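(* Let $A$ be an asymmetric fuzzy number, $F,G\in L^1(\mathbb{R}^n,\mathbb{C}_{\mathcal{F}(A)})$, $a\in\mathbb{C}$, $B\in\mathbb{C}_{\mathcal{F}(A)}$, and $x\in\mathbb{R}^n$. Write $\widehat{F}$ or $(F(\xi))^{\wedge}(\omega)$ for the Fourier transform of the function $\xi\mapsto F(\xi)$ at $\omega\in\mathbb{R}^n$. 1. $\widehat{F}:\mathbb{R}^n\to\mathbb{C}_{\mathcal{F}(A)}$ is continuous, $\|\widehat F\|_{\tilde\infty}\le\|F\|_{\tilde1}$, and $\widehat F(\omega)\to0$ as $|\omega|\to\infty$. 2. $\bigl(F(\xi/a)\bigr)^{\wedge}(\omega)=a^n\,\widehat F(a\,\omega)$. 3. $\bigl(e^{i\langle x,\xi\rangle}F(\xi)\bigr)^{\wedge}(\omega)=\widehat F(\omega-x)$. 4. $\bigl(F(\xi-x)\bigr)^{\wedge}(\omega)=e^{-i\langle x,\omega\rangle}\widehat F(\omega)$. 5. If $F\in C^1(\mathbb{R}^n,\mathbb{C}_{\mathcal{F}(A)})$ and $\frac{\partial}{\partial\xi_j}F\in L^1(\mathbb{R}^n,\mathbb{C}_{\mathcal{F}(A)})$, $j\in\{1,\dots,n\}$, then $\widehat{\frac{\partial}{\partial\xi_j}F}(\omega)=i\,\omega_j\,\widehat F(\omega)$ (where the factor $i$ is the imaginary unit). 6. If $\widehat F\in L^1(\mathbb{R}^n,\mathbb{C}_{\mathcal{F}(A)})$, then for almost every $\xi$ $$F(\xi)=\frac{1}{(2\pi)^n}\int_{\mathbb{R}^n}\widehat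 F(\omega)e^{i\langle\omega,\xi\rangle}\,d\omega.$$ 7. $(F\oplus B\odot G)^{\wedge}(\omega)=\widehat F(\omega)\oplus B\odot\widehat G(\omega)$. 8. $(F\star G)^{\wedge}(\omega)=\widehat F(\omega)\odot\widehat G(\omega)$, where $(F\star G)(\xi)=\int_{\mathbb{R}^n}F(z)\odot G(\xi-z)\,dz$. 9. If $F\in L^2(\mathbb{R}^n,\mathbb{C}_{\mathcal{F}(A)})$, then $\widehat F\in L^2(\mathbb{R}^n,\mathbb{C}_{\mathcal{F}(A)})$ and $\|\widehat F\|_{\tilde2}\le(2\pi)^{n/2}\sqrt2\,\|F\|_{\tilde2}$.
   Context: A fuzzy number is a function $A:\mathbb{R}\to[0,1]$ whose level sets $[A]_\alpha=\{x: A(x)\ge\alpha\}$ ($0<\alpha\le1$) and $[A]_0=\overline{\{x:A(x)>0\}}$ are all nonempty closed bounded intervals; sums and real multiples of fuzzy numbers are taken level-wise, and real numbers are identified with singletons. A complex fuzzy number is an expression $C+iD$ with $C,D$ fuzzy numbers. $A$ is asymmetric if for every $y\in\mathbb{R}$ there is $x_0\in\mathbb{R}$ with $A(y-x_0)\ne A(y+x_0)$. For $u,v\in\mathbb{C}$ put $u+vA:=(\mathrm{Re}\,u+(\mathrm{Re}\,v)A)+i(\mathrm{Im}\,u+(\mathrm{Im}\,v)A)$ and $\mathbb{C}_{\mathcal{F}(A)}:=\{u+vA: u,v\in\mathbb{C}\}$. For asymmetric $A$ the map $\psi(u,v)=u+vA$ is a bijection $\mathbb{C}^2\to\mathbb{C}_{\mathcal{F}(A)}$,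 and $\mathbb{C}_{\mathcal{F}(A)}$ is a two-dimensional complex vector space with operations transported by $\psi$: $(u+vA)\oplus(z+wA)=(u+z)+(v+w)A$, $\lambda(u+vA)=\lambda u+\lambda vA$, and $Z\ominus W=Z\oplus(-1)W$. Let $m(A)$ be the midpoint of the interval $[A]_1$. The $A$-cross product is $(u+vA)\odot(z+wA)=(uz-m(A)^2vw)+(uw+zv+2m(A)vw)A$. On $\mathbb{C}_{\mathcal{F}(A)}$, $\|u+vA\|_{\tilde p}=(|u+m(A)v|^p+|v|^p)^{1/p}$ for $1\le p<\infty$ and $\|u+vA\|_{\tilde\infty}=\max\{|u+m(A)v|,|v|\}$. A function $F=u+vA$ with $u,v$ complex-valued is integrable if $u$ and $v$ are, and then $\int F=\int u+(\int v)A$. For $1\le p<\infty$, $L^p(\mathbb{R}^n,\mathbb{C}_{\mathcal{F}(A)})$ is the set of (measurable) $F:\mathbb{R}^n\to\mathbb{C}_{\mathcal{F}(A)}$ with $\|F\|_{\tilde p}:=\bigl(\int_{\mathbb{R}^n}\|F(\omega)\|_{\tilde p}^p\,d\omega\bigr)^{1/p}<\infty$; for a function $H$, $\|H\|_{\tilde\infty}=\sup_\omega\|H(\omega)\|_{\tilde\infty}$. Partial derivatives are norm limits of difference quotients formed with $\ominus$, and $C^1(\mathbb{R}^n,\mathbb{C}_{\mathcal{F}(A)})$ is the set of continuously differentiable functions. The Fourier transform of $F\in L^1(\mathbb{R}^n,\mathbb{C}_{\mathcal{F}(A)})$ is $\widehat F:\mathbb{R}^n\to\mathbb{C}_{\mathcal{F}(A)}$,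 $\widehat F(\omega)=\int_{\mathbb{R}^n}F(\xi)e^{-i\langle\omega,\xi\rangle}\,d\xi$, with $\langle\cdot,\cdot\rangle$ the Euclidean inner product.
   Formalization: Item 2 is proved for real a ≠ 0 with the factor |a|^n, and with a^n whenever a^n > 0: for non-real a or a = 0, F(ξ/a) or F̂(aω) is undefined on R^n, and for a < 0 with n odd the printed factor a^n is wrong (e.g. n = 1, a = −1). *)

(* Defs.v *)
From HB Require Import structures.
From mathcomp Require Import all_boot all_order all_algebra.
From mathcomp Require Import all_classical all_reals all_analysis.
From mathcomp Require Import complex.

Set Implicit Arguments.
Unset Strict Implicit.
Unset Printing Implicit Defensive.

Import Order.TTheory GRing.Theory Num.Theory.
Import numFieldNormedType.Exports.

Local Open Scope classical_set_scope.
Local Open Scope ring_scope.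
Local Open Scope complex_scope.

Definition rV_display : measure_display. Proof. exact. Qed.

Section rV_measurable.
Context {R : realType} (n : nat).

Let coors (i : 'I_n) (x : 'rV[R]_n) : measurableTypeR R := x ord0 i.

Let rV_set0 : g_sigma_preimage coors set0.
Proof. exact: sigma_algebra0. Qed.

Let rV_setC A : g_sigma_preimage coors A -> g_sigma_preimage coors (~` A).
Proof. exact: sigma_algebraC. Qed.

Let rV_bigcup (F : (set 'rV[R]_n)^nat) :
  (forall i, g_sigma_preimage coors (F i)) ->
  g_sigma_preimage coors (\bigcup_i (F i)).
Proof. exact: sigma_algebra_bigcup. Qed.

(* The Borel sigma-algebra of R^n, generated by the coordinate maps. *)
HB.instance Definition _ := @isMeasurable.Build rV_display
  'rV[R]_n (g_sigma_preimage coors) rV_set0 rV_setC rV_bigcup.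

End rV_measurable.

Section rV_cons.
Context {R : realType}.

Definition rV_cons n (p : measurableTypeR R * 'rV[R]_n) : 'rV[R]_n.+1 :=
  \row_i oapp (p.2 ord0) p.1 (unlift ord0 i).

Definition rV_uncons n (x : 'rV[R]_n.+1) : measurableTypeR R * 'rV[R]_n :=
  (x ord0 ord0, \row_i x ord0 (lift ord0 i)).

Lemma rV_consK n : cancel (@rV_cons n) (@rV_uncons n).
Proof.
move=> [a x]; rewrite /rV_uncons /rV_cons !mxE unlift_none /=; congr pair.
by apply/rowP => i; rewrite !mxE liftK.
Qed.

Lemma measurable_rV_coord n (i : 'I_n) :
  measurable_fun [set: 'rV[R]_n] (fun x => x ord0 i : measurableTypeR R).
Proof.
move=> _ Y mY; rewrite setTI; apply: sub_sigma_algebra => /=.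
rewrite -bigcup_seq/=; exists i => /=; first by rewrite mem_index_enum.
by exists Y => //; rewrite setTI.
Qed.

Lemma measurable_fun_rV d (T : measurableType d) n (f : T -> 'rV[R]_n) :
  (forall i,
     measurable_fun [set: T] (fun t => f t ord0 i : measurableTypeR R)) ->
  measurable_fun [set: T] f.
Proof.
move=> mf _ Y mY; rewrite setTI; move: Y mY.
apply: (@smallest_sub _ _ _ [set Y | measurable (f @^-1` Y)]).
  split => /=; first by rewrite preimage_set0.
    by move=> A mA; rewrite setTD -preimage_setC; exact: measurableC.
  by move=> F mF; rewrite preimage_bigcup; exact: bigcup_measurable.
rewrite -bigcup_seq; apply: bigcup_sub => i _ _ [B mB <-] /=.
rewrite setTI -comp_preimage -[X in measurable X]setTI.
exact: mf.
Qed.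

Lemma measurable_rV_cons n : measurable_fun setT (@rV_cons n).
Proof.
apply: measurable_fun_rV => i.
case: (unliftP ord0 i) => [j|] ->.
  rewrite (_ : (fun _ => _) = (fun x : 'rV_n => x ord0 j : measurableTypeR R)
      \o snd); last by apply/funext => p /=; rewrite mxE liftK.
  by apply: measurableT_comp => //; exact: measurable_rV_coord.
rewrite (_ : (fun _ => _) = fst) //.
by apply/funext => p /=; rewrite mxE unlift_none.
Qed.

Lemma measurable_rV_uncons n : measurable_fun setT (@rV_uncons n).
Proof.
apply: measurable_fun_pair => /=; first exact: measurable_rV_coord.
apply: measurable_fun_rV => i.
rewrite (_ : (fun _ => _) =
  (fun x : 'rV[R]_n.+1 => x ord0 (lift ord0 i) : measurableTypeR R)).
  exact: measurable_rV_coord.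
by apply/funext => x; rewrite mxE.
Qed.

HB.instance Definition _ n :=
  @isMeasurableFun.Build _ _ _ _ (@rV_cons n) (@measurable_rV_cons n).

Section step.
Context n (mu : {sigma_finite_measure set 'rV[R]_n -> \bar R}).

Definition lebesgue_rV_step : set 'rV[R]_n.+1 -> \bar R :=
  pushforward (@lebesgue_measure R \x mu)%E (@rV_cons n).

Let lebesgue_rV_step0 : lebesgue_rV_step set0 = 0%E.
Proof. exact: (@measure0 _ _ _ (pushforward _ (@rV_cons n))). Qed.

Let lebesgue_rV_step_ge0 A : (0 <= lebesgue_rV_step A)%E.
Proof. exact: (@measure_ge0 _ _ _ (pushforward _ (@rV_cons n))). Qed.

Let lebesgue_rV_step_sigma_additive : semi_sigma_additive lebesgue_rV_step.
Proof.
exact: (@measure_semi_sigma_additive _ _ _ (pushforward _ (@rV_cons n))).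
Qed.

HB.instance Definition _ := isMeasure.Build _ _ _ lebesgue_rV_step
  lebesgue_rV_step0 lebesgue_rV_step_ge0 lebesgue_rV_step_sigma_additive.

Let sigma_finite_step : sigma_finite setT lebesgue_rV_step.
Proof.
have /sigma_finiteP[F [FT ndF Foo]] := sigma_finiteT (@lebesgue_measure R).
have /sigma_finiteP[G [GT ndG Goo]] := sigma_finiteT mu.
exists (fun k => @rV_uncons n @^-1` (F k `*` G k)).
  rewrite -preimage_bigcup (_ : \bigcup_k _ = setT) ?preimage_setT//.
  rewrite -subTset => -[x y] _.
  have [i _ Fx] : (\bigcup_k F k) x by rewrite -FT.
  have [j _ Gy] : (\bigcup_k G k) y by rewrite -GT.
  exists (maxn i j) => //; split => /=.
    by move: x Fx; exact/subsetPset/ndF/leq_maxl.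
  by move: y Gy; exact/subsetPset/ndG/leq_maxr.
move=> k; have [mF Fk_lty] := Foo k; have [mG Gk_lty] := Goo k; split.
  rewrite -[X in measurable X]setTI.
  by apply: measurable_rV_uncons => //; exact: measurableX.
rewrite /lebesgue_rV_step /pushforward -comp_preimage.
rewrite (_ : _ \o _ = id); last by apply/funext => p; exact: rV_consK.
by rewrite preimage_id product_measure1E// lte_mul_pinfty// ge0_fin_numE.
Qed.

HB.instance Definition _ :=
  Measure_isSigmaFinite.Build _ _ _ lebesgue_rV_step sigma_finite_step.

End step.
End rV_cons.

(* Lebesgue measure on R^n, by R^(n+1) = R * R^n. *)
Fixpoint lebesgue_rV (R : realType) n :
    {sigma_finite_measure set 'rV[R]_n -> \bar R} :=
  if n is m.+1 return {sigma_finite_measure set 'rV[R]_n -> \bar R}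
  then lebesgue_rV_step (lebesgue_rV R m) else dirac (0 : 'rV[R]_0).

Section fuzzy.
Context {R : realType}.
Implicit Types (A B : R -> R) (u v : R[i]).

Definition level A (alpha : R) : set R :=
  if alpha == 0 then closure [set x | 0 < A x] else [set x | alpha <= A x].

Definition fuzzy_number A : Prop :=
  (forall x, 0 <= A x <= 1) /\
  (forall alpha, 0 <= alpha <= 1 ->
    exists l r, l <= r /\ level A alpha = `[l, r]%classic).

Definition asymmetric A : Prop :=
  forall y, exists x0, A (y - x0) != A (y + x0).

(* The membership function with prescribed level sets; [sup set0 = 0], so it
   vanishes at the points lying in none of them. *)
Definition of_levels (L : R -> set R) : R -> R :=
  fun x => sup [set alpha | 0 < alpha <= 1 /\ L alpha x].

Definition fuzzy_add A B : R -> R :=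
  of_levels (fun alpha =>
    [set x + y | x in level A alpha & y in level B alpha]).

Definition fuzzy_scale (c : R) A : R -> R :=
  of_levels (fun alpha => [set c * x | x in level A alpha]).

Definition crisp (c : R) : R -> R := \1_[set c].

(* The pair [(C, D)] stands for the complex fuzzy number [C + iD]. *)
Definition psi A (uv : R[i] * R[i]) : (R -> R) * (R -> R) :=
  (fuzzy_add (crisp (complex.Re uv.1)) (fuzzy_scale (complex.Re uv.2) A),
   fuzzy_add (crisp (complex.Im uv.1)) (fuzzy_scale (complex.Im uv.2) A)).

Definition CFA A : Type := {Z : (R -> R) * (R -> R) | exists uv, psi A uv = Z}.

Definition lin A u v : CFA A :=
  exist _ (psi A (u, v)) (ex_intro _ (u, v) erefl).

(* For asymmetric [A], [psi A] is injective and these are the unique [u], [v]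
   such that [Z = u + vA]. *)
Definition coords A (Z : CFA A) : R[i] * R[i] := sval (cid (svalP Z)).
Definition ucoord A (Z : CFA A) : R[i] := (coords Z).1.
Definition vcoord A (Z : CFA A) : R[i] := (coords Z).2.

Definition mid A : R := (inf (level A 1) + sup (level A 1)) / 2.

End fuzzy.

Section operations.
Context {R : realType} {A : R -> R}.
Implicit Types Z W : CFA A.
Local Notation m := ((mid A)%:C).
Local Notation abs := ComplexField.Normc.normc.

Definition cfa0 : CFA A := lin A 0 0.

Definition cfa_add Z W : CFA A :=
  lin A (ucoord Z + ucoord W) (vcoord Z + vcoord W).

Definition cfa_scale (lambda : R[i]) Z : CFA A :=
  lin A (lambda * ucoord Z) (lambda * vcoord Z).

Definition cfa_sub Z W : CFA A := cfa_add Z (cfa_scale (-1) W).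

Definition cfa_cross Z W : CFA A :=
  lin A (ucoord Z * ucoord W - m ^+ 2 * (vcoord Z * vcoord W))
        (ucoord Z * vcoord W + ucoord W * vcoord Z
           + 2 * m * (vcoord Z * vcoord W)).

Definition pnorm (p : R) Z : R :=
  (abs (ucoord Z + m * vcoord Z) `^ p + abs (vcoord Z) `^ p) `^ p^-1.

Definition inftynorm Z : R :=
  Num.max (abs (ucoord Z + m * vcoord Z)) (abs (vcoord Z)).

(* Convergence in norm; the norms above are all equivalent. *)
Definition cfa_cvg {T : Type} (FF : set_system T) (H : T -> CFA A) (L : CFA A)
    : Prop :=
  (fun t => inftynorm (cfa_sub (H t) L)) @ FF --> (0 : R).

End operations.

Arguments cfa0 {R A}.

Declare Scope cfa_scope.
Delimit Scope cfa_scope with CFA.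
Notation "Z (+) W" := (cfa_add Z W)
  (at level 50, left associativity) : cfa_scope.
Notation "Z (-) W" := (cfa_sub Z W)
  (at level 50, left associativity) : cfa_scope.
Notation "Z (.) W" := (cfa_cross Z W)
  (at level 40, left associativity) : cfa_scope.

Section functions.
Context {R : realType} {n : nat} {A : R -> R}.
Local Notation E := 'rV[R]_n.
Implicit Types (F G H : E -> CFA A) (f : E -> R[i]) (x w xi : E).

Definition dot x w : R := \sum_i x ord0 i * w ord0 i.
Definition enorm x : R := Num.sqrt (dot x x).

(* [|w| --> oo] *)
Definition at_infinity : set_system E :=
  [set P | exists M : R, forall w, M < enorm w -> P w].

Definition expi (theta : R) : R[i] := cos theta +i* sin theta.

Definition cmeasurable f : Prop :=
  measurable_fun setT (fun x => complex.Re (f x)) /\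
  measurable_fun setT (fun x => complex.Im (f x)).

Definition cintegrable f : Prop :=
  (lebesgue_rV R n).-integrable setT (fun x => (complex.Re (f x))%:E) /\
  (lebesgue_rV R n).-integrable setT (fun x => (complex.Im (f x))%:E).

Definition cintegral f : R[i] :=
  (\int[lebesgue_rV R n]_x complex.Re (f x))
    +i* (\int[lebesgue_rV R n]_x complex.Im (f x)).

Definition fmeasurable F : Prop :=
  cmeasurable (@ucoord R A \o F) /\ cmeasurable (@vcoord R A \o F).

Definition fintegrable F : Prop :=
  cintegrable (@ucoord R A \o F) /\ cintegrable (@vcoord R A \o F).

Definition fintegral F : CFA A :=
  lin A (cintegral (@ucoord R A \o F)) (cintegral (@vcoord R A \o F)).

Definition fLnorm (p : R) F : \bar R :=
  Lnorm (lebesgue_rV R n) p%:E (fun x => (pnorm p (F x))%:E).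

Definition Lpspace (p : R) F : Prop := fmeasurable F /\ (fLnorm p F < +oo)%E.

Definition supnorm H : \bar R :=
  ereal_sup (range (fun w => (inftynorm (H w))%:E)).

Definition fcontinuous F : Prop := forall x, cfa_cvg (nbhs x) F (F x).

Definition is_partial (j : 'I_n) F (dF : E -> CFA A) : Prop :=
  forall xi, cfa_cvg (0^' : set_system R)
    (fun t => cfa_scale (t^-1)%:C
                (cfa_sub (F (xi + t *: delta_mx ord0 j)) (F xi)))
    (dF xi).

Definition C1 F : Prop :=
  exists dF : 'I_n -> E -> CFA A,
    forall j, is_partial j F (dF j) /\ fcontinuous (dF j).

Definition fourier F : E -> CFA A :=
  fun w => fintegral (fun xi => cfa_scale (expi (- dot w xi)) (F xi)).

Definition convolution F G : E -> CFA A :=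
  fun xi => fintegral (fun z => cfa_cross (F z) (G (xi - z))).

End functions.

(* Main.v *)
Require Import Defs.
From mathcomp Require Import all_boot all_order all_algebra.
From mathcomp Require Import all_classical all_reals all_analysis measurable_realfun.
From mathcomp Require Import complex ring lra.
Import Order.TTheory GRing.Theory Num.Theory.
Import numFieldNormedType.Exports.
Set Implicit Arguments.
Unset Strict Implicit.
Unset Printing Implicit Defensive.
Local Open Scope classical_set_scope.
Local Open Scope ring_scope.
Local Open Scope complex_scope.
Local Open Scope cfa_scope.

(** Everything reduces to scalar Fourier analysis. Asymmetry of A makes the
    coordinates u and v of u + vA well defined: two fuzzy numbers c + dA and
    c' + d'A that agree, with d and d' nonzero, exhibit an affine map leaving A
    invariant, hence permuting the end points of all its level intervals; such a
    map is the identity, or a reflection, or collapses every level set to one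
    point, and the last two are excluded by asymmetry ([psi_inj]). All operations
    are then complex linear or bilinear in (u, v), the transform acts on u and v
    separately ([ucoord_fourier], [vcoord_fourier]), and in the coordinates
    u + mid A * v and v the norms are plain lp norms. So each assertion follows
    from its counterpart for a complex function f integrable on R^n and its
    transform [fhat f].

    Translation, modulation, dilation and convolution are changes of variables
    and Fubini. For partial derivatives, the increment of f along a segment is the
    integral of the partial derivative, and Fubini turns this into the identity
    [fhat_partial].

    The remaining three theorems rest on one computation on the line: the
    transform of exp(- e |x|) is the Poisson kernel 2 e / (e^2 + x^2), of integral
    2 pi ([cint_abel]). Take products over the coordinates. The multiplication
    formula, that is Fubini, shows that inserting the Abel weight exp(- e |w|_1)
    in the inverse Fourier integral of [fhat f] produces the Poisson means of f
    ([abel_inverse]).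

    - Square norms: the integral of |fhat f|^2 with the Abel weight is the
      Poisson quadratic form of f, which is at most (2 pi)^n times the square norm
      of f since the kernel has mass (2 pi)^n ([poisson_form_le]). Monotone
      convergence removes the weight ([plancherel_le]).
    - Vanishing at infinity: for f square-integrable, [fhat f] is uniformly
      continuous and, by the previous point, square-integrable, so it tends to
      zero; truncating the values of an integrable f reduces to this case
      ([riemann_lebesgue]).
    - Inversion: integrate the Abel means of the inverse integral over a box. By
      Fubini only the Poisson means of the box occur, and these are explicit
      products of differences of arctangents, converging off the faces of the box
      ([inversion_box]). Integrals over boxes determine a function almost
      everywhere ([box_determine]). *)

Local Notation normc := ComplexField.Normc.normc.
Local Notation Re := complex.Re.
Local Notation Im := complex.Im.

(** * Complex numbers *)

Section complex_numbers.
Context {R : realType}.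
Implicit Types z w : R[i].

Lemma ReD z w : Re (z + w) = Re z + Re w. Proof. by case: z w => a b [c d]. Qed.
Lemma ImD z w : Im (z + w) = Im z + Im w. Proof. by case: z w => a b [c d]. Qed.
Lemma ReN z : Re (- z) = - Re z. Proof. by case: z. Qed.
Lemma ImN z : Im (- z) = - Im z. Proof. by case: z. Qed.
Lemma ReM z w : Re (z * w) = Re z * Re w - Im z * Im w.
Proof. by case: z w => a b [c d]. Qed.
Lemma ImM z w : Im (z * w) = Re z * Im w + Im z * Re w.
Proof. by case: z w => a b [c d]. Qed.
Lemma ReC (r : R) : Re r%:C = r. Proof. by []. Qed.
Lemma ImC (r : R) : Im r%:C = 0. Proof. by []. Qed.
Lemma ReJ z : Re z^*%C = Re z. Proof. by case: z. Qed.
Lemma ImJ z : Im z^*%C = - Im z. Proof. by case: z. Qed.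

Definition ReImE := (ReD, ImD, ReN, ImN, ReM, ImM, ReC, ImC, ReJ, ImJ).

Lemma complexP z w : Re z = Re w -> Im z = Im w -> z = w.
Proof. by case: z w => a b [c d] /= -> ->. Qed.

Lemma normc_ge0 z : 0 <= normc z.
Proof. by case: z => a b /=; rewrite sqrtr_ge0. Qed.

Lemma normcS z : normc z ^+ 2 = Re z ^+ 2 + Im z ^+ 2.
Proof. by case: z => a b /=; rewrite sqr_sqrtr// addr_ge0// sqr_ge0. Qed.

Lemma normr_normc z : `|normc z| = normc z.
Proof. by rewrite ger0_norm// normc_ge0. Qed.

Lemma Re_le_normc z : `|Re z| <= normc z.
Proof.
rewrite -ler_sqr ?nnegrE ?normc_ge0// real_normK ?num_real//.
by rewrite normcS lerDl sqr_ge0.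
Qed.

Lemma Im_le_normc z : `|Im z| <= normc z.
Proof.
rewrite -ler_sqr ?nnegrE ?normc_ge0// real_normK ?num_real//.
by rewrite normcS lerDr sqr_ge0.
Qed.

Lemma normc_le_ReIm z : normc z <= `|Re z| + `|Im z|.
Proof.
rewrite -ler_sqr ?nnegrE ?normc_ge0 ?addr_ge0//.
by rewrite normcS sqrrD !real_normK ?num_real// addrAC lerDl mulrn_wge0// mulr_ge0.
Qed.

Lemma normcM z w : normc (z * w) = normc z * normc w.
Proof. exact: ComplexField.Normc.normcM. Qed.

Lemma normc_tri z w : normc (z + w) <= normc z + normc w.
Proof. exact: le_normcD. Qed.

Lemma normc_opp z : normc (- z) = normc z.
Proof. by case: z => a b /=; rewrite !sqrrN. Qed.

Lemma normcC (r : R) : normc r%:C = `|r|.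
Proof. by rewrite /= expr0n addr0 sqrtr_sqr. Qed.

Lemma normc_conj z : normc z^*%C = normc z.
Proof. by case: z => a b /=; rewrite sqrrN. Qed.

Lemma conjM z w : (z * w)^*%C = z^*%C * w^*%C.
Proof. by apply: complexP; rewrite !ReImE; ring. Qed.

Lemma normc00 : normc (0 : R[i]) = 0.
Proof. exact: ComplexField.Normc.normc0. Qed.

Lemma mulJc z : z^*%C * z = (normc z ^+ 2)%:C.
Proof.
by apply: complexP; rewrite !ReImE ?normcS; [|]; rewrite ?expr2; ring.
Qed.

Lemma normc_sqrD z w : normc (z + w) ^+ 2 <= 2 * normc z ^+ 2 + 2 * normc w ^+ 2.
Proof.
have := normc_tri z w; have := normc_ge0 (z + w).
have := normc_ge0 z; have := normc_ge0 w => *.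
have h : normc (z + w) ^+ 2 <= (normc z + normc w) ^+ 2.
  by rewrite ler_sqr ?nnegrE// addr_ge0.
apply: (le_trans h); have := sqr_ge0 (normc z - normc w); nra.
Qed.

Lemma expi0 : expi 0 = 1 :> R[i].
Proof. by rewrite /expi cos0 sin0. Qed.

Lemma expiD (s t : R) : expi (s + t) = expi s * expi t :> R[i].
Proof. by apply: complexP; rewrite /= ?cosD// sinD addrC [_ * cos t]mulrC mulrC. Qed.

Lemma expiN (t : R) : expi (- t) = (expi t)^*%C.
Proof. by rewrite /expi cosN sinN. Qed.

Lemma normc_expi (t : R) : normc (expi t) = 1.
Proof. by rewrite /= cos2Dsin2 sqrtr1. Qed.

End complex_numbers.

(** * Complex-valued integrals *)

Section cfun.
Context {d : measure_display} {T : measurableType d} {R : realType}.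
Implicit Types (f g : T -> R[i]) (h : T -> R) (mu : {measure set T -> \bar R}).

(** Complex measurability, integrability and integrals are taken over an
    arbitrary measure space because the Fubini arguments integrate over products
    of two copies of R^n, or of the line and R^n. Over [lebesgue_rV R n] they are
    convertible to [cmeasurable], [cintegrable] and [cintegral]. *)
Definition cmfun f := measurable_fun setT (fun x => Re (f x)) /\
                      measurable_fun setT (fun x => Im (f x)).

Definition cL1 mu f := mu.-integrable setT (fun x => (Re (f x))%:E) /\
                       mu.-integrable setT (fun x => (Im (f x))%:E).

Definition cint mu f : R[i] :=
  (\int[mu]_x Re (f x)) +i* (\int[mu]_x Im (f x)).

Lemma cmfun_normc f : cmfun f -> measurable_fun setT (fun x => normc (f x)).
Proof.
move=> [mr mi].
rewrite (_ : (fun _ => _) =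
  fun x => Num.sqrt (Re (f x) ^+ 2 + Im (f x) ^+ 2)); last first.
  by apply/funext => x; case: (f x).
apply: (@measurableT_comp _ _ _ _ _ _ (@Num.sqrt R)) => //.
  by apply: continuous_measurable_fun; exact: sqrt_continuous.
by apply: measurable_funD; exact: measurable_funX.
Qed.

Lemma cmfunD f g : cmfun f -> cmfun g -> cmfun (fun x => f x + g x).
Proof.
move=> [fr fi] [gr gi]; split.
  by under eq_fun do rewrite ReD; exact: measurable_funD.
by under eq_fun do rewrite ImD; exact: measurable_funD.
Qed.

Lemma cmfunN f : cmfun f -> cmfun (fun x => - f x).
Proof.
move=> [fr fi]; split.
  by under eq_fun do rewrite ReN; exact: measurableT_comp.
by under eq_fun do rewrite ImN; exact: measurableT_comp.
Qed.

Lemma cmfunB f g : cmfun f -> cmfun g -> cmfun (fun x => f x - g x).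
Proof. by move=> mf mg; apply: cmfunD => //; exact: cmfunN. Qed.

Lemma cmfunM f g : cmfun f -> cmfun g -> cmfun (fun x => f x * g x).
Proof.
move=> [fr fi] [gr gi]; split.
  under eq_fun do rewrite ReM.
  by apply: measurable_funB; exact: measurable_funM.
under eq_fun do rewrite ImM.
by apply: measurable_funD; exact: measurable_funM.
Qed.

Lemma cmfun_cst (c : R[i]) : cmfun (fun _ => c).
Proof. by split; exact: measurable_cst. Qed.

Lemma cmfunC h : measurable_fun setT h -> cmfun (fun x => (h x)%:C).
Proof. by move=> mh; split => //=. Qed.

Lemma cmfunJ f : cmfun f -> cmfun (fun x => (f x)^*%C).
Proof.
move=> [fr fi]; split; first by under eq_fun do rewrite ReJ.
by under eq_fun do rewrite ImJ; exact: measurableT_comp.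
Qed.

Lemma cmfun_expi h : measurable_fun setT h -> cmfun (fun x => expi (h x)).
Proof.
move=> mh; split => /=.
  apply: (@measurableT_comp _ _ _ _ _ _ (@cos R)) => //.
  by apply: continuous_measurable_fun; exact: continuous_cos.
apply: (@measurableT_comp _ _ _ _ _ _ (@sin R)) => //.
by apply: continuous_measurable_fun; exact: continuous_sin.
Qed.

Lemma cL1_cmfun mu f : cL1 mu f -> cmfun f.
Proof.
by move=> [/measurable_int/measurable_EFinP ? /measurable_int/measurable_EFinP ?].
Qed.

Lemma cL1_le mu f h : cmfun f -> mu.-integrable setT (EFin \o h) ->
  (forall x, normc (f x) <= h x) -> cL1 mu f.
Proof.
move=> [mr mi] ih le_fh; split; apply: le_integrable ih => //.
- exact/measurable_EFinP.
- move=> x _ /=; rewrite lee_fin (le_trans (Re_le_normc _))//.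
  by rewrite (le_trans (le_fh x))// ler_norm.
- exact/measurable_EFinP.
- move=> x _ /=; rewrite lee_fin (le_trans (Im_le_normc _))//.
  by rewrite (le_trans (le_fh x))// ler_norm.
Qed.

Lemma cL1_normc mu f : cL1 mu f -> mu.-integrable setT (fun x => (normc (f x))%:E).
Proof.
move=> L1f; have [ir ii] := L1f; have mf := cL1_cmfun L1f.
have := integrableD measurableT (integrable_abse ir) (integrable_abse ii).
apply: le_integrable => //.
  by apply/measurable_EFinP; exact: cmfun_normc.
move=> x _ /=; rewrite lee_fin normr_normc.
by rewrite (le_trans (normc_le_ReIm _))// ler_norm.
Qed.

Lemma cL1P mu f : cL1 mu f <->
  cmfun f /\ (\int[mu]_x (normc (f x))%:E < +oo)%E.
Proof.
split=> [L1f|[mf foo]].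
  split; first exact: cL1_cmfun L1f.
  have /integrableP[_] := cL1_normc L1f.
  by under eq_integral do rewrite gee0_abs ?lee_fin ?normc_ge0//.
apply: (@cL1_le _ _ (fun x => normc (f x))) => //.
apply/integrableP; split; first by apply/measurable_EFinP; exact: cmfun_normc.
by under eq_integral do rewrite gee0_abs ?lee_fin ?normc_ge0//.
Qed.

Lemma cL1_le_cL1 mu f g : cmfun f -> cL1 mu g ->
  (forall x, normc (f x) <= normc (g x)) -> cL1 mu f.
Proof. by move=> mf /cL1_normc ig; exact: cL1_le. Qed.

Lemma cL1D mu f g : cL1 mu f -> cL1 mu g -> cL1 mu (fun x => f x + g x).
Proof.
move=> [fr fi] [gr gi]; split.
  by under eq_fun do rewrite ReD EFinD; exact: integrableD.
by under eq_fun do rewrite ImD EFinD; exact: integrableD.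
Qed.

Lemma cL1Ml mu f (c : R[i]) : cL1 mu f -> cL1 mu (fun x => c * f x).
Proof.
move=> L1f; have mf := cL1_cmfun L1f.
apply: (@cL1_le _ _ (fun x => normc c * normc (f x))).
- by apply: cmfunM => //; exact: cmfun_cst.
- have := integrableZl measurableT (normc c) (cL1_normc L1f).
  by under eq_fun do rewrite -EFinM.
- by move=> x; rewrite normcM.
Qed.

Lemma cL1N mu f : cL1 mu f -> cL1 mu (fun x => - f x).
Proof. by move=> /(cL1Ml (-1)); under eq_fun do rewrite mulN1r. Qed.

Lemma cL1B mu f g : cL1 mu f -> cL1 mu g -> cL1 mu (fun x => f x - g x).
Proof. by move=> L1f L1g; apply: cL1D => //; exact: cL1N. Qed.

Lemma cL1C mu h : mu.-integrable setT (EFin \o h) -> cL1 mu (fun x => (h x)%:C).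
Proof. by move=> ih; split => //=; exact: integrable0. Qed.

Lemma cL1_mod mu f g : cmfun g -> (forall x, normc (g x) <= 1) ->
  cL1 mu f -> cL1 mu (fun x => g x * f x).
Proof.
move=> mg g1 L1f; apply: (cL1_le_cL1 _ L1f).
  by apply: cmfunM => //; exact: cL1_cmfun L1f.
by move=> x; rewrite normcM ler_piMl// normc_ge0.
Qed.

Lemma cL1_expi mu f h : measurable_fun setT h -> cL1 mu f ->
  cL1 mu (fun x => expi (h x) * f x).
Proof.
move=> mh; apply: cL1_mod; first exact: cmfun_expi.
by move=> x; rewrite normc_expi.
Qed.

Lemma eq_cint mu f g : f =1 g -> cint mu f = cint mu g.
Proof. by move=> /funext ->. Qed.

Lemma cintD mu f g : cL1 mu f -> cL1 mu g ->
  cint mu (fun x => f x + g x) = cint mu f + cint mu g.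
Proof.
move=> [fr fi] [gr gi]; apply: complexP => /=.
  by under eq_Rintegral do rewrite ReD; rewrite RintegralD.
by under eq_Rintegral do rewrite ImD; rewrite RintegralD.
Qed.

Lemma cintMl mu f (c : R[i]) : cL1 mu f ->
  cint mu (fun x => c * f x) = c * cint mu f.
Proof.
move=> [fr fi]; apply: complexP; rewrite ?ReM ?ImM.
  transitivity (\int[mu]_x (Re c * Re (f x) - Im c * Im (f x))).
    by apply: eq_Rintegral => x _; rewrite ReM.
  rewrite RintegralB ?RintegralZl//.
    exact: (integrableZl measurableT _ fr).
  exact: (integrableZl measurableT _ fi).
transitivity (\int[mu]_x (Re c * Im (f x) + Im c * Re (f x))).
  by apply: eq_Rintegral => x _; rewrite ImM.
rewrite RintegralD ?RintegralZl//.
  exact: (integrableZl measurableT _ fi).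
exact: (integrableZl measurableT _ fr).
Qed.

Lemma cintN mu f : cL1 mu f -> cint mu (fun x => - f x) = - cint mu f.
Proof.
by move=> L1f; under eq_cint do rewrite -mulN1r; rewrite cintMl// mulN1r.
Qed.

Lemma cintB mu f g : cL1 mu f -> cL1 mu g ->
  cint mu (fun x => f x - g x) = cint mu f - cint mu g.
Proof. by move=> L1f L1g; rewrite cintD ?cintN//; exact: cL1N. Qed.

Lemma cintMr mu f (c : R[i]) : cL1 mu f ->
  cint mu (fun x => f x * c) = cint mu f * c.
Proof. by move=> L1f; under eq_cint do rewrite mulrC; rewrite cintMl// mulrC. Qed.

Lemma cintJ mu f : cL1 mu f -> cint mu (fun x => (f x)^*%C) = (cint mu f)^*%C.
Proof.
move=> [fr fi]; apply: complexP; rewrite ?ReJ ?ImJ.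
  by apply: eq_Rintegral => x _; rewrite ReJ.
transitivity (\int[mu]_x (-1 * Im (f x))).
  by apply: eq_Rintegral => x _; rewrite ImJ mulN1r.
by rewrite RintegralZl// mulN1r.
Qed.

Lemma cintC mu h : cint mu (fun x => (h x)%:C) = (\int[mu]_x h x)%:C.
Proof.
apply: complexP => //=; rewrite /Rintegral /=.
by rewrite integral0.
Qed.

Lemma ae_eq_cint mu f g : cmfun f -> cmfun g ->
  (\forall x \ae mu, f x = g x) -> cint mu f = cint mu g.
Proof.
move=> [fr fi] [gr gi] fg; apply: complexP => /=; congr fine;
  apply: ae_eq_integral => //; try exact/measurable_EFinP;
  by apply: filterS fg => x -> _.
Qed.

(** Rotating the integral onto the positive axis reduces the triangle
    inequality to the monotonicity of the real integral. *)
Lemma normc_cint_le mu f : cL1 mu f ->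
  normc (cint mu f) <= \int[mu]_x normc (f x).
Proof.
move=> L1f; have Rge0 : 0 <= \int[mu]_x normc (f x).
  by apply: Rintegral_ge0 => x _; exact: normc_ge0.
have [->|z0] := eqVneq (cint mu f) 0; first by rewrite normc00.
set z := cint mu f in z0 *; pose c := z^*%C.
have nz0 : 0 < normc z.
  rewrite lt_neqAle normc_ge0 andbT eq_sym.
  by apply: contra z0 => /eqP/ComplexField.Normc.eq0_normc ->.
rewrite -(ler_pM2l nz0) -expr2.
have -> : normc z ^+ 2 = Re (cint mu (fun x => c * f x)).
  by rewrite cintMl// -/z /c mulJc.
rewrite /= -RintegralZl//; last exact: cL1_normc.
apply: le_Rintegral => //.
- by case: (cL1Ml c L1f).
- exact: (integrableZl measurableT _ (cL1_normc L1f)).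
- move=> x _; rewrite (le_trans (ler_norm _))// (le_trans (Re_le_normc _))//.
  by rewrite normcM normc_conj.
Qed.

Lemma normc_cint_lee mu f : cL1 mu f ->
  ((normc (cint mu f))%:E <= \int[mu]_x (normc (f x))%:E)%E.
Proof.
move=> L1f; rewrite -[leRHS]fineK; last first.
  by apply: integrable_fin_num => //; exact: cL1_normc.
by rewrite lee_fin; exact: normc_cint_le.
Qed.

End cfun.

Lemma cmfun_comp {R : realType} d d' (T : measurableType d)
    (T' : measurableType d') (phi : T -> T') (f : T' -> R[i]) :
  measurable_fun setT phi -> cmfun f -> cmfun (fun x => f (phi x)).
Proof.
by move=> mphi [fr fi]; split;
  [exact: (measurableT_comp fr)|exact: (measurableT_comp fi)].
Qed.

Section limits.
Context {d : measure_display} {T : measurableType d} {R : realType}.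
Variable mu : {measure set T -> \bar R}.

Lemma integrable_EFin_le (h g : T -> R) : measurable_fun setT h ->
  mu.-integrable setT (EFin \o g) -> (forall x, `|h x| <= g x) ->
  mu.-integrable setT (EFin \o h).
Proof.
move=> mh ig hg; apply: le_integrable ig => //; first exact/measurable_EFinP.
by move=> x _; rewrite /= lee_fin (le_trans (hg x))// ler_norm.
Qed.

Lemma integrable_EFinD (f g : T -> R) : mu.-integrable setT (EFin \o f) ->
  mu.-integrable setT (EFin \o g) ->
  mu.-integrable setT (EFin \o (fun x => f x + g x)).
Proof. by move=> i_f i_g; have := integrableD measurableT i_f i_g. Qed.

Lemma integrable_EFinZ (c : R) (f : T -> R) : mu.-integrable setT (EFin \o f) ->
  mu.-integrable setT (EFin \o (fun x => c * f x)).
Proof. by move=> i_f; have := integrableZl measurableT c i_f. Qed.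

Lemma Rdominated_cvg (h_ : nat -> T -> R) (h g : T -> R) :
  (forall k, measurable_fun setT (h_ k)) -> measurable_fun setT h ->
  (\forall x \ae mu, h_ ^~ x @ \oo --> h x) ->
  mu.-integrable setT (EFin \o g) ->
  (forall k x, `|h_ k x| <= g x) ->
  (fun k => \int[mu]_x h_ k x) @ \oo --> \int[mu]_x h x.
Proof.
move=> mh_ mh cv ig le_hg.
have [|||||ih _ cvi] := @dominated_convergence _ _ _ mu setT measurableT
    (fun k x => (h_ k x)%:E) (fun x => (h x)%:E) (fun x => (g x)%:E).
- by move=> k; exact/measurable_EFinP.
- exact/measurable_EFinP.
- by apply: filterS cv => x hx _; apply/fine_cvgP; split => //;
  exact: nearW.
- exact: ig.
- by apply: aeW => x k _; rewrite lee_fin.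
by move: cvi; rewrite -(fineK (integrable_fin_num measurableT ih)) => /fine_cvgP[].
Qed.

Lemma cdominated_cvg (f_ : nat -> T -> R[i]) (f : T -> R[i]) (g : T -> R) :
  (forall k, cmfun (f_ k)) -> cmfun f ->
  (\forall x \ae mu, (fun k => normc (f_ k x - f x)) @ \oo --> (0 : R)) ->
  mu.-integrable setT (EFin \o g) ->
  (forall k x, normc (f_ k x) <= g x) -> (forall x, normc (f x) <= g x) ->
  (fun k => normc (cint mu (f_ k) - cint mu f)) @ \oo --> (0 : R).
Proof.
move=> mf_ mf cv ig le_f_g le_fg.
have L1f_ k : cL1 mu (f_ k) by exact: (@cL1_le _ _ _ _ _ g).
have L1f : cL1 mu f by exact: (@cL1_le _ _ _ _ _ g).
have cv0 : (fun k => \int[mu]_x normc (f_ k x - f x)) @ \oo --> (0 : R).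
  have -> : (0 : R) = \int[mu]_x ((fun=> 0) x).
    by rewrite Rintegral_cst// mul0r.
  apply: (@Rdominated_cvg _ _ (fun x => 2 * g x)) => //.
  - by move=> k; apply: cmfun_normc; exact: cmfunB.
  - exact: (integrableZl measurableT 2 ig).
  - move=> k x; rewrite normr_normc (le_trans (normc_tri _ _))// normc_opp.
    by rewrite mulr_natl mulr2n lerD.
apply: (squeeze_cvgr _ (cvg_cst 0) cv0); apply: nearW => k.
by rewrite normc_ge0 -cintB//= normc_cint_le//; exact: cL1B.
Qed.

End limits.

Section complex_limits.
Context {R : realType}.
Implicit Types (a b : nat -> R[i]) (l : R[i]).

Lemma ccvg_unique {F : set_system nat} {FF : ProperFilter F} a l l' :
  (fun k => normc (a k - l)) @ F --> (0 : R) ->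
  (fun k => normc (a k - l')) @ F --> (0 : R) -> l = l'.
Proof.
move=> al al'.
have h : (fun k => normc (a k - l) + normc (a k - l')) @ F --> (0 : R).
  by rewrite -[0]addr0; exact: cvgD.
have : (fun _ : nat => normc (l - l')) @ F --> (0 : R).
  apply: (squeeze_cvgr _ (cvg_cst 0) h); apply: nearW => k.
  rewrite normc_ge0/= (_ : l - l' = - (a k - l) + (a k - l')); last by ring.
  by rewrite (le_trans (normc_tri _ _))// normc_opp.
move=> /(cvg_unique (@norm_hausdorff _ _) (cvg_cst _)).
by move=> /ComplexField.Normc.eq0_normc/eqP; rewrite subr_eq0 => /eqP.
Qed.

End complex_limits.

Section fubini.
Context {d1 d2 : measure_display} {T1 : measurableType d1}
  {T2 : measurableType d2} {R : realType}.
Variables (m1 : {sigma_finite_measure set T1 -> \bar R})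
          (m2 : {sigma_finite_measure set T2 -> \bar R}).
Local Notation m12 := (m1 \x m2)%E.

Lemma measurable_Rint1 (h : T1 * T2 -> R) : measurable_fun setT h ->
  measurable_fun setT (fun x => \int[m2]_y h (x, y)).
Proof.
move=> mh; apply: (@measurableT_comp _ _ _ _ _ _ (@fine R)).
  exact: fine_measurable.
have mE : measurable_fun setT (EFin \o h) by exact/measurable_EFinP.
rewrite (_ : (fun _ => _) = (fun x => fubini_F m2 (EFin \o h)^\+ x -
    fubini_F m2 (EFin \o h)^\- x)%E); last first.
  apply/funext => x; rewrite /fubini_F.
  transitivity (\int[m2]_y ((EFin \o h) \o pair x) y)%E => //.
  by rewrite [LHS]integralE funepos_comp funeneg_comp.
by apply: emeasurable_funB; apply: measurable_fun_fubini_tonelli_F => //;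
  [exact: measurable_funepos|exact: measurable_funeneg].
Qed.

Lemma cmfun_cint1 (f : T1 * T2 -> R[i]) : cmfun f ->
  cmfun (fun x => cint m2 (fun y => f (x, y))).
Proof.
move=> [fr fi]; split; first exact: (measurable_Rint1 fr).
exact: (measurable_Rint1 fi).
Qed.

Lemma Rfubini1 (h : T1 * T2 -> R) : m12.-integrable setT (EFin \o h) ->
  m1.-integrable setT (fun x => (\int[m2]_y h (x, y))%:E) /\
  \int[m1]_x \int[m2]_y h (x, y) = \int[m12]_p h p.
Proof.
move=> ih; have mh : measurable_fun setT h.
  by move/measurable_int : ih => /measurable_EFinP.
have ae12 := ae_integrable1 ih.
have iF := integrable_fubini_F ih.
have mF := measurable_int _ iF.
have mR : measurable_fun setT (fun x => (\int[m2]_y h (x, y))%:E).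
  by apply/measurable_EFinP; exact: measurable_Rint1.
have aeE : ae_eq m1 setT (fubini_F m2 (EFin \o h))
    (fun x => (\int[m2]_y h (x, y))%:E).
  by apply: filterS ae12 => x ix _; rewrite /fubini_F /Rintegral fineK//;
    exact: integrable_fin_num.
split; last by rewrite /Rintegral -(integral12_prod_meas1 ih);
  congr fine; apply: ae_eq_integral => //; exact: ae_eq_sym.
apply/integrableP; split => //.
have /integrableP[_] := iF; apply: le_lt_trans.
rewrite (ae_eq_integral (fun x => `|fubini_F m2 (EFin \o h) x|)%E)//.
- exact: measurableT_comp.
- exact: measurableT_comp.
- by apply: filterS aeE => x /[apply] ->.
Qed.

Lemma Rfubini2 (h : T1 * T2 -> R) : m12.-integrable setT (EFin \o h) ->
  m2.-integrable setT (fun y => (\int[m1]_x h (x, y))%:E) /\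
  \int[m2]_y \int[m1]_x h (x, y) = \int[m12]_p h p.
Proof.
move=> ih; have mh : measurable_fun setT h.
  by move/measurable_int : ih => /measurable_EFinP.
have ae12 := ae_integrable2 ih.
have mF := measurable_fubini_G ih.
have aeE : ae_eq m2 setT (fubini_G m1 (EFin \o h))
    (fun x => (\int[m1]_y h (y, x))%:E).
  by apply: filterS ae12 => x ix _; rewrite /fubini_G /Rintegral fineK//;
    exact: integrable_fin_num.
have mR : measurable_fun setT (fun x => (\int[m1]_y h (y, x))%:E).
  apply/measurable_EFinP; apply: (@measurableT_comp _ _ _ _ _ _ (@fine R)) => //.
split; last by rewrite /Rintegral -(integral21_prod_meas1 ih);
  congr fine; apply: ae_eq_integral => //; exact: ae_eq_sym.
apply/integrableP; split => //.
have := (integrable21ltyP m1 m2 (measurable_int _ ih)).1 ih; apply: le_lt_trans.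
rewrite (ae_eq_integral (fun x => `|fubini_G m1 (EFin \o h) x|)%E)//; last 3 first.
- exact: measurableT_comp.
- exact: measurableT_comp.
- by apply: filterS aeE => x /[apply] ->.
have mh' : measurable_fun setT (fun p => `|(h p)%:E|%E).
  by apply: measurableT_comp => //; exact: measurable_int ih.
apply: ge0_le_integral => //.
- exact: measurableT_comp.
- exact: (@measurable_fun_fubini_tonelli_G _ _ _ _ _ m1 _ mh').
- move=> y _; apply: le_abse_integral => //.
  by apply: measurableT_comp => //; exact: measurable_int ih.
Qed.

Lemma cfubini1 (f : T1 * T2 -> R[i]) : cL1 m12 f ->
  cL1 m1 (fun x => cint m2 (fun y => f (x, y))) /\
  cint m1 (fun x => cint m2 (fun y => f (x, y))) = cint m12 f.
Proof.
move=> [/Rfubini1[ir er] /Rfubini1[ii ei]]; split; first by split.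
by apply: complexP.
Qed.

Lemma cfubini2 (f : T1 * T2 -> R[i]) : cL1 m12 f ->
  cL1 m2 (fun y => cint m1 (fun x => f (x, y))) /\
  cint m2 (fun y => cint m1 (fun x => f (x, y))) = cint m12 f.
Proof.
move=> [/Rfubini2[ir er] /Rfubini2[ii ei]]; split; first by split.
by apply: complexP.
Qed.

Lemma cFubini (f : T1 * T2 -> R[i]) : cL1 m12 f ->
  cint m1 (fun x => cint m2 (fun y => f (x, y))) =
  cint m2 (fun y => cint m1 (fun x => f (x, y))).
Proof. by move=> L1f; rewrite (cfubini1 L1f).2 (cfubini2 L1f).2. Qed.

Lemma ae_cL1 (f : T1 * T2 -> R[i]) : cL1 m12 f ->
  \forall x \ae m1, cL1 m2 (fun y => f (x, y)).
Proof.
by move=> [/ae_integrable1 ir /ae_integrable1 ii]; apply: filterS2 ir ii.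
Qed.

Lemma cL1_prod (f : T1 * T2 -> R[i]) : cmfun f ->
  (\int[m1]_x \int[m2]_y (normc (f (x, y)))%:E < +oo)%E -> cL1 m12 f.
Proof.
move=> mf foo; apply/cL1P; split => //; rewrite fubini_tonelli1//.
  by apply/measurable_EFinP; exact: cmfun_normc.
by move=> p; rewrite lee_fin normc_ge0.
Qed.

Lemma cL1_tensor (f : T1 -> R[i]) (g : T2 -> R[i]) : cL1 m1 f -> cL1 m2 g ->
  cL1 m12 (fun p => f p.1 * g p.2).
Proof.
move=> /cL1P[mf foo] /cL1P[mg goo]; apply: cL1_prod.
  by apply: cmfunM; [exact: (cmfun_comp measurable_fst)|
                     exact: (cmfun_comp measurable_snd)].
have mnf : measurable_fun setT (fun x => (normc (f x))%:E).
  by apply/measurable_EFinP; exact: cmfun_normc.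
have mng : measurable_fun setT (fun x => (normc (g x))%:E).
  by apply/measurable_EFinP; exact: cmfun_normc.
rewrite (eq_integral (fun x => (normc (f x))%:E *
    \int[m2]_y (normc (g y))%:E)%E); last first.
  move=> x _; rewrite -ge0_integralZl//=.
  - by apply: eq_integral => y _; rewrite normcM EFinM.
  - by move=> y _; rewrite lee_fin normc_ge0.
  - by rewrite lee_fin normc_ge0.
rewrite ge0_integralZr//; last 2 first.
- by move=> x _; rewrite lee_fin normc_ge0.
- by apply: integral_ge0 => y _; rewrite lee_fin normc_ge0.
by rewrite lte_mul_pinfty// ?integral_ge0// => [x _|];
  [rewrite lee_fin normc_ge0|rewrite ge0_fin_numE// integral_ge0// => x _;
   rewrite lee_fin normc_ge0].
Qed.

Lemma cint_tensor (f : T1 -> R[i]) (g : T2 -> R[i]) : cL1 m1 f -> cL1 m2 g ->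
  cint m12 (fun p => f p.1 * g p.2) = cint m1 f * cint m2 g.
Proof.
move=> L1f L1g; rewrite -(cfubini1 (cL1_tensor L1f L1g)).2 /=.
under eq_cint do rewrite cintMl//.
exact: cintMr.
Qed.

End fubini.

(** A change of variables is checked on nonnegative functions only; complex
    functions follow by splitting into positive and negative parts. *)
Section change_of_variables.
Context {d d' : measure_display} {T : measurableType d} {T' : measurableType d'}
  {R : realType}.
Variables (mu : {measure set T -> \bar R}) (mu' : {measure set T' -> \bar R}).
Variables (phi : T -> T') (c : R).
Hypothesis mphi : measurable_fun setT phi.
Hypothesis c0 : 0 <= c.
Hypothesis cov : forall h : T' -> \bar R, measurable_fun setT h ->
  (forall x, 0 <= h x)%E ->
  (\int[mu]_x h (phi x) = c%:E * \int[mu']_x h x)%E.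

Lemma cL1_cov (f : T' -> R[i]) : cL1 mu' f -> cL1 mu (fun x => f (phi x)).
Proof.
move=> /cL1P[mf foo]; apply/cL1P; split; first exact: cmfun_comp.
rewrite (cov (h := fun x => (normc (f x))%:E)); last 2 first.
- by apply/measurable_EFinP; exact: cmfun_normc.
- by move=> x; rewrite lee_fin normc_ge0.
by rewrite lte_mul_pinfty.
Qed.

Lemma integral_cov (h : T' -> R) : mu'.-integrable setT (EFin \o h) ->
  \int[mu]_x h (phi x) = c * \int[mu']_x h x.
Proof.
move=> ih; have mh := measurable_int _ ih.
rewrite /Rintegral -[c in RHS]/(fine c%:E) -fineM//; last first.
  exact: integrable_fin_num.
congr fine; transitivity (\int[mu]_x ((EFin \o h) \o phi) x)%E => //.
rewrite integralE funepos_comp funeneg_comp [in RHS]integralE muleBr//; last first.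
  rewrite fin_num_adde_defl// fin_numN.
  by apply: integrable_neg_fin_num.
congr (_ - _)%E.
  by apply: (cov (h := (EFin \o h)^\+%E)) => //; exact: measurable_funepos.
by apply: (cov (h := (EFin \o h)^\-%E)) => //; exact: measurable_funeneg.
Qed.

Lemma cint_cov (f : T' -> R[i]) : cL1 mu' f ->
  cint mu (fun x => f (phi x)) = c%:C * cint mu' f.
Proof.
move=> [ir ii]; apply: complexP; rewrite ?ReM ?ImM ReC ImC mul0r.
  by rewrite subr0; exact: integral_cov.
by rewrite addr0; exact: integral_cov.
Qed.

End change_of_variables.

(** * Lebesgue measure on R^n *)

Section lebesgue_line.
Context {R : realType}.
Local Notation leb := (@lebesgue_measure R).

Lemma measurable_affine (t b : R) : measurable_fun setT (fun x : R => t * x + b).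
Proof. by apply: measurable_funD => //; exact: measurable_funM. Qed.

(** The right-hand side is a measure in A with the value of the Lebesgue measure
    on half-open intervals, and such a measure is unique. *)
Lemma lebesgue_measure_affine (t b : R) (A : set R) : t != 0 -> measurable A ->
  leb A = (`|t|%:E * leb ((fun x => (t * x + b)%R) @^-1` A))%E.
Proof.
move=> t0 mA.
pose phi : measurableTypeR R -> measurableTypeR R := fun x => t * x + b.
have mphi : measurable_fun setT phi by exact: measurable_affine.
pose nu_ := mscale (NngNum (normr_ge0 t)) (pushforward leb phi).
pose nu := nu_ mphi.
have -> : (`|t|%:E * leb ((fun x => t * x + b)%R @^-1` A))%E = nu A by [].
apply: lebesgue_measure_unique => // _ [[c e] _ <-] /=.
rewrite /nu /nu_ /mscale /= /pushforward lebesgue_measure_itv/= lte_fin.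
have [t_gt0|t_le0] := ltP 0 t.
  have -> : phi @^-1` `]c, e] = `](c - b) / t, (e - b) / t]%classic.
    apply/seteqP; split => x /=; rewrite !in_itv/= /phi.
      by rewrite ltr_pdivrMr// ler_pdivlMr// ltrBlDr lerBrDr mulrC.
    by rewrite ltr_pdivrMr// ler_pdivlMr// ltrBlDr lerBrDr mulrC.
  rewrite lebesgue_measure_itv/= lte_fin ltr_pM2r ?invr_gt0// ltrD2r.
  case: ifP => _; last by rewrite mule0.
  by rewrite -!EFinB -EFinM gtr0_norm//; congr EFin; field.
have t_lt0 : t < 0 by rewrite lt_neqAle t0.
have -> : phi @^-1` `]c, e] = `[(e - b) / t, (c - b) / t[%classic.
  apply/seteqP; split => x /=; rewrite !in_itv/= /phi.
    rewrite ler_ndivrMr// ltr_ndivlMr// ltrBlDr lerBrDr ![x * t]mulrC.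
    by rewrite andbC.
  by rewrite ler_ndivrMr// ltr_ndivlMr// ltrBlDr lerBrDr ![x * t]mulrC andbC.
rewrite lebesgue_measure_itv/= lte_fin ltr_nM2r ?invr_lt0// ltrD2r.
case: ifP => _; last by rewrite mule0.
by rewrite -!EFinB -EFinM ltr0_norm//; congr EFin; field.
Qed.

Lemma ge0_integral_affine1 (t b : R) (h : R -> \bar R) : t != 0 ->
  measurable_fun setT h -> (forall x, 0 <= h x)%E ->
  (\int[leb]_x h (t * x + b)%R = (`|t|^-1)%:E * \int[leb]_x h x)%E.
Proof.
move=> t0 mh h0.
pose phi : measurableTypeR R -> measurableTypeR R := fun x => t * x + b.
have mphi : measurable_fun setT phi by exact: measurable_affine.
pose nu_ := mscale (NngNum (normr_ge0 t)) (pushforward leb phi).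
pose nu := nu_ mphi.
have -> : (\int[leb]_x h x = \int[nu]_x h x)%E.
  by apply: eq_measure_integral => A mA _; exact: lebesgue_measure_affine.
rewrite ge0_integral_mscale//= muleA -EFinM mulVf ?normr_eq0// mul1e.
by rewrite (@ge0_integral_pushforward _ _ _ _ _ _ mphi leb setT).
Qed.

End lebesgue_line.

Section lebesgue_space.
Context {R : realType}.
Local Notation leb := (@lebesgue_measure R).
Local Notation mu n := (lebesgue_rV R n).

Lemma ge0_integral_rVS n (h : 'rV[R]_n.+1 -> \bar R) :
  measurable_fun setT h -> (forall x, 0 <= h x)%E ->
  (\int[mu n.+1]_x h x = \int[leb \x mu n]_p h (rV_cons p))%E.
Proof.
move=> mh h0.
by rewrite -(@ge0_integral_pushforward _ _ _ _ _ _ (@measurable_rV_cons R n)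
  (leb \x mu n)%E setT).
Qed.

Lemma ge0_integral_rVSF n (h : 'rV[R]_n.+1 -> \bar R) :
  measurable_fun setT h -> (forall x, 0 <= h x)%E ->
  (\int[mu n.+1]_x h x = \int[leb]_a \int[mu n]_x h (rV_cons (a, x)))%E.
Proof.
move=> mh h0; rewrite ge0_integral_rVS// fubini_tonelli1//.
exact: measurableT_comp (@measurable_rV_cons R n).
Qed.

Lemma cL1_rVS n (f : 'rV[R]_n.+1 -> R[i]) : cmfun f ->
  cL1 (leb \x mu n)%E (fun p => f (rV_cons p)) -> cL1 (mu n.+1) f.
Proof.
move=> mf /cL1P[_ foo]; apply/cL1P; split => //; rewrite ge0_integral_rVS//.
  by apply/measurable_EFinP; exact: cmfun_normc.
by move=> x; rewrite lee_fin normc_ge0.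
Qed.

Lemma cint_rVS n (f : 'rV[R]_n.+1 -> R[i]) : cL1 (mu n.+1) f ->
  cint (mu n.+1) f = cint (leb \x mu n)%E (fun p => f (rV_cons p)).
Proof.
move=> L1f; rewrite (@cint_cov _ _ _ _ _ _ (mu n.+1) (@rV_cons R n) 1) ?mul1r//.
by move=> h mh h0; rewrite mul1e ge0_integral_rVS.
Qed.

Section measurability.
Context {d : measure_display} {T : measurableType d} {n : nat}.
Implicit Types (u v : T -> 'rV[R]_n).

Lemma measurable_rV_entry u i : measurable_fun setT u ->
  measurable_fun setT (fun t => u t ord0 i : R).
Proof. by move=> mu; exact: (measurableT_comp (measurable_rV_coord i)). Qed.

Lemma measurable_rVD u v : measurable_fun setT u -> measurable_fun setT v ->
  measurable_fun setT (fun t => u t + v t).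
Proof.
move=> mu mv; apply: measurable_fun_rV => i.
under eq_fun do rewrite mxE.
by apply: measurable_funD; exact: measurable_rV_entry.
Qed.

Lemma measurable_rVZ (s : T -> R) u : measurable_fun setT s ->
  measurable_fun setT u -> measurable_fun setT (fun t => s t *: u t).
Proof.
move=> ms mu; apply: measurable_fun_rV => i.
under eq_fun do rewrite mxE.
by apply: measurable_funM => //; exact: measurable_rV_entry.
Qed.

Lemma measurable_rVB u v : measurable_fun setT u -> measurable_fun setT v ->
  measurable_fun setT (fun t => u t - v t).
Proof.
move=> mu mv; apply: measurable_fun_rV => i.
under eq_fun do rewrite !mxE.
by apply: measurable_funB; exact: measurable_rV_entry.
Qed.

Lemma measurable_dot u v : measurable_fun setT u -> measurable_fun setT v ->
  measurable_fun setT (fun t => dot (u t) (v t)).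
Proof.
move=> mu mv; rewrite /dot; apply: measurable_sum => i.
by apply: measurable_funM; exact: measurable_rV_entry.
Qed.

End measurability.

(** Induction on the dimension: one affine substitution on the line for each
    coordinate. *)
Lemma ge0_integral_affine n (t : R) (b : 'rV[R]_n) (h : 'rV[R]_n -> \bar R) :
  t != 0 -> measurable_fun setT h -> (forall x, 0 <= h x)%E ->
  (\int[mu n]_x h (t *: x + b)%R = (`|t| ^- n)%:E * \int[mu n]_x h x)%E.
Proof.
move=> t0; elim: n b h => [|n IH] b h mh h0.
  rewrite expr0 invr1 mul1e; apply: eq_integral => x _.
  by rewrite (thinmx0 (t *: x + b)) (thinmx0 x).
have maff : measurable_fun setT (fun x : 'rV[R]_n.+1 => t *: x + b).
  by apply: measurable_rVD => //; apply: measurable_rVZ.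
rewrite !ge0_integral_rVSF//; last exact: measurableT_comp.
pose b1 := b ord0 ord0; pose b' : 'rV[R]_n := \row_i b ord0 (lift ord0 i).
have E a x : t *: rV_cons (a, x) + b = rV_cons (t * a + b1, t *: x + b').
  apply/rowP => i; rewrite !mxE /=; case: (unliftP ord0 i) => [j|] ->.
    by rewrite /= !mxE.
  by [].
have mcons a : measurable_fun setT (fun x : 'rV[R]_n => rV_cons (a : R, x)).
  by apply: (measurableT_comp (@measurable_rV_cons R n)); exact: measurable_fun_pair.
pose F (a : R) := (\int[mu n]_x h (rV_cons (a, x)))%E.
have F0 a : (0 <= F a)%E by exact: integral_ge0.
have mF : measurable_fun setT F.
  apply: (@measurable_fun_fubini_tonelli_F _ _ _ _ _ (mu n) (h \o @rV_cons R n)).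
    exact: measurableT_comp (@measurable_rV_cons R n).
  by move=> p; exact: h0.
transitivity (\int[leb]_a ((`|t| ^- n)%:E * F (t * a + b1)%R))%E.
  apply: eq_integral => a _; rewrite -(IH b')//; last exact: measurableT_comp.
  by apply: eq_integral => x _; rewrite E.
transitivity ((`|t| ^- n)%:E * \int[leb]_a F (t * a + b1)%R)%E.
  apply: ge0_integralZl => //.
  by apply: (measurableT_comp mF); exact: measurable_affine.
by rewrite (ge0_integral_affine1 b1 t0 mF F0) muleA -EFinM -invfM exprSr.
Qed.

Section affine_cov.
Context {n : nat} (t : R) (b : 'rV[R]_n) (t0 : t != 0).

Lemma cL1_affine (f : 'rV[R]_n -> R[i]) : cL1 (mu n) f ->
  cL1 (mu n) (fun x => f (t *: x + b)).
Proof.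
apply: (@cL1_cov _ _ _ _ _ (mu n) (mu n) _ (`|t| ^- n)).
- by apply: measurable_rVD => //; exact: measurable_rVZ.
- by rewrite invr_ge0 exprn_ge0.
- by move=> h mh h0; exact: ge0_integral_affine.
Qed.

Lemma cint_affine (f : 'rV[R]_n -> R[i]) : cL1 (mu n) f ->
  cint (mu n) (fun x => f (t *: x + b)) = (`|t| ^- n)%:C * cint (mu n) f.
Proof.
move=> L1f; apply: cint_cov => //.
by move=> h mh h0; exact: ge0_integral_affine.
Qed.

End affine_cov.

Lemma cL1_shift n (b : 'rV[R]_n) (f : 'rV[R]_n -> R[i]) : cL1 (mu n) f ->
  cL1 (mu n) (fun x => f (x + b)).
Proof.
by move=> /(cL1_affine b (oner_neq0 _)); under eq_fun do rewrite scale1r.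
Qed.

Lemma cint_shift n (b : 'rV[R]_n) (f : 'rV[R]_n -> R[i]) : cL1 (mu n) f ->
  cint (mu n) (fun x => f (x + b)) = cint (mu n) f.
Proof.
move=> /(cint_affine b (oner_neq0 _)); rewrite normr1 expr1n invr1 mul1r => <-.
by apply: eq_cint => x; rewrite scale1r.
Qed.

Lemma ge0_integral_shift n (b : 'rV[R]_n) (h : 'rV[R]_n -> \bar R) :
  measurable_fun setT h -> (forall x, 0 <= h x)%E ->
  (\int[mu n]_x h (x + b)%R = \int[mu n]_x h x)%E.
Proof.
move=> mh h0; have := @ge0_integral_affine n 1 b h (oner_neq0 _) mh h0.
rewrite normr1 expr1n invr1 mul1e => <-.
by apply: eq_integral => x _; rewrite scale1r.
Qed.

(** The Abel kernel, the Poisson kernel, the plane waves and the indicators of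
    boxes are all products of functions of one coordinate, so that integrals
    involving them reduce to the line. *)
Section coordinate_products.

Definition prod_rV n (f : 'I_n -> R -> R[i]) (x : 'rV[R]_n) : R[i] :=
  \prod_i f i (x ord0 i).

Lemma prod_rVS n (f : 'I_n.+1 -> R -> R[i]) (p : R * 'rV[R]_n) :
  prod_rV f (rV_cons p) = f ord0 p.1 * prod_rV (fun i => f (lift ord0 i)) p.2.
Proof.
rewrite /prod_rV big_ord_recl !mxE unlift_none /=; congr (_ * _).
by apply: eq_bigr => i _; rewrite !mxE liftK.
Qed.

Lemma prod_rV0 (f : 'I_0 -> R -> R[i]) : prod_rV f = fun=> 1.
Proof. by apply/funext => x; rewrite /prod_rV big_ord0. Qed.

Lemma cmfun_prod_rV n (f : 'I_n -> R -> R[i]) : (forall i, cmfun (f i)) ->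
  cmfun (prod_rV f).
Proof.
move=> mf; rewrite /prod_rV.
elim: (index_enum _) => [|i s IH].
  by under eq_fun do rewrite big_nil; exact: cmfun_cst.
under eq_fun do rewrite big_cons; apply: cmfunM => //.
apply: (@cmfun_comp R _ _ _ _ (fun x : 'rV[R]_n => x ord0 i) (f i)) => //.
exact: measurable_rV_coord.
Qed.

Lemma cL1_prod_rV n (f : 'I_n -> R -> R[i]) : (forall i, cL1 leb (f i)) ->
  cL1 (mu n) (prod_rV f).
Proof.
elim: n f => [|n IH] f L1f.
  rewrite prod_rV0; apply/cL1P; split; first exact: cmfun_cst.
  by rewrite integral_cst//= diracT mule1 ltry.
apply: cL1_rVS.
  by apply: cmfun_prod_rV => i; exact: cL1_cmfun (L1f i).
under eq_fun do rewrite prod_rVS.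
by apply: cL1_tensor => //; exact: IH.
Qed.

Lemma cint_prod_rV n (f : 'I_n -> R -> R[i]) : (forall i, cL1 leb (f i)) ->
  cint (mu n) (prod_rV f) = \prod_i cint leb (f i).
Proof.
elim: n f => [|n IH] f L1f.
  rewrite big_ord0 prod_rV0.
  have mu0T : fine (mu 0 setT) = 1 by rewrite [mu 0 setT](@diracT _ _ _ _).
  apply: complexP; first by rewrite [LHS]Rintegral_cst// mu0T mulr1.
  by rewrite [LHS]Rintegral_cst// mul0r.
rewrite cint_rVS; last exact: cL1_prod_rV.
under eq_cint do rewrite prod_rVS.
rewrite big_ord_recl -IH//; apply: cint_tensor => //.
exact: cL1_prod_rV.
Qed.

End coordinate_products.

(** The slab over N is a product, in the decomposition of R^n.+1 as R * R^n, in
    which N or, by induction, a lower-dimensional slab is a null factor. *)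
Lemma coord_null n (i : 'I_n) (N : set R) : measurable N -> leb N = 0 ->
  mu n [set x | N (x ord0 i)] = 0.
Proof.
move=> mN N0; elim: n i => [[]//|n IH] i.
rewrite /= /lebesgue_rV_step /pushforward.
have mS : measurable [set x : 'rV[R]_n.+1 | N (x ord0 i)].
  by rewrite -[X in measurable X]setTI; exact: measurable_rV_coord.
case: (unliftP ord0 i) => [j|] ->.
  rewrite (_ : _ @^-1` _ = setT `*` [set x : 'rV[R]_n | N (x ord0 j)]).
    rewrite product_measure1E ?IH ?mule0//.
    by rewrite -[X in measurable X]setTI; exact: measurable_rV_coord.
  by apply/seteqP; split => -[a x] /=; rewrite mxE liftK //= => -[].
rewrite (_ : _ @^-1` _ = N `*` setT).
  transitivity (leb N * mu n setT)%E; last by rewrite N0 mul0e.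
  exact: product_measure1E.
by apply/seteqP; split => -[a x] /=; rewrite mxE unlift_none //= => -[].
Qed.

Section boxes.
Variable n : nat.

Definition box (a b : 'I_n -> R) : set 'rV[R]_n :=
  [set x | forall i, a i < x ord0 i <= b i].

Definition boxes : set (set 'rV[R]_n) :=
  [set box ab.1 ab.2 | ab in [set: ('I_n -> R) * ('I_n -> R)]].

Lemma boxesP a b : boxes (box a b). Proof. by exists (a, b). Qed.

Lemma boxE a b : box a b =
  \bigcap_(i in [set: 'I_n]) (fun x : 'rV[R]_n => x ord0 i) @^-1` `]a i, b i].
Proof.
apply/seteqP; split => x /= h i; first by move=> _ /=; rewrite in_itv/= h.
by have := h i I; rewrite /= in_itv.
Qed.

Lemma measurable_box a b : measurable (box a b).
Proof.
rewrite boxE; apply: fin_bigcap_measurable => // i _.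
rewrite -[X in measurable X]setTI.
by apply: (measurable_rV_coord i) => //; exact: measurable_itv.
Qed.

Lemma boxes_setI_closed : setI_closed boxes.
Proof.
move=> _ _ [[a b] _ <-] [[c e] _ <-] /=.
exists (fun i => Num.max (a i) (c i), fun i => Num.min (b i) (e i)) => //=.
apply/seteqP; split => x /=.
  by move=> h; split => i; have := h i; rewrite gt_max le_min;
    move=> /andP[/andP[h1 h2] /andP[h3 h4]]; exact/andP.
move=> [h1 h2] i; have /andP[? ?] := h1 i; have /andP[? ?] := h2 i.
by rewrite gt_max le_min; apply/andP; split; apply/andP.
Qed.

Lemma bigcup_box : \bigcup_k box (fun=> - k%:R) (fun=> k%:R) = setT.
Proof.
apply/seteqP; split => // x _.
have [k hk] : exists k : nat, forall i, `|x ord0 i| < k%:R.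
  exists (\max_i (Num.trunc `|x ord0 i|).+1) => i.
  rewrite (lt_le_trans (truncnS_gt _))// ler_nat.
  exact: (@leq_bigmax _ (fun i : 'I_n => (Num.trunc `|x ord0 i|).+1)).
exists k => // i; have := hk i; rewrite ltr_norml => /andP[-> ?] /=.
exact: ltW.
Qed.

(** Boxes being closed under intersection, this generation property makes them
    a family on which almost everywhere equality can be tested. *)
Lemma measurable_boxes : measurable = <<s boxes >>.
Proof.
apply/seteqP; split; last first.
  apply: smallest_sub; first exact: sigma_algebra_measurable.
  by move=> _ [[a b] _ <-]; exact: measurable_box.
apply: smallest_sub; first exact: smallest_sigma_algebra.
rewrite -bigcup_seq; apply: bigcup_sub => i _ _ [B mB <-] /=.
rewrite setTI; move: B mB.
apply: (@smallest_sub _ _ _ [set B | <<s boxes >> ((fun x : 'rV[R]_n => x ord0 i) @^-1` B)]).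
  split => /=; first by rewrite preimage_set0; exact: sigma_algebra0.
    move=> B mB; rewrite setTD preimage_setC -setTD.
    exact: sigma_algebraCD.
  by move=> F mF; rewrite preimage_bigcup; exact: sigma_algebra_bigcup.
move=> _ [[a b] _ <-] /=.
rewrite (_ : _ @^-1` _ = \bigcup_k box
   (fun j => if j == i then a else - k%:R) (fun j => if j == i then b else k%:R)).
  apply: sigma_algebra_bigcup => k; apply: sub_sigma_algebra; exact: boxesP.
apply/seteqP; split => x /=.
  rewrite in_itv/= => xab.
  have [k _ hk] : (\bigcup_k box (fun=> - k%:R) (fun=> k%:R)) x by rewrite bigcup_box.
  by exists k => // j; case: eqP => [->//|_]; exact: hk.
by move=> [k _ hk]; have := hk i; rewrite eqxx in_itv.
Qed.

End boxes.

End lebesgue_space.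

(** * The Abel and Poisson kernels on the line *)

Section line_kernels.
Context {R : realType}.
Local Notation leb := (@lebesgue_measure R).

Lemma is_derive1_cont (F f : R -> R) :
  (forall x, is_derive x (1 : R) F (f x)) -> continuous F.
Proof.
move=> dF x; apply: differentiable_continuous; apply/derivable1_diffP.
by case: (dF x).
Qed.

Lemma ge0_integral_halfline (F f : R -> R) (l : R) :
  (forall x, 0 <= x -> 0 <= f x) -> continuous f ->
  (forall x, is_derive x (1 : R) F (f x)) ->
  F x @[x --> +oo] --> l ->
  (\int[leb]_(x in `[0%R, +oo[) (f x)%:E = (l - F 0)%:E)%E.
Proof.
move=> f0 cf dF Fl; rewrite (ge0_continuous_FTC2y f0 _ Fl)//.
- exact: continuous_subspaceT.
- by apply: cvg_at_right_filter; exact: (is_derive1_cont dF).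
- by move=> x _; rewrite derive1E; case: (dF x).
Qed.

Lemma ge0_integral_even (F f g : R -> R) (l : R) :
  (forall x, 0 <= f x) -> continuous f -> f =1 f \o -%R ->
  {in `[0, +oo[, f =1 g} -> continuous g ->
  (forall x, is_derive x (1 : R) F (g x)) -> F x @[x --> +oo] --> l ->
  (\int[leb]_x (f x)%:E = (2 * (l - F 0))%:E)%E.
Proof.
move=> f0 cf ev fg cg dF Fl; rewrite ge0_symfun_integralT//.
have -> : [set x : R | 0 <= x] = `[0, +oo[%classic.
  by apply/seteqP; split => x/=; rewrite in_itv/= andbT.
rewrite EFinM -(ge0_integral_halfline _ cg dF Fl)//; last first.
  by move=> x x0; rewrite -fg// in_itv/= andbT.
by congr (_ * _)%E; apply: eq_integral => x; rewrite inE/= => x0; rewrite fg.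
Qed.

Lemma ge0_integrable_EFin (h : R -> R) : measurable_fun setT h ->
  (forall x, 0 <= h x) -> (\int[leb]_x (h x)%:E < +oo)%E ->
  leb.-integrable setT (EFin \o h).
Proof.
move=> mh h0 hoo; apply/integrableP; split; first exact/measurable_EFinP.
rewrite (_ : (fun x => _) = (fun x => (h x)%:E))//.
by apply/funext => x /=; rewrite ger0_norm.
Qed.

(** The Abel kernel regularizes Fourier integrals; its Fourier transform is the
    Poisson kernel, of total mass [2 * pi], with an elementary primitive. *)
Definition abel (e x : R) : R := expR (- (e * `|x|)).

Definition poisson (e x : R) : R := 2 * e / (e ^+ 2 + x ^+ 2).

Lemma abel_ge0 e x : 0 <= abel e x. Proof. exact: expR_ge0. Qed.

Lemma continuous_abel e : continuous (abel e).
Proof.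
move=> x; rewrite /abel; apply: continuous_comp; last exact: continuous_expR.
by apply: cvgN; apply: cvgM; [exact: cvg_cst|exact: norm_continuous].
Qed.

Lemma measurable_abel e : measurable_fun setT (abel e).
Proof. by apply: continuous_measurable_fun; exact: continuous_abel. Qed.

Section abel_transform.
Variables (e w : R).
Hypothesis e0 : 0 < e.

Let D : R := e ^+ 2 + w ^+ 2.

Let D0 : D != 0.
Proof. by rewrite gt_eqF// ltr_pwDl ?exprn_gt0// sqr_ge0. Qed.

(* On the half-line x >= 0, [abel e x * (1 + s * cos (w * x))] agrees with the
   smooth function [g s x], of primitive [G s x]. *)
Let g (s x : R) : R := expR (- (e * x)) * (1 + s * cos (w * x)).

Let G (s x : R) : R := expR (- (e * x)) *
  (s * (w * sin (w * x) - e * cos (w * x)) / D - e^-1).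

Let is_derive_G s x : is_derive x (1 : R) (G s) (g s x).
Proof.
have dl (c : R) : is_derive x (1 : R) (fun x : R => c * x) c.
  have -> : (fun x : R => c * x) = (c \*: id) by [].
  by apply: is_derive_eq; rewrite /GRing.scale/= mulr1.
have dE : is_derive x (1 : R) (fun x : R => expR (- (e * x))) (- e * expR (- (e * x))).
  have -> : (fun x : R => expR (- (e * x))) = expR \o (fun x => (- e) * x).
    by apply/funext => y /=; rewrite mulNr.
  have := @is_derive1_comp R expR (fun x : R => - e * x) x _ _ (is_derive_expR _) (dl (- e)).
  by rewrite mulNr mulrC.
have dS : is_derive x (1 : R) (fun x : R => sin (w * x)) (w * cos (w * x)).
  have := @is_derive1_comp R sin (fun x : R => w * x) x _ _ (is_derive_sin _) (dl w).
  by rewrite mulrC.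
have dC : is_derive x (1 : R) (fun x : R => cos (w * x)) (- w * sin (w * x)).
  have := @is_derive1_comp R cos (fun x : R => w * x) x _ _ (is_derive_cos _) (dl w).
  by rewrite mulrC mulrN mulNr.
have -> : G s = (fun x : R => expR (- (e * x))) *
    ((s / D) \*: ((w \*: (fun x : R => sin (w * x))) - (e \*: (fun x : R => cos (w * x))))
     - cst e^-1).
  apply/funext => y.
  change (G s y = expR (- (e * y)) * ((s / D) * (w * sin (w * y) - e * cos (w * y)) - e^-1)).
  by rewrite /G; ring.
apply: is_derive_eq.
change (expR (- (e * x)) * ((s / D) * (w * (w * cos (w * x)) -
    e * (- w * sin (w * x))) - 0) + ((s / D) * (w * sin (w * x) - e * cos (w * x)) - e^-1) *
    (- e * expR (- (e * x))) = g s x).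
have -> : g s x = expR (- (e * x)) * (e * e^-1 + s * ((e ^+ 2 + w ^+ 2) / D) * cos (w * x)).
  by rewrite -/D /g (divff D0) divff ?gt_eqF// mulr1.
by move: (D^-1) => D'; ring.
Qed.

Let g_ge0 s x : 0 <= s <= 1 -> 0 <= g s x.
Proof.
move=> /andP[s0 s1]; rewrite mulr_ge0 ?expR_ge0//.
have := cos_geN1 (w * x); have := cos_le1 (w * x); nra.
Qed.

Let G_cvg s : 0 <= s <= 1 -> G s x @[x --> +oo] --> (0 : R).
Proof.
move=> s01; pose C := (`|w| + e) / D + e^-1.
have E0 : C * expR (- (e * x)) @[x --> +oo] --> (0 : R).
  rewrite -[0](mulr0 C); apply: cvgM; first exact: cvg_cst.
  apply: (cvg_comp (fun x => e * x) (fun x => expR (- x))); last exact: cvgr_expR.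
  exact: gt0_cvgMry.
apply/norm_cvg0P; apply: (squeeze_cvgr _ (cvg_cst 0) E0).
apply: nearW => x; rewrite normr_ge0/= /G normrM [X in X <= _]mulrC.
rewrite (ger0_norm (expR_ge0 _)) ler_wpM2r ?expR_ge0//.
rewrite (le_trans (ler_normB _ _))// /C lerD//; last first.
  by rewrite gtr0_norm// invr_gt0.
have Dp : 0 < D by rewrite lt_neqAle eq_sym D0 addr_ge0// sqr_ge0.
rewrite !normrM (gtr0_norm (_ : 0 < D^-1)) ?invr_gt0// ler_pM2r ?invr_gt0//.
case/andP: s01 => s0 s1; rewrite (ger0_norm s0).
rewrite (le_trans (ler_piMl _ s1))// (le_trans (ler_normB _ _))// lerD//.
  by rewrite normrM ler_piMr// ler_norml sin_geN1 sin_le1.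
rewrite normrM (gtr0_norm e0) ler_piMr ?(ltW e0)//.
by rewrite ler_norml cos_geN1 cos_le1.
Qed.

Let f (s x : R) : R := abel e x * (1 + s * cos (w * x)).

Let continuous_cosM (c : R) : continuous (fun x : R => 1 + c * cos (w * x)).
Proof.
move=> x; apply: cvgD; first exact: cvg_cst.
apply: cvgM; first exact: cvg_cst.
apply: (@continuous_comp _ _ _ (fun x : R => w * x) cos); last exact: continuous_cos.
by apply: cvgM; [exact: cvg_cst|exact: cvg_id].
Qed.

Let ge0_integral_f s : 0 <= s <= 1 ->
  (\int[leb]_x (f s x)%:E = (2 * (s * e / D + e^-1))%:E)%E.
Proof.
move=> s01; transitivity (2 * (0 - G s 0))%:E;
  first apply: (@ge0_integral_even (G s) (f s) (g s) 0) => //; last first.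
- by congr EFin; rewrite sub0r /G !mulr0 oppr0 expR0 sin0 cos0; ring.
- exact: G_cvg.
- move=> x; apply: cvgM; last exact: continuous_cosM.
  apply: (@continuous_comp _ _ _ (fun x : R => - (e * x)) expR); last exact: continuous_expR.
  by apply: cvgN; apply: cvgM; [exact: cvg_cst|exact: cvg_id].
- by move=> x; rewrite in_itv/= andbT => x0; rewrite /f /abel ger0_norm.
- by move=> x; rewrite /f /abel /= normrN mulrN cosN.
- move=> x; apply: cvgM; first exact: continuous_abel.
  exact: continuous_cosM.
- move=> x; rewrite /f mulr_ge0 ?abel_ge0//; case/andP: s01 => s0 s1.
  have := cos_geN1 (w * x); have := cos_le1 (w * x); nra.
Qed.

Lemma integrable_abel : leb.-integrable setT (fun x => (abel e x)%:E).
Proof.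
apply: ge0_integrable_EFin; [exact: measurable_abel|exact: abel_ge0|].
have := @ge0_integral_f 0; rewrite lexx ler01 => /(_ isT).
rewrite (_ : (fun x => (f 0 x)%:E) = (fun x => (abel e x)%:E)).
  by move=> ->; rewrite ltry.
by apply/funext => x; rewrite /f mul0r addr0 mulr1.
Qed.

Let measurable_cosw : measurable_fun setT (fun x : R => cos (w * x)).
Proof.
apply: (@measurableT_comp _ _ _ _ _ _ (@cos R)); last exact: measurable_funM.
by apply: continuous_measurable_fun; exact: continuous_cos.
Qed.

Let integrable_abel_cos :
  leb.-integrable setT (EFin \o (fun x => abel e x * cos (w * x))).
Proof.
apply: (integrable_EFin_le _ integrable_abel).
  by apply: measurable_funM => //; exact: measurable_abel.
move=> x; rewrite normrM (ger0_norm (abel_ge0 _ _)) ler_piMr// ?abel_ge0//.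
by rewrite ler_norml cos_geN1 cos_le1.
Qed.

(** The oscillating integral is recovered from the nonnegative integrands
    [abel e x] and [abel e x * (1 + cos (w * x))], to which the fundamental
    theorem on a half-line applies. *)
Let Rintegral_abel_cos : \int[leb]_x (abel e x * cos (w * x)) = poisson e w.
Proof.
have : \int[leb]_x f 1 x = \int[leb]_x f 0 x + \int[leb]_x (abel e x * cos (w * x)).
  rewrite -RintegralD//.
    by apply: eq_Rintegral => x _; rewrite /f; ring.
  apply: eq_integrable integrable_abel => // x _.
  by rewrite /= /f mul0r addr0 mulr1.
rewrite {1 2}/Rintegral !ge0_integral_f ?lexx ?ler01//= => h.
by rewrite /poisson -/D -[LHS](addrK (2 * (0 * e / D + e^-1))) [_ + 2 * _]addrC -h; ring.
Qed.

Lemma cL1_abel : cL1 leb (fun x => (abel e x)%:C * expi (- (w * x))).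
Proof.
apply: (@cL1_le _ _ R leb _ (abel e)); last 2 first.
- exact: integrable_abel.
- by move=> x; rewrite normcM normc_expi mulr1 normcC ger0_norm ?abel_ge0.
apply: cmfunM; first by apply: cmfunC; exact: measurable_abel.
by apply: cmfun_expi; apply: measurableT_comp => //; exact: measurable_funM.
Qed.

(** The imaginary part is the integral of an odd function, which changes sign
    under the reflection of the line. *)
Lemma cint_abel :
  cint leb (fun x => (abel e x)%:C * expi (- (w * x))) = (poisson e w)%:C.
Proof.
apply: complexP => /=.
  rewrite -[RHS]Rintegral_abel_cos; apply: eq_Rintegral => x _.
  by rewrite cosN mul0r subr0.
pose h (x : R) := abel e x * sin (w * x).
have ih : leb.-integrable setT (EFin \o h).
  have := integrableZl measurableT (-1) (proj2 cL1_abel).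
  apply: eq_integrable => // x _ /=.
  by rewrite -EFinM sinN /h; congr EFin; ring.
have h0 : \int[leb]_x h x = 0.
  have N1 : -1 != 0 :> R by rewrite oppr_eq0 oner_eq0.
  have := @integral_cov _ _ _ _ _ leb leb (fun x => -1 * x + 0) `|-1|^-1
    (fun h mh h0 => @ge0_integral_affine1 R (-1) 0 h N1 mh h0) _ ih.
  rewrite normrN1 invr1 mul1r => hE.
  have : \int[leb]_x h (-1 * x + 0) = - \int[leb]_x h x.
    rewrite -[RHS]mulN1r -RintegralZl//; apply: eq_Rintegral => x _.
    by rewrite /h /abel addr0 mulN1r normrN mulrN sinN; ring.
  by rewrite hE => /eqP; rewrite -addr_eq0 -mulr2n mulrn_eq0/= => /eqP.
transitivity (\int[leb]_x (-1 * h x)); last by rewrite RintegralZl// h0 mulr0.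
by apply: eq_Rintegral => x _; rewrite sinN /h; ring.
Qed.

End abel_transform.
Lemma cvgy_atanM (M : R) : 0 < M -> atan (M * x) @[x --> +oo] --> pi / 2.
Proof.
move=> M0; apply: (cvg_comp (fun x => M * x) (@atan R)); last exact: cvgy_atan.
exact: gt0_cvgMry.
Qed.

Lemma poisson_ge0 e x : 0 <= e -> 0 <= poisson e x.
Proof. by move=> e0; rewrite divr_ge0 ?mulr_ge0// addr_ge0 ?sqr_ge0. Qed.

Lemma poissonN e x : poisson e (- x) = poisson e x.
Proof. by rewrite /poisson sqrrN. Qed.

Section poisson_integral.
Variable e : R.
Hypothesis e0 : 0 < e.

Lemma is_derive_poisson (y x : R) :
  is_derive x (1 : R) (fun x => 2 * atan ((x - y) / e)) (poisson e (x - y)).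
Proof.
have dl : is_derive x (1 : R) (fun x : R => (x - y) / e) e^-1.
  have -> : (fun x : R => (x - y) / e) = (e^-1 \*: (id - cst y)).
    by apply/funext => z; rewrite mulrC.
  by apply: is_derive_eq; rewrite /GRing.scale/= subr0 mulr1.
have da : is_derive ((x - y) / e) (1 : R) (@atan R) (1 + ((x - y) / e) ^+ 2)^-1.
  by apply: DeriveDef; [exact: derivable_atan|rewrite -derive1E derive1_atan].
have h := @is_derive1_comp R (@atan R) (fun x : R => (x - y) / e) x _ _ da dl.
have -> : (fun x : R => 2 * atan ((x - y) / e)) =
  2 \*: (@atan R \o (fun x : R => (x - y) / e)) by [].
apply: is_derive_eq.
rewrite /GRing.scale/= /poisson.
have e1 : e != 0 by rewrite gt_eqF.
have D1 : e ^+ 2 + (x - y) ^+ 2 != 0.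
  by rewrite gt_eqF// ltr_pwDl ?exprn_gt0// sqr_ge0.
have -> : 1 + ((x - y) / e) ^+ 2 = (e ^+ 2 + (x - y) ^+ 2) / e ^+ 2.
  by field.
by field; rewrite D1 e1.
Qed.

Lemma continuous_poisson (y : R) : continuous (fun x => poisson e (x - y)).
Proof.
move=> x; rewrite /poisson; apply: cvgM; first exact: cvg_cst.
apply: cvgV; first by rewrite gt_eqF// ltr_pwDl ?exprn_gt0// sqr_ge0.
apply: cvgD; first exact: cvg_cst.
rewrite expr2; under eq_fun do rewrite expr2.
by apply: cvgM; apply: cvgB; [exact: cvg_id|exact: cvg_cst|exact: cvg_id|exact: cvg_cst].
Qed.

Lemma measurable_poisson : measurable_fun setT (poisson e).
Proof.
apply: continuous_measurable_fun.
by have := @continuous_poisson 0; under [X in continuous X]eq_fun do rewrite subr0.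
Qed.

Lemma integral_poisson : (\int[leb]_x (poisson e x)%:E = (2 * pi)%:E)%E.
Proof.
have c0 : continuous (poisson e).
  by have := @continuous_poisson 0; under [X in continuous X]eq_fun do rewrite subr0.
transitivity (2 * (pi - 2 * atan ((0 - 0) / e)))%:E;
  last by rewrite subrr mul0r atan0 mulr0 subr0.
apply: (@ge0_integral_even (fun x => 2 * atan ((x - 0) / e)) _ (poisson e) pi) => //.
- by move=> x; apply: poisson_ge0; exact: ltW.
- by move=> x; rewrite /= poissonN.
- by move=> x; have := is_derive_poisson 0 x; rewrite subr0.
rewrite [X in _ --> X](_ : pi = 2 * (pi / 2)); last by field.
apply: cvgM; first exact: cvg_cst.
under eq_fun do rewrite subr0 mulrC.
by apply: cvgy_atanM; rewrite invr_gt0.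
Qed.

Lemma cL1_poisson : cL1 leb (fun x => (poisson e x)%:C).
Proof.
apply/cL1C/ge0_integrable_EFin; first exact: measurable_poisson.
  by move=> x; apply: poisson_ge0; exact: ltW.
by rewrite integral_poisson ltry.
Qed.

Lemma cint_poisson : cint leb (fun x => (poisson e x)%:C) = (2 * pi)%:C.
Proof. by rewrite cintC /Rintegral integral_poisson. Qed.

(** The mass that the Poisson kernel centred at y gives to ]a, b]. *)
Definition poisson_mass (a b y : R) : R :=
  if a < b then 2 * atan ((b - y) / e) - 2 * atan ((a - y) / e) else 0.

Lemma integral_poisson_itv (a b y : R) :
  (\int[leb]_x (\1_(`]a, b]) x * poisson e (x - y))%:E = (poisson_mass a b y)%:E)%E.
Proof.
have -> : (\int[leb]_x (\1_(`]a, b]) x * poisson e (x - y))%:E =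
          \int[leb]_(x in `]a, b]) (poisson e (x - y))%:E)%E.
  rewrite [RHS]integral_mkcond; apply: eq_integral => x _.
  by rewrite patchE indicE; case: ifPn => _; rewrite ?mul1r ?mul0r.
rewrite /poisson_mass; case: ltP => ab; last first.
  by rewrite set_itv_ge ?integral_set0// bnd_simp -leNgt.
rewrite integral_itv_obnd_cbnd; last first.
  apply/measurable_EFinP; apply: measurable_funTS.
  by apply: continuous_measurable_fun; exact: continuous_poisson.
rewrite (@continuous_FTC2 _ _ (fun x => 2 * atan ((x - y) / e)))//.
- by apply: continuous_subspaceT; exact: continuous_poisson.
- have cF := is_derive1_cont (is_derive_poisson y).
  split.
  + by move=> x _; case: (is_derive_poisson y x).
  + by apply: cvg_at_right_filter; exact: cF.
  + by apply: cvg_at_left_filter; exact: cF.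
- by move=> x _; rewrite derive1E; case: (is_derive_poisson y x).
Qed.

Lemma cL1_poisson_itv (a b y : R) :
  cL1 leb (fun x => (\1_(`]a, b]) x * poisson e (x - y))%:C).
Proof.
apply/cL1C/ge0_integrable_EFin.
  apply: measurable_funM; first exact: measurable_indic.
  by apply: continuous_measurable_fun; exact: continuous_poisson.
  by move=> x; rewrite mulr_ge0// poisson_ge0// ltW.
by rewrite integral_poisson_itv ltry.
Qed.

Lemma cint_poisson_itv (a b y : R) :
  cint leb (fun x => (\1_(`]a, b]) x * poisson e (x - y))%:C) =
  (poisson_mass a b y)%:C.
Proof. by rewrite cintC /Rintegral integral_poisson_itv. Qed.

Lemma poisson_mass_bound (a b y : R) : 0 <= poisson_mass a b y <= 2 * pi.
Proof.
rewrite /poisson_mass; case: ltP => [ab|_]; last by rewrite lexx mulr_ge0// pi_ge0.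
have h : atan ((a - y) / e) < atan ((b - y) / e).
  by apply: lt_atan; rewrite ltr_pM2r ?invr_gt0// ltrD2r.
have := atan_ltpi2 ((b - y) / e); have := atan_gtNpi2 ((a - y) / e).
lra.
Qed.

End poisson_integral.

(** As the parameter tends to zero, [atan ((c - y) / e)] tends to [pi / 2] or
    [- pi / 2] according to the sign of [c - y]; the end points are excluded. *)
Lemma poisson_mass_cvg (a b y : R) : y != a -> y != b ->
  (fun k => poisson_mass k.+1%:R^-1 a b y) @ \oo --> 2 * pi * \1_(`]a, b]) y.
Proof.
move=> ya yb.
have key (c : R) : y != c ->
  (fun k : nat => 2 * atan ((c - y) / k.+1%:R^-1)) @ \oo -->
  (if y < c then pi else - pi).
  move=> yc.
  have cvgk : (fun k => k.+1%:R : R) @ \oo --> +oo.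
    apply/cvgryPge => r; near=> k; rewrite (@le_trans _ _ k%:R)// ?ler_nat//.
    by near: k; exact: nbhs_infty_ger.
  case: ltP => [ltyc|leyc].
    rewrite [X in _ --> X](_ : pi = 2 * (pi / 2)); last by field.
    apply: cvgM; first exact: cvg_cst.
    under eq_fun do rewrite invrK.
    apply: (cvg_comp _ (fun r : R => atan ((c - y) * r)) cvgk).
    by apply: cvgy_atanM; rewrite subr_gt0.
  rewrite [X in _ --> X](_ : - pi = 2 * (- (pi / 2))); last by field.
  apply: cvgM; first exact: cvg_cst.
  under eq_fun do rewrite -opprB mulNr atanN.
  apply: cvgN.
  under eq_fun do rewrite invrK.
  apply: (cvg_comp _ (fun r : R => atan ((y - c) * r)) cvgk).
  by apply: cvgy_atanM; rewrite subr_gt0 lt_neqAle eq_sym yc.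
rewrite /poisson_mass indicE mem_setE in_itv/=.
case: ltP => ab; last first.
  rewrite (_ : (_ && _) = false) ?mulr0; first exact: cvg_cst.
  by apply/negbTE/negP => /andP[h1 h2]; have := lt_le_trans h1 h2; rewrite ltNge ab.
rewrite [X in _ --> X](_ : _ = (if y < b then pi else - pi) - (if y < a then pi else - pi)).
  by apply: cvgB; exact: key.
rewrite le_eqVlt (negbTE yb)/=.
case: (ltgtP y a) ya => // [ya|ay] _.
  by rewrite (lt_trans ya ab) mulr0 subrr.
by case: ifP => _; rewrite ?mulr1 ?mulr0; ring.
Unshelve. all: by end_near. Qed.

End line_kernels.

(** * The Fourier transform of integrable scalar functions *)

Section dot_product.
Context {R : realType} {n : nat}.
Implicit Types (x y w : 'rV[R]_n).

Lemma dotC x w : dot x w = dot w x.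
Proof. by apply: eq_bigr => i _; rewrite mulrC. Qed.

Lemma dotDl x y w : dot (x + y) w = dot x w + dot y w.
Proof. by rewrite -big_split; apply: eq_bigr => i _; rewrite mxE mulrDl. Qed.

Lemma dotZl (t : R) x w : dot (t *: x) w = t * dot x w.
Proof. by rewrite mulr_sumr; apply: eq_bigr => i _; rewrite mxE mulrA. Qed.

Lemma dotNl x w : dot (- x) w = - dot x w.
Proof. by rewrite -scaleN1r dotZl mulN1r. Qed.

Lemma dotBl x y w : dot (x - y) w = dot x w - dot y w.
Proof. by rewrite dotDl dotNl. Qed.

Lemma dotBr x y w : dot w (x - y) = dot w x - dot w y.
Proof. by rewrite dotC dotBl ![dot _ w]dotC. Qed.

Lemma dotZr (t : R) x w : dot w (t *: x) = t * dot w x.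
Proof. by rewrite dotC dotZl dotC. Qed.

Lemma expi_dot x w : expi (- dot w x) = \prod_i expi (- (w ord0 i * x ord0 i)).
Proof.
by rewrite /dot -sumrN (big_morph _ expiD expi0).
Qed.

(** The l1 norm, rather than the Euclidean one, is the quantity for which
    [\prod_i abel e (w i)] is [expR (- (e * l1norm w))]; it also dominates the
    Euclidean norm. *)
Definition l1norm x : R := \sum_i `|x ord0 i|.

Lemma l1norm_ge0 x : 0 <= l1norm x. Proof. exact: sumr_ge0. Qed.

Lemma enorm_le_l1norm x : enorm x <= l1norm x.
Proof.
rewrite /enorm -[leRHS]ger0_norm ?l1norm_ge0// -sqrtr_sqr ler_wsqrtr//.
rewrite /dot /l1norm.
elim: (index_enum _) => [|i s IH]; first by rewrite !big_nil expr0n.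
rewrite !big_cons sqrrD addrAC real_normK ?num_real// -expr2.
rewrite -addrA lerD2l (le_trans IH)// lerDl mulrn_wge0// mulr_ge0//.
exact: sumr_ge0.
Qed.

Lemma measurable_l1norm : measurable_fun setT l1norm.
Proof.
apply: measurable_sum => i; apply: measurableT_comp => //.
exact: measurable_rV_coord.
Qed.

End dot_product.

(** The mean value theorem for the cosine and the sine separately, which gives
    the constant 2 instead of 1. *)
Lemma normc_expiB1 {R : realType} (t : R) : normc (expi t - 1) <= 2 * `|t|.
Proof.
have lip (F f : R -> R) : (forall x, is_derive x (1 : R) F (f x)) ->
    (forall x, `|f x| <= 1) -> `|F t - F 0| <= `|t|.
  move=> dF f1; have cF := is_derive1_cont dF.
  have [t0|t0] := leP 0 t.
    have [|c _ ->] := @MVT_segment R F f 0 t t0 (fun x _ => dF x).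
      exact: continuous_subspaceT.
    by rewrite subr0 normrM ler_piMl.
  have [|c _ h] := @MVT_segment R F f t 0 (ltW t0) (fun x _ => dF x).
    exact: continuous_subspaceT.
  by rewrite distrC h sub0r normrM normrN ler_piMl.
rewrite (le_trans (normc_le_ReIm _))// !ReImE /= mulr_natl mulr2n lerD//.
  rewrite -(@cos0 R); apply: (lip cos (fun x => - sin x)).
  by move=> x; rewrite normrN ler_norml sin_geN1 sin_le1.
rewrite oppr0 addr0 -[sin t]subr0 -(@sin0 R); apply: (lip sin cos).
by move=> x; rewrite ler_norml cos_geN1 cos_le1.
Qed.

Section transform.
Context {R : realType} {n : nat}.
Local Notation mu := (lebesgue_rV R n).
Local Notation E := 'rV[R]_n.
Implicit Types (f g : E -> R[i]) (x w y : E).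

Definition fhat f w : R[i] := cint mu (fun x => expi (- dot w x) * f x).

Lemma measurable_Ndot w : measurable_fun setT (fun x => - dot w x).
Proof. by apply: measurableT_comp => //; exact: measurable_dot. Qed.

Lemma cL1_fhat f w : cL1 mu f -> cL1 mu (fun x => expi (- dot w x) * f x).
Proof. by apply: cL1_expi; exact: measurable_Ndot. Qed.

Lemma normc_fhat_le f w : cL1 mu f ->
  normc (fhat f w) <= \int[mu]_x normc (f x).
Proof.
move=> L1f; rewrite (le_trans (normc_cint_le (cL1_fhat w L1f)))//.
rewrite le_eqVlt; apply/orP; left; apply/eqP; apply: eq_Rintegral => x _.
by rewrite normcM normc_expi mul1r.
Qed.

Lemma cmfun_fhat f : cmfun f -> cmfun (fhat f).
Proof.
move=> mf; apply: (@cmfun_cint1 _ _ E E R mu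
  (fun p => expi (- dot p.1 p.2) * f p.2)).
apply: cmfunM; last exact: (cmfun_comp measurable_snd).
by apply: cmfun_expi; apply: measurableT_comp => //; exact: measurable_dot.
Qed.

Lemma fhatD f g w : cL1 mu f -> cL1 mu g ->
  fhat (fun x => f x + g x) w = fhat f w + fhat g w.
Proof.
move=> L1f L1g; rewrite /fhat -cintD; [|exact: cL1_fhat|exact: cL1_fhat].
by apply: eq_cint => x; rewrite mulrDr.
Qed.

Lemma fhatZ f c w : cL1 mu f -> fhat (fun x => c * f x) w = c * fhat f w.
Proof.
move=> L1f; rewrite /fhat -cintMl; last exact: cL1_fhat.
by apply: eq_cint => x; rewrite mulrCA.
Qed.

Lemma fhatB f g w : cL1 mu f -> cL1 mu g ->
  fhat (fun x => f x - g x) w = fhat f w - fhat g w.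
Proof.
move=> L1f L1g; rewrite fhatD//; last exact: cL1N.
by under [X in _ + fhat X _]eq_fun do rewrite -mulN1r; rewrite fhatZ// mulN1r.
Qed.

Lemma fhat_modulate f x w : fhat (fun y => expi (dot x y) * f y) w = fhat f (w - x).
Proof.
by apply: eq_cint => y; rewrite mulrA -expiD dotBl opprB addrC.
Qed.

Lemma fhat_shift f x w : cL1 mu f ->
  fhat (fun y => f (y - x)) w = expi (- dot x w) * fhat f w.
Proof.
move=> L1f; rewrite /fhat -cintMl; last exact: cL1_fhat.
have L1g : cL1 mu (fun y => expi (- dot x w) * (expi (- dot w y) * f y)).
  by apply: cL1Ml; exact: cL1_fhat.
rewrite -(cint_shift (- x) L1g); apply: eq_cint => y.
by rewrite mulrA -expiD dotBr (dotC x w); congr (expi _ * _); ring.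
Qed.

Lemma fhat_dilate f (t : R) w : t != 0 -> cL1 mu f ->
  fhat (fun y => f (t^-1 *: y)) w = (`|t| ^+ n)%:C * fhat f (t *: w).
Proof.
move=> t0 L1f; have t0' : t^-1 != 0 by rewrite invr_eq0.
have := cint_affine 0 t0' (cL1_fhat (t *: w) L1f).
rewrite normrV ?unitfE// exprVn invrK => <-.
apply: eq_cint => y; rewrite addr0.
by rewrite dotZl dotZr mulrA divff// mul1r.
Qed.

(** Both sides are the double integral of [f x * g w * expi (- dot w x)]. *)
Lemma multiplication_formula f g : cL1 mu f -> cL1 mu g ->
  cint mu (fun w => fhat f w * g w) = cint mu (fun x => f x * fhat g x).
Proof.
move=> L1f L1g.
pose h (p : E * E) := expi (- dot p.1 p.2) * (f p.1 * g p.2).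
have L1h : cL1 (mu \x mu)%E h.
  apply: cL1_expi; last exact: cL1_tensor.
  by apply: measurableT_comp => //; exact: measurable_dot.
have := cFubini L1h; rewrite /h /= => hE.
transitivity (cint mu (fun w => cint mu (fun x => expi (- dot x w) * (f x * g w)))).
  apply: eq_cint => w; rewrite /fhat -cintMr; last exact: cL1_fhat.
  by apply: eq_cint => x; rewrite dotC mulrA.
rewrite -hE; apply: eq_cint => x; rewrite /fhat -cintMl; last exact: cL1_fhat.
by apply: eq_cint => y; rewrite mulrCA.
Qed.

(** Uniform continuity with an explicit modulus: the increment of the transform
    is at most the integral of [normc (f x) * min 2 (2 * d * l1norm x)], which
    tends to zero with d by dominated convergence. *)
Lemma fhat_unif_continuous f (eps : R) : cL1 mu f -> 0 < eps ->
  exists2 d : R, 0 < d & forall (w h : E), (forall i, `|h ord0 i| <= d) ->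
    normc (fhat f (w + h) - fhat f w) <= eps.
Proof.
move=> L1f eps0; have mf := cL1_cmfun L1f.
pose m (d : R) x : R := normc (f x) * Num.min 2 (2 * d * l1norm x).
have m_meas d : measurable_fun setT (m d).
  apply: measurable_funM; first exact: cmfun_normc.
  apply: measurable_minr; first exact: measurable_cst.
  by apply: measurable_funM => //; exact: measurable_l1norm.
have m_le d x : 0 <= d -> `|m d x| <= 2 * normc (f x).
  move=> d0; rewrite ger0_norm; last first.
    by rewrite mulr_ge0 ?normc_ge0// le_min ler0n !mulr_ge0// l1norm_ge0.
  by rewrite /m mulrC ler_wpM2r ?normc_ge0// ge_min lexx.
have im2 : mu.-integrable setT (EFin \o (fun x => 2 * normc (f x))).
  exact: (integrableZl measurableT 2 (cL1_normc L1f)).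
have : (fun k => \int[mu]_x m k.+1%:R^-1 x) @ \oo --> (0 : R).
  have -> : (0 : R) = \int[mu]_x ((fun=> 0) x).
    by rewrite Rintegral_cst// mul0r.
  apply: (@Rdominated_cvg _ _ _ _ _ _ (fun x => 2 * normc (f x))) => //.
    apply: aeW => x; rewrite -[X in _ --> X](mulr0 (normc (f x))).
    apply: cvgM; first exact: cvg_cst.
    apply: (squeeze_cvgr (h := fun k => (2 * l1norm x) * k.+1%:R^-1) _ (cvg_cst 0)).
      apply: nearW => k; rewrite le_min ler0n !mulr_ge0 ?invr_ge0 ?l1norm_ge0//=.
      by rewrite ge_min mulrAC lexx orbT.
    by rewrite -[X in _ --> X](mulr0 (2 * l1norm x)); apply: cvgM;
      [exact: cvg_cst|exact: cvg_harmonic].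
  by move=> k x; exact: m_le.
move=> /cvgrPdist_lt/(_ _ eps0)[K _ /(_ K (leqnn _)) mK0].
have mK : \int[mu]_x m K.+1%:R^-1 x < eps.
  by move: mK0; rewrite /= sub0r normrN ltr_norml => /andP[].
exists K.+1%:R^-1 => // w h hd; rewrite (le_trans _ (ltW mK))//.
pose F x := (expi (- dot h x) - 1) * (expi (- dot w x) * f x).
have FE x : F x = expi (- dot (w + h) x) * f x - expi (- dot w x) * f x.
  by rewrite /F dotDl opprD expiD; ring.
have L1F : cL1 mu F.
  by rewrite (funext FE); apply: cL1B; exact: cL1_fhat.
have -> : fhat f (w + h) - fhat f w = cint mu F.
  by rewrite (funext FE) cintB//; exact: cL1_fhat.
rewrite (le_trans (normc_cint_le L1F))//; apply: le_Rintegral => //.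
- exact: cL1_normc.
- by apply: (integrable_EFin_le _ im2) => // x; exact: m_le.
move=> x _; rewrite /F !normcM normc_expi mul1r mulrC /m ler_wpM2l ?normc_ge0//.
rewrite le_min; apply/andP; split.
  rewrite (le_trans (normc_tri _ _))// normc_expi normc_opp.
  by rewrite ComplexField.Normc.normc1.
rewrite (le_trans (normc_expiB1 _))// -mulrA ler_wpM2l// normrN.
rewrite (le_trans (ler_norm_sum _ _ _))// mulr_sumr ler_sum// => i _.
by rewrite normrM ler_wpM2r.
Qed.

End transform.

(** * Abel summation of Fourier integrals *)

Section kernels.
Context {R : realType} {n : nat}.
Local Notation mu := (lebesgue_rV R n).
Local Notation E := 'rV[R]_n.
Local Notation leb := (@lebesgue_measure R).
Implicit Types (f g : E -> R[i]) (x y w : E) (e : R).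

Definition abel_rV e w : R := \prod_i abel e (w ord0 i).

Definition poisson_rV e x : R := \prod_i poisson e (x ord0 i).

Lemma prod_rVC (h : 'I_n -> R -> R) :
  prod_rV (fun i t => (h i t)%:C) = fun x : E => (\prod_i h i (x ord0 i))%:C.
Proof. by apply/funext => x; rewrite /prod_rV rmorph_prod. Qed.

Lemma abel_rVE e w : abel_rV e w = expR (- (e * l1norm w)).
Proof.
by rewrite /l1norm mulr_sumr -sumrN (big_morph _ (@expRD R) (@expR0 R)).
Qed.

Lemma abel_rV_ge0 e w : 0 <= abel_rV e w.
Proof. by rewrite abel_rVE expR_ge0. Qed.

Lemma abel_rV_le1 e w : 0 <= e -> abel_rV e w <= 1.
Proof.
by move=> e0; rewrite abel_rVE -expR0 ler_expR oppr_le0 mulr_ge0 ?l1norm_ge0.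
Qed.

Lemma abel_rV_mono w : {homo (fun k => abel_rV k.+1%:R^-1 w) : k m / (k <= m)%N >-> k <= m}.
Proof.
move=> k m km; rewrite !abel_rVE ler_expR lerN2 ler_wpM2r ?l1norm_ge0//.
by rewrite lef_pV2 ?posrE// ler_nat.
Qed.

Lemma abel_rV_cvg w : (fun k => abel_rV k.+1%:R^-1 w) @ \oo --> (1 : R).
Proof.
under eq_fun do rewrite abel_rVE.
suff : (fun k => expR (- (k.+1%:R^-1 * l1norm w))) @ \oo --> (expR (- 0) : R).
  by rewrite oppr0 expR0.
apply: continuous_cvg; first exact: continuous_expR.
apply: cvgN; rewrite -[X in _ --> X](mul0r (l1norm w)).
by apply: cvgM; [exact: cvg_harmonic|exact: cvg_cst].
Qed.

Lemma measurable_abel_rV e : measurable_fun setT (abel_rV e).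
Proof.
apply: measurable_prod => i _; apply: measurableT_comp; first exact: measurable_abel.
exact: measurable_rV_coord.
Qed.

Section positive_parameter.
Variable e : R.
Hypothesis e0 : 0 < e.

Lemma poisson_rV_ge0 x : 0 <= poisson_rV e x.
Proof. by apply: prodr_ge0 => i _; apply: poisson_ge0; exact: ltW. Qed.

Lemma poisson_rV_le x : poisson_rV e x <= (2 / e) ^+ n.
Proof.
rewrite -[n in leRHS]card_ord -prodr_const; apply: ler_prod => i _.
rewrite poisson_ge0 ?(ltW e0)//= /poisson ler_pdivrMr; last first.
  by rewrite ltr_pwDl ?exprn_gt0// sqr_ge0.
rewrite mulrDr (_ : 2 / e * e ^+ 2 = 2 * e); last by field; rewrite gt_eqF.
by rewrite lerDl mulr_ge0 ?sqr_ge0// divr_ge0// ltW.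
Qed.

Lemma poisson_rV_distC x y : poisson_rV e (x - y) = poisson_rV e (y - x).
Proof.
by apply: eq_bigr => i _; rewrite -poissonN !mxE opprB.
Qed.

Lemma measurable_poisson_rV : measurable_fun setT (poisson_rV e).
Proof.
apply: measurable_prod => i _; apply: measurableT_comp; first exact: measurable_poisson.
exact: measurable_rV_coord.
Qed.

Lemma abel_modulate_prod x :
  (fun w => expi (- dot x w) * (abel_rV e w)%:C) =
  prod_rV (fun i t => (abel e t)%:C * expi (- (x ord0 i * t))).
Proof.
apply/funext => w; rewrite expi_dot /prod_rV big_split/= mulrC.
by rewrite /abel_rV rmorph_prod.
Qed.

Lemma cL1_abel_rV : cL1 mu (fun w => (abel_rV e w)%:C).
Proof.
rewrite (_ : (fun _ => _) = fun w => expi (- dot 0 w) * (abel_rV e w)%:C).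
  by rewrite abel_modulate_prod; apply: cL1_prod_rV => i; exact: cL1_abel.
apply/funext => w; rewrite (_ : dot 0 w = 0) ?oppr0 ?expi0 ?mul1r//.
by rewrite /dot big1// => i _; rewrite mxE mul0r.
Qed.

Lemma fhat_abel_rV x : fhat (fun w => (abel_rV e w)%:C) x = (poisson_rV e x)%:C.
Proof.
rewrite /fhat abel_modulate_prod cint_prod_rV; last by move=> i; exact: cL1_abel.
rewrite /poisson_rV rmorph_prod; apply: eq_bigr => i _; exact: cint_abel.
Qed.

Lemma cL1_poisson_rV : cL1 mu (fun x => (poisson_rV e x)%:C).
Proof.
rewrite -(prod_rVC (fun=> poisson e)); apply: cL1_prod_rV => i.
exact: cL1_poisson.
Qed.

Lemma integral_poisson_rV : (\int[mu]_x (poisson_rV e x)%:E = ((2 * pi) ^+ n)%:E)%E.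
Proof.
have : cint mu (fun x => (poisson_rV e x)%:C) = ((2 * pi) ^+ n)%:C.
  rewrite -(prod_rVC (fun=> poisson e)) cint_prod_rV; last first.
    by move=> i; exact: cL1_poisson.
  under eq_bigr do rewrite cint_poisson//.
  by rewrite prodr_const card_ord rmorphXn.
rewrite cintC => /complexI <-; rewrite /Rintegral fineK//.
by apply: integrable_fin_num => //; case: cL1_poisson_rV.
Qed.

Lemma cL1_mul_poisson f x : cL1 mu f ->
  cL1 mu (fun y => f y * (poisson_rV e (y - x))%:C).
Proof.
move=> L1f; apply: (cL1_le_cL1 _ (cL1Ml ((2 / e) ^+ n)%:C L1f)).
  apply: cmfunM; first exact: cL1_cmfun L1f.
  apply: cmfunC; apply: (measurableT_comp measurable_poisson_rV).
  exact: measurable_rVB.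
move=> y; rewrite !normcM mulrC ler_wpM2r ?normc_ge0// !normcC.
by rewrite !ger0_norm ?poisson_rV_ge0 ?poisson_rV_le// exprn_ge0// divr_ge0// ltW.
Qed.

(** The multiplication formula, applied to f and to the modulated Abel kernel,
    whose transform is a translate of the Poisson kernel: the Abel means of the
    inverse Fourier integral are the Poisson means of f. *)
Lemma abel_inverse f x : cL1 mu f ->
  cint mu (fun w => fhat f w * (expi (dot x w) * (abel_rV e w)%:C)) =
  cint mu (fun y => f y * (poisson_rV e (y - x))%:C).
Proof.
move=> L1f; rewrite multiplication_formula//.
  by apply: eq_cint => y; rewrite fhat_modulate fhat_abel_rV.
by apply: cL1_expi; [exact: measurable_dot|exact: cL1_abel_rV].
Qed.

(** Since [a * b <= (a ^+ 2 + b ^+ 2) / 2], the Poisson quadratic form is bounded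
    by the total mass of the kernel times the square norm. *)
Lemma poisson_form_le (h : E -> R) : measurable_fun setT h -> (forall x, 0 <= h x) ->
  (\int[mu]_x \int[mu]_y (h x * (h y * poisson_rV e (y - x)))%:E <=
   ((2 * pi) ^+ n)%:E * \int[mu]_x (h x ^+ 2)%:E)%E.
Proof.
move=> mh h0.
have mP : measurable_fun setT (fun p : E * E => poisson_rV e (p.2 - p.1)).
  by apply: (measurableT_comp measurable_poisson_rV); exact: measurable_rVB.
have mh2 : measurable_fun setT (fun x => (h x ^+ 2)%:E).
  by apply/measurable_EFinP; exact: measurable_funX.
have mass b : (\int[mu]_y (poisson_rV e (y - b))%:E = ((2 * pi) ^+ n)%:E)%E.
  rewrite (@ge0_integral_shift _ n (- b) (fun x => (poisson_rV e x)%:E)).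
  - exact: integral_poisson_rV.
  - by apply/measurable_EFinP; exact: measurable_poisson_rV.
  - by move=> x; rewrite lee_fin poisson_rV_ge0.
have c0 : (0 <= ((2 * pi) ^+ n)%:E :> \bar R)%E.
  by rewrite lee_fin exprn_ge0// mulr_ge0// pi_ge0.
pose q1 (p : E * E) := (h p.1 ^+ 2 * poisson_rV e (p.2 - p.1))%:E.
pose q2 (p : E * E) := (h p.2 ^+ 2 * poisson_rV e (p.2 - p.1))%:E.
have mh1 : measurable_fun setT (fun p : E * E => h p.1).
  exact: (measurableT_comp mh).
have mhy : measurable_fun setT (fun p : E * E => h p.2).
  exact: (measurableT_comp mh).
have mq1 : measurable_fun setT q1.
  by apply/measurable_EFinP/measurable_funM => //; exact: measurable_funX.
have mq2 : measurable_fun setT q2.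
  by apply/measurable_EFinP/measurable_funM => //; exact: measurable_funX.
have q10 p : (0 <= q1 p)%E by rewrite lee_fin mulr_ge0 ?sqr_ge0 ?poisson_rV_ge0.
have q20 p : (0 <= q2 p)%E by rewrite lee_fin mulr_ge0 ?sqr_ge0 ?poisson_rV_ge0.
have I1 : (\int[mu \x mu]_p q1 p = ((2 * pi) ^+ n)%:E * \int[mu]_x (h x ^+ 2)%:E)%E.
  rewrite fubini_tonelli1//.
  rewrite -ge0_integralZl//; last by move=> x _; rewrite lee_fin sqr_ge0.
  apply: eq_integral => x _; rewrite /fubini_F /q1 /=.
  under eq_integral do rewrite EFinM.
  rewrite ge0_integralZl// ?lee_fin ?sqr_ge0//.
  - by rewrite mass muleC.
  - apply/measurable_EFinP/(measurableT_comp measurable_poisson_rV).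
    exact: measurable_rVB.
  - by move=> y _; rewrite lee_fin poisson_rV_ge0.
have I2 : (\int[mu \x mu]_p q2 p = ((2 * pi) ^+ n)%:E * \int[mu]_x (h x ^+ 2)%:E)%E.
  rewrite fubini_tonelli2//.
  rewrite -ge0_integralZl//; last by move=> x _; rewrite lee_fin sqr_ge0.
  apply: eq_integral => x _; rewrite /fubini_G /q2 /=.
  under eq_integral do rewrite EFinM poisson_rV_distC.
  rewrite ge0_integralZl// ?lee_fin ?sqr_ge0//.
  - by rewrite mass muleC.
  - apply/measurable_EFinP/(measurableT_comp measurable_poisson_rV).
    exact: measurable_rVB.
  - by move=> y _; rewrite lee_fin poisson_rV_ge0.
pose q (p : E * E) := (h p.1 * (h p.2 * poisson_rV e (p.2 - p.1)))%:E.
have mq : measurable_fun setT q.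
  by apply/measurable_EFinP; apply: measurable_funM => //; exact: measurable_funM.
have q0 p : (0 <= q p)%E by rewrite lee_fin !mulr_ge0// poisson_rV_ge0.
have -> : (\int[mu]_x \int[mu]_y (h x * (h y * poisson_rV e (y - x)))%:E =
           \int[mu \x mu]_p q p)%E by rewrite fubini_tonelli1.
have -> : (((2 * pi) ^+ n)%:E * \int[mu]_x (h x ^+ 2)%:E =
   \int[mu \x mu]_p (2^-1%:E * (q1 p + q2 p)))%E.
  rewrite ge0_integralZl//; last 2 first.
  - exact: emeasurable_funD.
  - by move=> p _; rewrite adde_ge0.
  rewrite ge0_integralD// I1 I2; have : (0 <= \int[mu]_x (h x ^+ 2)%:E)%E.
    by apply: integral_ge0 => x _; rewrite lee_fin sqr_ge0.
  move=> /(mule_ge0 c0); case: (_ * _)%E => [r _|_|//].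
    by rewrite -EFinD -EFinM; congr EFin; field.
  by rewrite addye// gt0_muley// lte_fin.
apply: ge0_le_integral => //.
- by apply: measurable_funeM; exact: emeasurable_funD.
move=> p _; rewrite -EFinD -EFinM lee_fin.
have := poisson_rV_ge0 (p.2 - p.1); set P := poisson_rV _ _ => P0.
have := sqr_ge0 (h p.1 - h p.2); nra.
Qed.

End positive_parameter.

Section plancherel.
Variable f : E -> R[i].
Hypothesis L1f : cL1 mu f.

Let mf := cL1_cmfun L1f.

Let mF := cmfun_fhat mf.

Let C : R := \int[mu]_x normc (f x).

Let C0 : 0 <= C. Proof. by apply: Rintegral_ge0 => x _; exact: normc_ge0. Qed.

(* By the multiplication formula, the weighted square norm of the transform is
   the integral of [f x * fhat g x], and [fhat g x] is the conjugate of a Poisson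
   mean of f: the left-hand side is the Poisson quadratic form of f. *)
Let abel_plancherel_le e : 0 < e ->
  (\int[mu]_w (normc (fhat f w) ^+ 2 * abel_rV e w)%:E <=
   ((2 * pi) ^+ n)%:E * \int[mu]_x (normc (f x) ^+ 2)%:E)%E.
Proof.
move=> e0.
pose g w := (fhat f w)^*%C * (abel_rV e w)%:C.
have mg : cmfun g.
  by apply: cmfunM; [exact: cmfunJ|apply: cmfunC; exact: measurable_abel_rV].
have L1g : cL1 mu g.
  apply: (cL1_le_cL1 mg (cL1Ml C%:C (cL1_abel_rV e0))) => w.
  rewrite !normcM normc_conj ler_wpM2r ?normc_ge0//.
  by rewrite normcC ger0_norm// normc_fhat_le.
have gE x : fhat g x = (cint mu (fun y => f y * (poisson_rV e (y - x))%:C))^*%C.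
  rewrite -(abel_inverse e0 x L1f) -cintJ.
    by apply: eq_cint => w; rewrite /g !conjM conjc_real -expiN mulrCA.
  apply: (cL1_le_cL1 _ (cL1Ml C%:C (cL1_abel_rV e0))).
    apply: cmfunM => //; apply: cmfunM; last first.
      by apply: cmfunC; exact: measurable_abel_rV.
    by apply: cmfun_expi; exact: measurable_dot.
  move=> w; rewrite !normcM normc_expi mul1r ler_wpM2r ?normc_ge0//.
  by rewrite normcC ger0_norm// normc_fhat_le.
have mK x : measurable_fun setT (fun y => poisson_rV e (y - x)).
  by apply: (measurableT_comp (measurable_poisson_rV e0)); exact: measurable_rVB.
have L1P x := cL1_mul_poisson e0 x L1f.
have L1fg : cL1 mu (fun x => f x * fhat g x).
  have Cg0 : 0 <= \int[mu]_x normc (g x).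
    by apply: Rintegral_ge0 => x _; exact: normc_ge0.
  apply: (cL1_le_cL1 _ (cL1Ml (\int[mu]_x normc (g x))%:C L1f)).
    by apply: cmfunM => //; exact: cmfun_fhat.
  move=> x; rewrite !normcM mulrC ler_wpM2r ?normc_ge0//.
  by rewrite normcC ger0_norm// normc_fhat_le.
have h2E w : ((normc (fhat f w) ^+ 2 * abel_rV e w)%:C = fhat f w * g w)%R.
  by rewrite /g mulrA [fhat f w * _]mulrC mulJc rmorphM.
have -> : (\int[mu]_w (normc (fhat f w) ^+ 2 * abel_rV e w)%:E =
           (normc (cint mu (fun w => fhat f w * g w)))%:E)%E.
  under [in RHS]eq_cint do rewrite -h2E.
  rewrite cintC normcC ger0_norm; last first.
    by apply: Rintegral_ge0 => w _; rewrite mulr_ge0 ?sqr_ge0 ?abel_rV_ge0.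
  rewrite /Rintegral fineK//; apply: integrable_fin_num => //.
  have [] : cL1 mu (fun w => fhat f w * g w).
    apply: (cL1_le_cL1 _ (cL1Ml C%:C L1g)); first exact: cmfunM.
    move=> w; rewrite (normcM (fhat f w)) (normcM C%:C) ler_wpM2r ?normc_ge0//.
    by rewrite normcC ger0_norm// normc_fhat_le.
  by under eq_fun do rewrite -h2E.
rewrite multiplication_formula//.
apply: le_trans (normc_cint_lee L1fg) _.
apply: le_trans (poisson_form_le e0 (cmfun_normc mf) _); last first.
  by move=> x; exact: normc_ge0.
apply: ge0_le_integral => //.
- by move=> x _; rewrite lee_fin normc_ge0.
- by apply/measurable_EFinP; exact: cmfun_normc (cL1_cmfun L1fg).
- apply: (@measurable_fun_fubini_tonelli_F _ _ _ _ _ mu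
    (fun p => (normc (f p.1) * (normc (f p.2) * poisson_rV e (p.2 - p.1)))%:E)).
    apply/measurable_EFinP; apply: measurable_funM.
      exact: (measurableT_comp (cmfun_normc mf)).
    apply: measurable_funM; first exact: (measurableT_comp (cmfun_normc mf)).
    by apply: (measurableT_comp (measurable_poisson_rV e0)); exact: measurable_rVB.
  by move=> p; rewrite lee_fin !mulr_ge0 ?normc_ge0 ?poisson_rV_ge0.
move=> x _; rewrite normcM gE normc_conj EFinM.
under [leRHS]eq_integral do rewrite EFinM.
rewrite ge0_integralZl//; last 3 first.
- by apply/measurable_EFinP/measurable_funM => //; exact: cmfun_normc.
- by move=> y _; rewrite lee_fin mulr_ge0 ?normc_ge0 ?poisson_rV_ge0.
- by rewrite lee_fin normc_ge0.
apply: lee_wpmul2l; first by rewrite lee_fin normc_ge0.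
apply: le_trans (normc_cint_lee (L1P x)) _.
by under eq_integral do rewrite normcM normcC ger0_norm ?poisson_rV_ge0//.
Qed.

(** Half of the Plancherel theorem: the Abel weights increase to 1, so monotone
    convergence removes them from the weighted inequality. *)
Lemma plancherel_le : (\int[mu]_w (normc (fhat f w) ^+ 2)%:E <=
   ((2 * pi) ^+ n)%:E * \int[mu]_x (normc (f x) ^+ 2)%:E)%E.
Proof.
pose G k w := (normc (fhat f w) ^+ 2 * abel_rV k.+1%:R^-1 w)%:E.
have mG k : measurable_fun setT (G k).
  apply/measurable_EFinP/measurable_funM; last exact: measurable_abel_rV.
  by apply: measurable_funX; exact: cmfun_normc.
have G0 k w : [set: E] w -> (0 <= G k w)%E.
  by move=> _; rewrite lee_fin mulr_ge0 ?sqr_ge0 ?abel_rV_ge0.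
have G_mono w : [set: E] w -> {homo G^~ w : k m / (k <= m)%N >-> (k <= m)%E}.
  by move=> _ k m km; rewrite lee_fin ler_wpM2l ?sqr_ge0// abel_rV_mono.
have /(_ mu) := cvg_monotone_convergence measurableT mG G0 G_mono.
have -> : (\int[mu]_w (fun x => limn (G^~ x)) w =
           \int[mu]_w (normc (fhat f w) ^+ 2)%:E)%E.
  apply: eq_integral => w _; apply/cvg_lim => //.
  apply/fine_cvgP; split; first exact: nearW.
  rewrite -[X in _ --> X]mulr1; apply: cvgM; first exact: cvg_cst.
  exact: abel_rV_cvg.
move=> cv; rewrite -(cvg_lim _ cv)//; apply: lime_le.
  by apply/cvg_ex; eexists; exact: cv.
by apply: nearW => k; exact: abel_plancherel_le.
Qed.

End plancherel.

End kernels.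

(** * The Riemann-Lebesgue lemma *)

Section riemann_lebesgue.
Context {R : realType} {n : nat}.
Local Notation mu := (lebesgue_rV R n).
Local Notation E := 'rV[R]_n.
Local Notation leb := (@lebesgue_measure R).
Implicit Types (f g : E -> R[i]) (x y w : E).

Lemma indic01 (A : set E) x : 0 <= (\1_A x : R) <= 1.
Proof. by rewrite indicE ler0n lern1 leq_b1. Qed.

Lemma box_prod (a b : 'I_n -> R) x :
  \1_(box a b) x = \prod_i \1_(`]a i, b i]) (x ord0 i) :> R.
Proof.
rewrite indicE; case: (boolP (x \in box a b)) => [|/negP xB].
  rewrite inE => xB; rewrite big1// => i _; rewrite indicE mem_set//=.
  by rewrite in_itv/=; exact: xB.
have [i hi] : exists i, ~ (a i < x ord0 i <= b i).
  by apply/existsNP => h; apply: xB; rewrite inE.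
by rewrite (bigD1 i)//= indicE memNset ?mul0r//= in_itv.
Qed.

Lemma box_prodC (a b : 'I_n -> R) : (fun x => (\1_(box a b) x)%:C) =
  prod_rV (fun i t => (\1_(`]a i, b i]) t : R)%:C).
Proof. by rewrite prod_rVC; apply/funext => x; rewrite box_prod. Qed.

Lemma cL1_indic_itv (a b : R) : cL1 leb (fun t => (\1_(`]a, b]) t : R)%:C).
Proof. by apply: cL1C; exact/integrable_indic_itv. Qed.

Lemma cL1_box (a b : 'I_n -> R) : cL1 mu (fun x => (\1_(box a b) x)%:C).
Proof. by rewrite box_prodC; apply: cL1_prod_rV => i; exact: cL1_indic_itv. Qed.

Lemma cint_box (a b : 'I_n -> R) : (forall i, a i <= b i) ->
  cint mu (fun x => (\1_(box a b) x)%:C) = (\prod_i (b i - a i))%:C.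
Proof.
move=> ab; rewrite box_prodC cint_prod_rV; last by move=> i; exact: cL1_indic_itv.
rewrite rmorph_prod; apply: eq_bigr => i _; rewrite cintC; congr (_%:C).
rewrite /Rintegral integral_indic// setIT [X in fine X](lebesgue_measure_itv `]a i, b i]).
rewrite /= lte_fin; case: ltP => // ba.
by apply/eqP; rewrite eq_sym subr_eq0 eq_le ab ba.
Qed.

Lemma normc_fhatB_le f g w : cL1 mu f -> cL1 mu g ->
  normc (fhat f w - fhat g w) <= \int[mu]_x normc (f x - g x).
Proof.
by move=> L1f L1g; rewrite -fhatB// normc_fhat_le//; exact: cL1B.
Qed.

Let le_of_sqr (z e : R) : 0 <= z -> 0 <= e -> z ^+ 2 <= e ^+ 2 -> z <= e.
Proof. by move=> z0 e0; rewrite ler_sqr. Qed.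

(* Below, g is the value [G w], v the volume of a box of radius d, t the integral
   of the tail of G and e the square of [eps / 2]. *)
Let mean_bound (v g t e : R) : g * v <= 2 * t + 2 * e * v -> t < v * e ->
  g * v <= 4 * e * v.
Proof. lra. Qed.

(** The transform of a square-integrable f is square-integrable, so its square
    has small integral far away; being uniformly continuous, it is comparable
    to its mean over a small box, hence small itself. *)
Lemma riemann_lebesgue_L2 f (eps : R) : cL1 mu f ->
  (\int[mu]_x (normc (f x) ^+ 2)%:E < +oo)%E -> 0 < eps ->
  exists M : R, forall w, M < l1norm w -> normc (fhat f w) <= eps.
Proof.
move=> L1f L2f eps0; have mf := cL1_cmfun L1f; have mF := cmfun_fhat mf.
pose eta := eps / 2; have eta0 : 0 < eta by rewrite divr_gt0.
have [d d0 hd] := fhat_unif_continuous L1f eta0.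
pose G w : R := normc (fhat f w) ^+ 2.
have mG : measurable_fun setT G by apply: measurable_funX; exact: cmfun_normc.
have G0 w : 0 <= G w by exact: sqr_ge0.
have iG : mu.-integrable setT (EFin \o G).
  apply/integrableP; split; first exact/measurable_EFinP.
  rewrite (_ : (fun x => _) = (fun x => (G x)%:E)).
    apply: le_lt_trans (plancherel_le L1f) _.
    by rewrite lte_mul_pinfty// lee_fin exprn_ge0// mulr_ge0// pi_ge0.
  by apply/funext => x /=; rewrite ger0_norm.
pose tail (M : R) x : R := \1_[set y | M < l1norm y] x * G x.
have mtailS M : measurable [set y : E | M < l1norm y].
  rewrite -[X in measurable X]setTI (_ : [set y | _] = l1norm @^-1` `]M, +oo[).
    by apply: measurable_l1norm => //; exact: measurable_itv.
  by apply/seteqP; split => y /=; rewrite in_itv/= andbT.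
have mtail M : measurable_fun setT (tail M).
  by apply: measurable_funM => //; exact: measurable_indic.
have tail_le M x : `|tail M x| <= G x.
  have /andP[i0 i1] := indic01 [set y | M < l1norm y] x.
  have t0 : 0 <= tail M x by exact: mulr_ge0.
  by rewrite (ger0_norm t0); exact: ler_piMl.
have itail M : mu.-integrable setT (EFin \o tail M).
  exact: (integrable_EFin_le (mtail M) iG).
pose B := box (fun=> - d : R) (fun=> d) : set E.
pose v := \prod_(i < n) (d - - d).
have v0 : 0 < v by apply: prodr_gt0 => i _; rewrite opprK addr_gt0.
have intB : cint mu (fun x => (\1_B x)%:C) = v%:C.
  by apply: cint_box => i; rewrite (le_trans _ (ltW d0))// oppr_le0 ltW.
have iB : mu.-integrable setT (EFin \o \1_B) by case: (cL1_box (fun=> - d) (fun=> d)).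
have rB : \int[mu]_x \1_B x = v by move: intB; rewrite cintC => /complexI.
have [M hM] : exists M, \int[mu]_x tail M x < v * (eta ^+ 2).
  have : (fun k => \int[mu]_x tail k%:R x) @ \oo --> (0 : R).
    have -> : (0 : R) = \int[mu]_x ((fun=> 0) x).
      by rewrite Rintegral_cst// mul0r.
    apply: (@Rdominated_cvg _ _ _ _ _ _ G) => //.
    apply: aeW => x; apply: cvg_near_cst.
    near=> k; rewrite /tail indicE memNset ?mul0r//=; apply/negP; rewrite -leNgt.
    by near: k; exact: nbhs_infty_ger.
  have e2 : 0 < v * eta ^+ 2 by rewrite mulr_gt0// exprn_gt0.
  move=> /cvgrPdist_lt/(_ _ e2)[K _ /(_ K (leqnn _))] hK.
  exists K%:R; apply: le_lt_trans hK.
  by rewrite sub0r normrN ler_norm.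
(* A translate by h in the box B changes the l1 norm by at most [n * d]. *)
exists (M + n%:R * d) => w Mw.
have tail0 h : 0 <= tail M h by exact: mulr_ge0.
(* [normc_sqrD] splits [G w] into the value at [h + w] and the increment. *)
have key h : \1_B h * G w <= 2 * tail M (h + w) + (2 * eta ^+ 2) * \1_B h.
  rewrite indicE; case: (boolP (h \in B)) => [|_]; last first.
    by rewrite mul0r mulr0 addr0; exact: mulr_ge0.
  rewrite inE => hB; rewrite mul1r mulr1.
  have hbd i : `|h ord0 i| <= d.
    by have := hB i; rewrite ler_norml => /andP[/ltW -> ->].
  rewrite /tail indicE mem_set ?mul1r; last first.
    rewrite /= -(ltrD2r (n%:R * d)) (lt_le_trans Mw)//.
    rewrite -[n in n%:R]card_ord mulr_natl -sumr_const -big_split/=.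
    apply: ler_sum => i _; rewrite mxE.
    have := ler_normB (h ord0 i + w ord0 i) (h ord0 i); have := hbd i.
    by rewrite addrAC subrr add0r; lra.
  rewrite /G; have -> : fhat f w = fhat f (h + w) + - (fhat f (w + h) - fhat f w).
    by rewrite [h + w]addrC; ring.
  rewrite (le_trans (normc_sqrD _ _))// lerD2l ler_wpM2l// normc_opp.
  by rewrite ler_sqr ?nnegrE ?normc_ge0 ?(ltW eta0)// hd.
have itailw : mu.-integrable setT (EFin \o (fun h => tail M (h + w))).
  by have [] := cL1_shift w (cL1C (itail M)).
have rtailw : \int[mu]_h tail M (h + w) = \int[mu]_h tail M h.
  by have := cint_shift w (cL1C (itail M)); rewrite !cintC => /complexI.
have i2t := integrable_EFinZ 2 itailw.
have i2B := integrable_EFinZ (2 * eta ^+ 2) iB.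
have iGB := integrable_EFinZ (G w) iB.
have : \int[mu]_h (G w * \1_B h) <=
       \int[mu]_h (2 * tail M (h + w) + (2 * eta ^+ 2) * \1_B h).
  apply: (le_Rintegral measurableT iGB (integrable_EFinD i2t i2B)) => h _.
  by rewrite mulrC key.
rewrite (RintegralD measurableT i2t i2B).
rewrite (RintegralZl (G w) measurableT iB) (RintegralZl 2 measurableT itailw).
rewrite (RintegralZl (2 * eta ^+ 2) measurableT iB) rB rtailw => h.
have := mean_bound h hM; rewrite (ler_pM2r v0) => hG.
have e4 : 4 * eta ^+ 2 = eps ^+ 2 by rewrite /eta; field.
by apply: le_of_sqr (normc_ge0 _) (ltW eps0) _; rewrite -e4; exact: hG.
Unshelve. all: by end_near. Qed.

(** Truncating the values of f leaves a square-integrable function and changes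
    the transform uniformly little. *)
Lemma riemann_lebesgue f (eps : R) : cL1 mu f -> 0 < eps ->
  exists M : R, forall w, M < l1norm w -> normc (fhat f w) <= eps.
Proof.
move=> L1f eps0; have mf := cL1_cmfun L1f.
pose S k : set E := [set x | normc (f x) <= k%:R].
have mS k : measurable (S k).
  rewrite -[X in measurable X]setTI (_ : S k = (fun x => normc (f x)) @^-1` `]-oo, k%:R]).
    by apply: (cmfun_normc mf) => //; exact: measurable_itv.
  by apply/seteqP; split => y /=; rewrite in_itv.
pose fk k x := (\1_(S k) x)%:C * f x.
have mfk k : cmfun (fk k).
  by apply: cmfunM => //; apply: cmfunC; exact: measurable_indic.
have fk_le k x : normc (fk k x) <= normc (f x).
  have /andP[i0 i1] := indic01 (S k) x.
  by rewrite normcM normcC ler_piMl ?normc_ge0// ger0_norm.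
have L1fk k : cL1 mu (fk k) by exact: (cL1_le_cL1 (mfk k) L1f).
have cv : (fun k => \int[mu]_x normc (f x - fk k x)) @ \oo --> (0 : R).
  have -> : (0 : R) = \int[mu]_x ((fun=> 0) x).
    by rewrite Rintegral_cst// mul0r.
  apply: (@Rdominated_cvg _ _ _ _ _ _ (fun x => 2 * normc (f x))) => //.
  - by move=> k; apply: cmfun_normc; exact: cmfunB.
  - apply: aeW => x; apply: cvg_near_cst; near=> k.
    rewrite /fk indicE mem_set ?mul1r ?subrr ?normc00//=.
    by near: k; exact: nbhs_infty_ger.
  - exact: (integrableZl measurableT 2 (cL1_normc L1f)).
  - move=> k x; rewrite normr_normc (le_trans (normc_tri _ _))// normc_opp.
    by rewrite mulr_natl mulr2n lerD2l.
have eps2 : 0 < eps / 2 by rewrite divr_gt0.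
move: cv => /cvgrPdist_lt/(_ _ eps2)[K _ /(_ K (leqnn _))] hK.
have {}hK : \int[mu]_x normc (f x - fk K x) < eps / 2.
  by apply: le_lt_trans hK; rewrite sub0r normrN ler_norm.
have L2 : (\int[mu]_x (normc (fk K x) ^+ 2)%:E < +oo)%E.
  have i2 := integrableZl measurableT K%:R (cL1_normc L1f).
  apply: le_lt_trans (integrable_lty measurableT i2).
  apply: ge0_le_integral => //.
  - by move=> x _; rewrite lee_fin sqr_ge0.
  - by apply/measurable_EFinP/measurable_funX; exact: cmfun_normc.
  - exact: measurable_int i2.
  move=> x _; rewrite -EFinM lee_fin expr2 ler_pM ?normc_ge0//.
  rewrite normcM normcC ger0_norm// indicE.
  case: (boolP (x \in S K)) => [|_]; last by rewrite mul0r.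
  by rewrite inE mul1r.
have [M hM] := riemann_lebesgue_L2 (L1fk K) L2 eps2.
exists M => w Mw; have -> : fhat f w = (fhat f w - fhat (fk K) w) + fhat (fk K) w.
  by rewrite subrK.
rewrite (le_trans (normc_tri _ _))// [leRHS](splitr eps) lerD ?hM//.
by rewrite (le_trans (normc_fhatB_le w L1f (L1fk K)))// ltW.
Unshelve. all: by end_near. Qed.

End riemann_lebesgue.

(** * Convolutions and derivatives *)

Section convolution.
Context {R : realType} {n : nat}.
Local Notation mu := (lebesgue_rV R n).
Local Notation E := 'rV[R]_n.
Implicit Types (f g : E -> R[i]).

Definition cconv f g (x : E) : R[i] := cint mu (fun z => f z * g (x - z)).

(** Integrating first in the variable of g, by translation invariance, bounds the
    double integral by the product of the norms of f and g. *)
Lemma cL1_conv_prod f g : cL1 mu f -> cL1 mu g ->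
  cL1 (mu \x mu)%E (fun p : E * E => f p.2 * g (p.1 - p.2)).
Proof.
move=> L1f L1g; have mf := cL1_cmfun L1f; have mg := cL1_cmfun L1g.
have mh : cmfun (fun p : E * E => f p.2 * g (p.1 - p.2)).
  apply: cmfunM; first exact: (cmfun_comp measurable_snd).
  by apply: (cmfun_comp _ mg); exact: measurable_rVB.
apply: cL1_prod => //.
rewrite (@fubini_tonelli _ _ _ _ _ mu mu
  (fun p => (normc (f p.2 * g (p.1 - p.2)))%:E))//; last 2 first.
- by apply/measurable_EFinP; exact: cmfun_normc.
- by move=> p; rewrite lee_fin normc_ge0.
have [_ foo] := (cL1P mu f).1 L1f; have [_ goo] := (cL1P mu g).1 L1g.
have mnf : measurable_fun setT (fun x => (normc (f x))%:E).
  by apply/measurable_EFinP; exact: cmfun_normc.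
have mng : measurable_fun setT (fun x => (normc (g x))%:E).
  by apply/measurable_EFinP; exact: cmfun_normc.
have c0 : (0 <= \int[mu]_x (normc (g x))%:E)%E.
  by apply: integral_ge0 => x _; rewrite lee_fin normc_ge0.
have f0 x : (0 <= (normc (f x))%:E)%E by rewrite lee_fin normc_ge0.
have g0 x : (0 <= (normc (g x))%:E)%E by rewrite lee_fin normc_ge0.
rewrite (eq_integral (fun z => (normc (f z))%:E * \int[mu]_x (normc (g x))%:E)%E).
  rewrite ge0_integralZr// lte_mul_pinfty ?integral_ge0//.
  by rewrite ge0_fin_numE ?integral_ge0.
move=> z _; rewrite -(@ge0_integral_shift _ _ (- z) (fun x => (normc (g x))%:E))//.
rewrite -ge0_integralZl//.
  by apply: eq_integral => x _; rewrite normcM.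
by apply/measurable_EFinP/cmfun_normc/(cmfun_comp _ mg); exact: measurable_rVB.
Qed.

Lemma cL1_cconv f g : cL1 mu f -> cL1 mu g -> cL1 mu (cconv f g).
Proof. by move=> L1f L1g; have [] := cfubini1 (cL1_conv_prod L1f L1g). Qed.

Lemma ae_cL1_cconv f g : cL1 mu f -> cL1 mu g ->
  \forall x \ae mu, cL1 mu (fun z => f z * g (x - z)).
Proof. by move=> L1f L1g; exact: (ae_cL1 (cL1_conv_prod L1f L1g)). Qed.

(** After exchanging the integrals, the inner one is the transform of the
    translate of g by z, which is [expi (- dot z w) * fhat g w]. *)
Lemma fhat_cconv f g w : cL1 mu f -> cL1 mu g ->
  fhat (cconv f g) w = fhat f w * fhat g w.
Proof.
move=> L1f L1g.
pose h (p : E * E) := expi (- dot w p.1) * (f p.2 * g (p.1 - p.2)).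
have L1h : cL1 (mu \x mu)%E h.
  apply: cL1_expi; last exact: cL1_conv_prod.
  by apply: measurableT_comp => //; exact: measurable_dot.
transitivity (cint mu (fun x => cint mu (fun z => h (x, z)))).
  have mf := cL1_cmfun L1f; have mg := cL1_cmfun L1g.
  apply: ae_eq_cint.
  - apply: cmfunM; first by apply: cmfun_expi; exact: measurable_Ndot.
    exact: (cL1_cmfun (cL1_cconv L1f L1g)).
  - exact: (cL1_cmfun (cfubini1 L1h).1).
  - by apply: filterS (ae_cL1_cconv L1f L1g) => x L1x; rewrite -cintMl.
rewrite (cFubini L1h) /h /=.
transitivity (cint mu (fun z => (expi (- dot w z) * f z) * fhat g w)).
  apply: eq_cint => z; rewrite -mulrA mulrCA (dotC w z) -fhat_shift// /fhat.
  rewrite -cintMl; last by apply: cL1_fhat; exact: cL1_shift.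
  by apply: eq_cint => x; rewrite mulrCA.
by rewrite cintMr//; exact: cL1_fhat.
Qed.

End convolution.

Section derivative.
Context {R : realType}.
Local Notation leb := (@lebesgue_measure R).

(** Derivatives and continuity of complex functions of a real variable are taken
    on real and imaginary parts, where the real fundamental theorem applies. *)
Definition cderiv (u du : R -> R[i]) : Prop := forall s : R,
  is_derive s (1 : R) (fun s => Re (u s)) (Re (du s)) /\
  is_derive s (1 : R) (fun s => Im (u s)) (Im (du s)).

Definition ccontinuous (u : R -> R[i]) : Prop :=
  continuous (fun s => Re (u s)) /\ continuous (fun s => Im (u s)).

Lemma Rintegral_derive (F f : R -> R) (t : R) : 0 < t ->
  (forall x, is_derive x (1 : R) F (f x)) -> continuous f ->
  leb.-integrable setT (EFin \o (fun s => \1_(`[0, t]) s * f s)) /\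
  \int[leb]_s (\1_(`[0, t]) s * f s) = F t - F 0.
Proof.
move=> t0 dF cf.
have E : (fun s => \1_(`[0, t]) s * f s) = f \_ `[0, t].
  apply/funext => s; rewrite patchE indicE.
  by case: ifPn => _; rewrite ?mul1r ?mul0r.
rewrite E; split.
  rewrite -restrict_EFin; apply/integrable_restrict => //=.
  rewrite setTI; apply: continuous_compact_integrable; first exact: segment_compact.
  exact: continuous_subspaceT.
rewrite -Rintegral_mkcond /Rintegral (@continuous_FTC2 _ f F)//.
- exact: continuous_subspaceT.
- have cF := is_derive1_cont dF; split.
  + by move=> x _; case: (dF x).
  + by apply: cvg_at_right_filter; exact: cF.
  + by apply: cvg_at_left_filter; exact: cF.
- by move=> x _; rewrite derive1E; case: (dF x).
Qed.

Lemma cint_derive (u du : R -> R[i]) (t : R) : 0 < t ->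
  cderiv u du -> ccontinuous du ->
  cL1 leb (fun s => (\1_(`[0, t]) s)%:C * du s) /\
  cint leb (fun s => (\1_(`[0, t]) s)%:C * du s) = u t - u 0.
Proof.
move=> t0 dE [cr ci].
have [ir er] := Rintegral_derive t0 (fun s => (dE s).1) cr.
have [ii ei] := Rintegral_derive t0 (fun s => (dE s).2) ci.
have ER s : Re ((\1_(`[0, t]) s)%:C * du s) = \1_(`[0, t]) s * Re (du s).
  by rewrite ReM ReC ImC mul0r subr0.
have EI s : Im ((\1_(`[0, t]) s)%:C * du s) = \1_(`[0, t]) s * Im (du s).
  by rewrite ImM ReC ImC mul0r addr0.
split.
  by split; [under eq_fun do rewrite ER|under eq_fun do rewrite EI].
apply: complexP; rewrite ?ReD ?ImD ?ReN ?ImN.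
  by rewrite -er; apply: eq_Rintegral => s _; rewrite ER.
by rewrite -ei; apply: eq_Rintegral => s _; rewrite EI.
Qed.

Lemma is_derive_mulr_cst (c s : R) : is_derive s (1 : R) (fun s : R => s * c) c.
Proof.
have -> : (fun s : R => s * c) = c \*: id by apply/funext => x; rewrite mulrC.
by apply: is_derive_eq; rewrite /GRing.scale/= mulr1.
Qed.

Lemma cderiv_expi (c : R) :
  cderiv (fun s => expi (s * c)) (fun s => 'i%C * c%:C * expi (s * c)).
Proof.
move=> s; have dl := is_derive_mulr_cst c s; split => /=.
  have h := @is_derive1_comp R cos (fun s : R => s * c) s _ _ (is_derive_cos _) dl.
  by rewrite (_ : _ - _ = - sin (s * c) * c); [exact: h|ring].
have h := @is_derive1_comp R sin (fun s : R => s * c) s _ _ (is_derive_sin _) dl.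
by rewrite (_ : _ + _ = cos (s * c) * c); [exact: h|ring].
Qed.

Lemma ccontinuous_expi (c : R) : ccontinuous (fun s => expi (s * c)).
Proof.
by split; apply: is_derive1_cont => s; have [] := cderiv_expi c s; [move=> h _; exact: h|move=> _ h; exact: h].
Qed.

Lemma ccontinuousMl (z : R[i]) (u : R -> R[i]) : ccontinuous u ->
  ccontinuous (fun s => z * u s).
Proof.
move=> [cr ci]; split.
  rewrite (_ : (fun _ => _) = fun s => Re z * Re (u s) - Im z * Im (u s)) => [s|].
    by apply: cvgB; apply: cvgM; try exact: cvg_cst; [exact: cr|exact: ci].
  by apply/funext => s; rewrite ReM.
rewrite (_ : (fun _ => _) = fun s => Re z * Im (u s) + Im z * Re (u s)) => [s|].
  by apply: cvgD; apply: cvgM; try exact: cvg_cst; [exact: ci|exact: cr].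
by apply/funext => s; rewrite ImM.
Qed.

(** The integral of [expi (s * c)] over [0, t] is nonzero for a suitable t: half
    a period when [c != 0]. *)
Lemma cint_expi_neq0 (c : R) : exists2 t : R, 0 < t &
  [/\ cL1 leb (fun s => (\1_(`[0, t]) s)%:C * expi (s * c)),
      cint leb (fun s => (\1_(`[0, t]) s)%:C * expi (s * c)) != 0 &
      'i%C * c%:C * cint leb (fun s => (\1_(`[0, t]) s)%:C * expi (s * c)) =
      expi (t * c) - 1].
Proof.
have [->|c0] := eqVneq c 0.
  exists 1 => //.
  have d1 : cderiv (fun s => s%:C) (fun s => expi (s * 0)).
    by move=> s /=; rewrite mulr0 cos0 sin0; split; [exact: is_derive_id|exact: is_derive_cst].
  have [L1e ->] := cint_derive ltr01 d1 (ccontinuous_expi 0).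
  split => //; first by rewrite subr0 oner_eq0.
  by rewrite mulr0 mul0r mulr0 expi0 subrr.
have c0' : 0 < `|c| by rewrite normr_gt0.
have t0 : 0 < pi / `|c| by rewrite divr_gt0// pi_gt0.
exists (pi / `|c|) => //.
have [L1de ide] := cint_derive t0 (cderiv_expi c)
  (ccontinuousMl ('i%C * c%:C) (ccontinuous_expi c)).
have ic0 : 'i%C * c%:C != 0 :> R[i].
  rewrite mulf_neq0//; first by rewrite eq_complex /= oner_eq0 andbF.
  by rewrite eq_complex /= negb_and c0.
have L1e : cL1 leb (fun s => (\1_(`[0, pi / `|c|]) s)%:C * expi (s * c)).
  have := cL1Ml ('i%C * c%:C)^-1 L1de.
  by under eq_fun do rewrite mulrCA [X in _ * X]mulrA mulVf// mul1r.
have ie : 'i%C * c%:C * cint leb (fun s => (\1_(`[0, pi / `|c|]) s)%:C * expi (s * c)) =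
      expi (pi / `|c| * c) - 1.
  rewrite -cintMl//; under eq_cint do rewrite mulrCA.
  by rewrite ide mul0r expi0.
split => //; apply/negP => /eqP i0; move: ie; rewrite i0 mulr0 => /esym/eqP.
have -> : expi (pi / `|c| * c) = -1 :> R[i].
  have [cp|cn] := leP 0 c.
    by rewrite ger0_norm// divfK// /expi cospi sinpi; apply: complexP; rewrite /= ?oppr0.
  rewrite ltr0_norm// invrN mulrN mulNr divfK// /expi cosN sinN cospi sinpi.
  by apply: complexP; rewrite /= ?oppr0.
by rewrite -opprD oppr_eq0 eq_complex /= -mulr2n pnatr_eq0.
Qed.

Context {n : nat}.
Local Notation mu := (lebesgue_rV R n).
Local Notation E := 'rV[R]_n.

(** Writing the increment of f along the segment of length t in direction j as
    the integral of df and exchanging integrals gives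
    [c * fhat df w = (expi (t * w j) - 1) * fhat f w], where c is the integral
    of [expi (s * w j)] over [0, t]. *)
Lemma fhat_partial (f df : E -> R[i]) (j : 'I_n) (w : E) :
  cL1 mu f -> cL1 mu df ->
  (forall xi, cderiv (fun s => f (xi + s *: delta_mx ord0 j))
                     (fun s => df (xi + s *: delta_mx ord0 j))) ->
  (forall xi, ccontinuous (fun s => df (xi + s *: delta_mx ord0 j))) ->
  fhat df w = 'i%C * (w ord0 j)%:C * fhat f w.
Proof.
move=> L1f L1df dfE cdf; set ej : E := delta_mx ord0 j.
have dotej s : dot w (s *: ej) = s * w ord0 j.
  rewrite dotZr; congr (_ * _); rewrite /dot (bigD1 j)//= mxE !eqxx mulr1.
  rewrite big1 ?addr0// => i ij; rewrite mxE eqxx /= (negbTE ij).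
  by rewrite mulr0.
have [t t0 [L1e e_neq0 eE]] := cint_expi_neq0 (w ord0 j).
pose I s : R[i] := (\1_(`[0, t]) s)%:C.
pose h (p : measurableTypeR R * E) : R[i] :=
  I p.1 * (expi (- dot w p.2) * df (p.2 + p.1 *: ej)).
have L1I : cL1 leb I.
  by apply: cL1C; apply/integrable_indic_itv.
have mdf := cL1_cmfun L1df.
have mh : cmfun h.
  apply: cmfunM.
    by apply: (cmfun_comp (f := I)); [exact: measurable_fst|exact: cL1_cmfun L1I].
  apply: cmfunM.
    by apply: cmfun_expi; apply: measurableT_comp => //; exact: measurable_dot.
  by apply: (cmfun_comp _ mdf); apply: measurable_rVD => //; exact: measurable_rVZ.
have L1h : cL1 (leb \x mu)%E h.
  apply: cL1_prod => //.
  have [_ dfoo] := (cL1P mu df).1 L1df; have [_ Ioo] := (cL1P leb I).1 L1I.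
  have df0 x : (0 <= (normc (df x))%:E)%E by rewrite lee_fin normc_ge0.
  have I0 x : (0 <= (normc (I x))%:E)%E by rewrite lee_fin normc_ge0.
  have mndf : measurable_fun setT (fun x => (normc (df x))%:E).
    by apply/measurable_EFinP; exact: cmfun_normc.
  rewrite (eq_integral (fun s : measurableTypeR R => (normc (I s))%:E * \int[mu]_x (normc (df x))%:E)%E).
    rewrite ge0_integralZr ?integral_ge0//.
      rewrite lte_mul_pinfty ?integral_ge0//.
      by rewrite ge0_fin_numE ?integral_ge0.
    by apply/measurable_EFinP/cmfun_normc; exact: cL1_cmfun L1I.
  move=> s _; rewrite -(@ge0_integral_shift _ _ (s *: ej) (fun x => (normc (df x))%:E))//.
  rewrite -ge0_integralZl//.
    by apply: eq_integral => x _; rewrite /h /= normcM (normcM (expi _)) normc_expi mul1r.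
  by apply/measurable_EFinP/cmfun_normc/(cmfun_comp _ mdf); exact: measurable_rVD.
have := cFubini L1h; rewrite /h /=.
have -> : cint leb (fun s => cint mu (fun x =>
    I s * (expi (- dot w x) * df (x + s *: ej)))) =
    cint leb (fun s => I s * expi (s * w ord0 j)) * fhat df w.
  rewrite -cintMr//; apply: eq_cint => s.
  rewrite cintMl; last by apply: cL1_fhat; exact: cL1_shift.
  rewrite -mulrA; congr (_ * _).
  have := fhat_shift (- (s *: ej)) w L1df.
  by rewrite dotC dotC -dotNl opprK dotC dotej => <-.
have -> : cint mu (fun x => cint leb (fun s =>
    I s * (expi (- dot w x) * df (x + s *: ej)))) =
    (expi (t * w ord0 j) - 1) * fhat f w.
  transitivity (cint mu (fun x => expi (- dot w x) * f (x + t *: ej) -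
      expi (- dot w x) * f x)).
    apply: eq_cint => x; have [L1s Es] := cint_derive t0 (dfE x) (cdf x).
    under eq_cint do rewrite mulrCA; rewrite cintMl//.
    by rewrite Es scale0r addr0 mulrBr.
  rewrite cintB; [|by apply: cL1_fhat; exact: cL1_shift|exact: cL1_fhat].
  rewrite mulrBl mul1r; congr (_ - _).
  have := fhat_shift (- (t *: ej)) w L1f.
  by rewrite dotC dotC -dotNl opprK dotC dotej => <-.
by rewrite -eE mulrAC [in RHS]mulrC => /(mulfI e_neq0).
Qed.

End derivative.

(** * Fourier inversion *)

Section inversion.
Context {R : realType} {n : nat}.
Local Notation mu := (lebesgue_rV R n).
Local Notation E := 'rV[R]_n.
Local Notation leb := (@lebesgue_measure R).
Implicit Types (f g : E -> R[i]) (a b : 'I_n -> R).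

(** The sets on which the integral of q vanishes form a lambda-system containing
    the boxes, hence all measurable sets. *)
Lemma integral_box_eq0 (q : E -> R) : mu.-integrable setT (EFin \o q) ->
  \int[mu]_x q x = 0 -> (forall a b, \int[mu]_(x in box a b) q x = 0) ->
  \forall x \ae mu, q x = 0.
Proof.
move=> iq qT qB.
have iS S : measurable S -> mu.-integrable S (EFin \o q).
  by move=> mS; apply: integrableS iq.
have fE S : measurable S -> (\int[mu]_(x in S) (q x)%:E)%E = (\int[mu]_(x in S) q x)%:E.
  by move=> mS; rewrite /Rintegral fineK//; apply: integrable_fin_num => //; exact: iS.
have h S : measurable S -> \int[mu]_(x in S) q x = 0.
  rewrite measurable_boxes.
  apply: (@dynkin_induction _ _ (boxes (R := R) (n := n))
      [set S | \int[mu]_(x in S) q x = 0]) => //.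
  - exact: measurable_boxes.
  - exact: boxes_setI_closed.
  - by move=> _ [[a b] _ <-]; exact: qB.
  - move=> {}S mS /= S0.
    have := @Rintegral_setU _ _ _ mu S (~` S) q mS (measurableC mS).
    rewrite setUv => /(_ iq); rewrite qT S0 add0r => <-//.
    by apply/disj_set2P; rewrite setICr.
  - move=> F mF tF /= F0; rewrite /Rintegral integral_bigcup//; last first.
      by apply: iS; exact: bigcup_measurable.
    by rewrite eseries0// => i _ _; rewrite fE// F0.
have : ae_eq mu setT (EFin \o q) (cst 0)%E.
  apply: integral_ae_eq => // S _ mS; rewrite [LHS]fE// h// integral0.
  by [].
by apply: filterS => x /(_ I)[].
Qed.

(** The functions need only be integrable on boxes: cutting the difference off
    by each cube of an exhausting sequence makes it integrable. *)
Lemma box_determine f g : cmfun f -> cmfun g ->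
  (forall a b, cL1 mu (fun x => (\1_(box a b) x)%:C * f x)) ->
  (forall a b, cL1 mu (fun x => (\1_(box a b) x)%:C * g x)) ->
  (forall a b, cint mu (fun x => (\1_(box a b) x)%:C * f x) =
               cint mu (fun x => (\1_(box a b) x)%:C * g x)) ->
  \forall x \ae mu, f x = g x.
Proof.
move=> mf mg L1f L1g fg.
pose Q (k : nat) : set E := box (fun=> - k%:R) (fun=> k%:R).
pose q k x := (\1_(Q k) x)%:C * f x - (\1_(Q k) x)%:C * g x.
have L1q k : cL1 mu (q k) := cL1B (L1f _ _) (L1g _ _).
have qT k : cint mu (q k) = 0 by rewrite /q /Q cintB// fg subrr.
have qB k a b : cint mu (fun x => (\1_(box a b) x)%:C * q k x) = 0.
  have [[c e] _ /= ceE] := boxes_setI_closed (boxesP a b) (boxesP (fun=> - k%:R) (fun=> k%:R)).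
  have E1 u x : (\1_(box a b) x)%:C * ((\1_(Q k) x)%:C * u x) = (\1_(box c e) x)%:C * u x :> R[i].
    by rewrite mulrA -rmorphM /= ceE indicI.
  under eq_cint do rewrite /q mulrBr !E1.
  by rewrite cintB// fg subrr.
have q0 k : \forall x \ae mu, q k x = 0.
  have [ir ii] := L1q k.
  have RB a b : \int[mu]_(x in box a b) Re (q k x) = 0.
    rewrite Rintegral_mkcond; have := congr1 (@complex.Re R) (qB k a b) => /= <-.
    apply: eq_Rintegral => x _; rewrite patchE ReM ReC ImC mul0r subr0 indicE.
    by case: ifPn => _; rewrite ?mul1r ?mul0r.
  have IB a b : \int[mu]_(x in box a b) Im (q k x) = 0.
    rewrite Rintegral_mkcond; have := congr1 (@complex.Im R) (qB k a b) => /= <-.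
    apply: eq_Rintegral => x _; rewrite patchE ImM ReC ImC mul0r addr0 indicE.
    by case: ifPn => _; rewrite ?mul1r ?mul0r.
  have RT : \int[mu]_x Re (q k x) = 0 by exact: (congr1 (@complex.Re R) (qT k)).
  have IT : \int[mu]_x Im (q k x) = 0 by exact: (congr1 (@complex.Im R) (qT k)).
  have hr := integral_box_eq0 ir RT RB; have hi := integral_box_eq0 ii IT IB.
  by apply: filterS2 hr hi => x hrx hix; apply: complexP.
apply: filterS (ae_foralln q0) => x hx.
have [k _ Qx] : (\bigcup_k Q k) x by rewrite bigcup_box.
have := hx k; rewrite /q indicE mem_set// !mul1r => /eqP.
by rewrite subr_eq0 => /eqP.
Qed.

Lemma ae_coord_neq (i : 'I_n) (c : R) : \forall x \ae mu, (x : E) ord0 i != c.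
Proof.
exists [set x : E | [set c] (x ord0 i)]; split.
- by rewrite -[X in measurable X]setTI; apply: measurable_rV_coord.
- by apply: (@coord_null _ _ i [set c]) => //; exact: lebesgue_measure_set1.
- by move=> x /= /negP; rewrite negbK => /eqP.
Qed.

Definition poisson_box e a b (x : E) : R :=
  \prod_i poisson_mass e (a i) (b i) (x ord0 i).

Lemma poisson_box_cvg a b : \forall x \ae mu,
  (fun k => poisson_box k.+1%:R^-1 a b x) @ \oo --> (2 * pi) ^+ n * \1_(box a b) x.
Proof.
have ha : \forall x \ae mu, forall i, (x : E) ord0 i != a i.
  by apply: filter_forall => i; exact: ae_coord_neq.
have hb : \forall x \ae mu, forall i, (x : E) ord0 i != b i.
  by apply: filter_forall => i; exact: ae_coord_neq.
apply: filterS2 ha hb => x xa xb.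
rewrite box_prod; have -> : (2 * pi) ^+ n = \prod_(i < n) (2 * pi) :> R.
  by rewrite prodr_const card_ord.
rewrite -big_split/=.
rewrite /poisson_box; apply: cvg_big; first exact: mul_continuous.
by move=> i _; exact: poisson_mass_cvg.
Qed.

Lemma poisson_box_bound e a b x : 0 < e -> 0 <= poisson_box e a b x <= (2 * pi) ^+ n.
Proof.
move=> e0; have h i := poisson_mass_bound e0 (a i) (b i) (x ord0 i).
have -> : (2 * pi) ^+ n = \prod_(i < n) (2 * pi) :> R.
  by rewrite prodr_const card_ord.
apply/andP; split.
  by apply: prodr_ge0 => i _; have /andP[] := h i.
by apply: ler_prod => i _; exact: h.
Qed.

Lemma cint_poisson_box e a b x : 0 < e ->
  cint mu (fun y => (\1_(box a b) y)%:C * (poisson_rV e (y - x))%:C) =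
  (poisson_box e a b x)%:C.
Proof.
move=> e0; rewrite (_ : (fun _ => _) = prod_rV (fun i t =>
    (\1_(`]a i, b i]) t * poisson e (t - x ord0 i))%:C)).
  rewrite cint_prod_rV; last by move=> i; exact: cL1_poisson_itv.
  by rewrite /poisson_box rmorph_prod; apply: eq_bigr => i _; exact: cint_poisson_itv.
apply/funext => y; rewrite prod_rVC -rmorphM box_prod /poisson_rV -big_split/=.
by congr (_%:C); apply: eq_bigr => i _; rewrite !mxE.
Qed.

Lemma measurable_poisson_box e a b : 0 < e ->
  measurable_fun setT (poisson_box e a b).
Proof.
move=> e0; have [] : cmfun (fun x : E => (poisson_box e a b x)%:C); last by [].
rewrite (_ : (fun _ => _) = fun x => cint mu (fun y =>
    (\1_(box a b) y)%:C * (poisson_rV e (y - x))%:C)).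
  apply: (@cmfun_cint1 _ _ E E R mu
    (fun p => (\1_(box a b) p.2)%:C * (poisson_rV e (p.2 - p.1))%:C)).
  apply: cmfunM.
    exact: (@cmfun_comp R _ _ _ _ snd _ measurable_snd (cL1_cmfun (cL1_box a b))).
  apply: cmfunC; apply: (measurableT_comp (measurable_poisson_rV e0)).
  exact: measurable_rVB.
by apply/funext => x; rewrite cint_poisson_box.
Qed.

(** The Abel means [H k] of the inverse integral, integrated over the box, have
    two limits as the parameter tends to zero: by dominated convergence the
    integral of the inverse integral itself, and, since they are Poisson means
    of f, by Fubini and the symmetry of the kernel the limit of the integrals of
    f against the Poisson means of the indicator of the box. The latter tend to
    [(2 * pi) ^+ n] times the indicator off the faces of the box, which are null.
    Only the Poisson means of a box have to be computed. *)
Lemma inversion_box f a b : cL1 mu f -> cL1 mu (fhat f) ->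
  cint mu (fun y => (\1_(box a b) y)%:C * cint mu (fun w => expi (dot w y) * fhat f w)) =
  ((2 * pi) ^+ n)%:C * cint mu (fun x => (\1_(box a b) x)%:C * f x).
Proof.
move=> L1f L1F; have mf := cL1_cmfun L1f; have mF := cL1_cmfun L1F.
pose ek (k : nat) : R := k.+1%:R^-1; have ek0 k : 0 < ek k by rewrite invr_gt0.
pose B := box a b; pose I y : R[i] := (\1_B y)%:C.
have L1I : cL1 mu I by exact: cL1_box.
have mI := cL1_cmfun L1I.
pose C : R := \int[mu]_w normc (fhat f w).
have mphase : cmfun (fun p : E * E => expi (dot p.2 p.1) * fhat f p.2).
  apply: cmfunM; last exact: (cmfun_comp measurable_snd).
  by apply: cmfun_expi; exact: measurable_dot.
pose G y := cint mu (fun w => expi (dot w y) * fhat f w).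
pose H k y := cint mu (fun w => (abel_rV (ek k) w)%:C * (expi (dot w y) * fhat f w)).
have L1G y : cL1 mu (fun w => expi (dot w y) * fhat f w).
  by apply: cL1_expi => //; exact: measurable_dot.
have mabel k : cmfun (fun w : E => (abel_rV (ek k) w)%:C).
  by apply: cmfunC; exact: measurable_abel_rV.
have abel_le k (w : E) : normc ((abel_rV (ek k) w)%:C : R[i]) <= 1.
  by rewrite normcC ger0_norm ?abel_rV_ge0// abel_rV_le1// ltW.
have L1H k y : cL1 mu (fun w => (abel_rV (ek k) w)%:C * (expi (dot w y) * fhat f w)).
  exact: cL1_mod.
have phase_norm w y : normc (expi (dot w y) * fhat f w) = normc (fhat f w).
  by rewrite normcM normc_expi mul1r.
have HG y : (fun k => normc (H k y - G y)) @ \oo --> (0 : R).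
  apply: (cdominated_cvg _ _ _ (cL1_normc L1F)).
  - by move=> k; exact: cL1_cmfun (L1H k y).
  - exact: cL1_cmfun (L1G y).
  - apply: aeW => w; rewrite -[X in _ --> X](mul0r (normc (fhat f w))).
    rewrite (_ : (fun _ => _) = fun k => `|abel_rV (ek k) w - 1| * normc (fhat f w)).
      apply: cvgM; last exact: cvg_cst.
      rewrite -[X in _ --> X](@normr0 _ R) -(subrr 1); apply: cvg_norm.
      by apply: cvgB; [exact: abel_rV_cvg|exact: cvg_cst].
    apply/funext => k; rewrite -[X in _ - X]mul1r -mulrBl normcM phase_norm.
    by rewrite -normcC rmorphB.
  - move=> k w; rewrite normcM phase_norm ler_piMl ?normc_ge0//.
  - by move=> w; rewrite phase_norm.
have G_le y : normc (G y) <= C.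
  rewrite (le_trans (normc_cint_le (L1G y)))//.
  by under eq_Rintegral do rewrite phase_norm.
have H_le k y : normc (H k y) <= C.
  rewrite (le_trans (normc_cint_le (L1H k y)))//; apply: le_Rintegral => //.
  - exact: cL1_normc.
  - exact: cL1_normc.
  - by move=> w _; rewrite normcM phase_norm ler_piMl ?normc_ge0.
have mG : cmfun G.
  exact: (@cmfun_cint1 _ _ E E R mu (fun p => expi (dot p.2 p.1) * fhat f p.2)).
have mH k : cmfun (H k).
  apply: (@cmfun_cint1 _ _ E E R mu
    (fun p => (abel_rV (ek k) p.2)%:C * (expi (dot p.2 p.1) * fhat f p.2))).
  apply: cmfunM => //.
  exact: (@cmfun_comp R _ _ _ _ snd _ measurable_snd (mabel k)).
(* First limit: [H k] tends to G boundedly. *)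
have lim1 : (fun k => normc (cint mu (fun y => I y * H k y) -
    cint mu (fun y => I y * G y))) @ \oo --> (0 : R).
  apply: (cdominated_cvg (g := fun y => C * normc (I y))).
  - by move=> k; exact: cmfunM.
  - exact: cmfunM.
  - apply: aeW => y; rewrite -[X in _ --> X](mulr0 (normc (I y))).
    rewrite (_ : (fun _ => _) = fun k => normc (I y) * normc (H k y - G y)).
      by apply: cvgM; [exact: cvg_cst|exact: HG].
    by apply/funext => k; rewrite -mulrBr normcM.
  - exact: integrable_EFinZ (cL1_normc L1I).
  - by move=> k y; rewrite normcM mulrC ler_wpM2r ?normc_ge0.
  - by move=> y; rewrite normcM mulrC ler_wpM2r ?normc_ge0.
have HE k y : H k y = cint mu (fun x => f x * (poisson_rV (ek k) (x - y))%:C).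
  rewrite -abel_inverse//; apply: eq_cint => w.
  by rewrite dotC; ring.
pose M k x : R[i] := (poisson_box (ek k) a b x)%:C.
have HM k : cint mu (fun y => I y * H k y) = cint mu (fun x => f x * M k x).
  pose h (p : E * E) := (poisson_rV (ek k) (p.2 - p.1))%:C * (I p.1 * f p.2).
  have mp : measurable_fun setT (fun p : E * E => poisson_rV (ek k) (p.2 - p.1)).
    by apply: (measurableT_comp (measurable_poisson_rV (ek0 k))); exact: measurable_rVB.
  have L1h : cL1 (mu \x mu)%E h.
    apply: (cL1_le_cL1 _ (cL1Ml ((2 / ek k) ^+ n)%:C (cL1_tensor L1I L1f))).
      apply: cmfunM; first exact: cmfunC.
      exact: cL1_cmfun (cL1_tensor L1I L1f).
    move=> p; rewrite /h (normcM (poisson_rV _ _)%:C) (normcM (_ ^+ n)%:C).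
    rewrite ler_wpM2r ?normc_ge0// !normcC !ger0_norm ?poisson_rV_ge0 ?poisson_rV_le//.
    by rewrite exprn_ge0// divr_ge0// ltW.
  have := cFubini L1h; rewrite /h /= => hE.
  transitivity (cint mu (fun y => cint mu (fun x =>
      (poisson_rV (ek k) (x - y))%:C * (I y * f x)))).
    apply: eq_cint => y; rewrite HE -cintMl; last exact: cL1_mul_poisson.
    by apply: eq_cint => x; ring.
  rewrite hE; apply: eq_cint => x; rewrite /M -(cint_poisson_box a b x (ek0 k)).
  rewrite -cintMl; last exact: cL1_mul_poisson.
  by apply: eq_cint => y; rewrite poisson_rV_distC -/(I y); ring.
have c0 : 0 <= (2 * pi) ^+ n :> R by rewrite exprn_ge0// mulr_ge0// pi_ge0.
have mM k : measurable_fun setT (poisson_box (ek k) a b).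
  exact: measurable_poisson_box.
(* Second limit: the Poisson means of the box converge boundedly. *)
have lim2 : (fun k => normc (cint mu (fun x => f x * M k x) -
    cint mu (fun x => f x * ((2 * pi) ^+ n * \1_B x)%:C))) @ \oo --> (0 : R).
  apply: (cdominated_cvg (g := fun x => (2 * pi) ^+ n * normc (f x))).
  - by move=> k; apply: cmfunM => //; exact: cmfunC.
  - apply: cmfunM => //; apply: cmfunC; apply: measurable_funM => //.
    by apply: measurable_indic; exact: measurable_box.
  - apply: filterS (poisson_box_cvg a b) => x hx.
    rewrite -[X in _ --> X](mulr0 (normc (f x))).
    rewrite (_ : (fun _ => _) = fun k => normc (f x) *
      `|poisson_box (ek k) a b x - (2 * pi) ^+ n * \1_B x|).
      apply: cvgM; first exact: cvg_cst.
      rewrite -[X in _ --> X](@normr0 _ R) -(subrr ((2 * pi) ^+ n * \1_B x)).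
      by apply: cvg_norm; apply: cvgB; [exact: hx|exact: cvg_cst].
    by apply/funext => k; rewrite -mulrBr normcM -normcC rmorphB.
  - exact: integrable_EFinZ (cL1_normc L1f).
  - move=> k x; rewrite normcM mulrC ler_wpM2r ?normc_ge0// normcC.
    by have /andP[? ?] := poisson_box_bound a b x (ek0 k); rewrite ger0_norm.
  - move=> x; rewrite normcM mulrC ler_wpM2r ?normc_ge0// normcC.
    have /andP[i0 i1] := indic01 B x.
    by rewrite ger0_norm ?mulr_ge0// ler_piMr.
have lim1' : (fun k => normc (cint mu (fun x => f x * M k x) -
    cint mu (fun y => I y * G y))) @ \oo --> (0 : R).
  by under eq_fun do rewrite -HM.
rewrite (ccvg_unique lim1' lim2).
rewrite -cintMl; last first.
  apply: cL1_mod => // y; rewrite normcC.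
  by have /andP[i0 i1] := indic01 B y; rewrite ger0_norm.
by apply: eq_cint => x; rewrite rmorphM /=; ring.
Qed.

(** By [inversion_box] both sides have the same integral over every box. *)
Theorem fourier_inversion f : cL1 mu f -> cL1 mu (fhat f) ->
  \forall y \ae mu, f y = ((2 * pi) ^- n)%:C *
    cint mu (fun w => expi (dot w y) * fhat f w).
Proof.
move=> L1f L1F; have mf := cL1_cmfun L1f; have mF := cL1_cmfun L1F.
have c0 : (2 * pi) ^+ n != 0 :> R by rewrite expf_neq0// mulf_neq0// gt_eqF// pi_gt0.
have mG : cmfun (fun y => cint mu (fun w => expi (dot w y) * fhat f w)).
  apply: (@cmfun_cint1 _ _ E E R mu (fun p => expi (dot p.2 p.1) * fhat f p.2)).
  apply: cmfunM; last exact: (cmfun_comp measurable_snd).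
  by apply: cmfun_expi; exact: measurable_dot.
have L1G a b : cL1 mu (fun y => (\1_(box a b) y)%:C *
    cint mu (fun w => expi (dot w y) * fhat f w)).
  apply: (cL1_le_cL1 _ (cL1Ml (\int[mu]_w normc (fhat f w))%:C (cL1_box a b))).
    by apply: cmfunM => //; exact: cL1_cmfun (cL1_box a b).
  move=> y; rewrite !normcM mulrC ler_wpM2r ?normc_ge0// normcC ger0_norm; last first.
    by apply: Rintegral_ge0 => w _; exact: normc_ge0.
  rewrite (le_trans (normc_cint_le _))//; first by apply: cL1_expi => //; exact: measurable_dot.
  by under eq_Rintegral do rewrite normcM normc_expi mul1r.
apply: box_determine => //.
- by apply: cmfunM => //; exact: cmfun_cst.
- move=> a b; apply: cL1_mod => //; first exact: cL1_cmfun (cL1_box a b).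
  move=> y; rewrite normcC.
  by have /andP[i0 i1] := indic01 (box a b) y; rewrite ger0_norm.
- by move=> a b; under eq_fun do rewrite mulrCA; exact: cL1Ml.
move=> a b; under [RHS]eq_cint do rewrite mulrCA.
rewrite cintMl// inversion_box// mulrA -rmorphM mulVf// mul1r.
by [].
Qed.

End inversion.

(** * Asymmetric fuzzy numbers *)

Section fuzzy_coordinates.
Context {R : realType}.
Variable A : R -> R.
Hypotheses (fuzzyA : fuzzy_number A) (asymA : asymmetric A).
Implicit Types (c d x y s b : R) (B : R -> R).

Let A01 x : 0 <= A x <= 1. Proof. exact: fuzzyA.1. Qed.

Lemma level_gt0 B alpha : 0 < alpha -> level B alpha = [set x | alpha <= B x].
Proof. by move=> a0; rewrite /level gt_eqF. Qed.

Lemma sup_levels (v : R) : 0 <= v <= 1 ->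
  sup [set alpha | 0 < alpha <= 1 /\ alpha <= v] = v.
Proof.
move=> /andP[v0 v1]; have [v_gt0|v_le0] := ltP 0 v.
  rewrite (_ : [set _ | _] = `]0, v]%classic); first by rewrite sup_itv// bnd_simp.
  apply/seteqP; split => a /=; rewrite in_itv/=; first by move=> [/andP[-> _] ->].
  by move=> /andP[-> av]; rewrite av (le_trans av v1).
rewrite (_ : [set _ | _] = set0); first by rewrite sup0; apply/le_anti/andP.
apply/seteqP; split => a //= -[/andP[a0 _] av].
by have := lt_le_trans a0 (le_trans av v_le0); rewrite ltxx.
Qed.

Lemma fuzzy_scaleE d : d != 0 -> fuzzy_scale d A = fun x => A (x / d).
Proof.
move=> d0; apply/funext => x; rewrite -[RHS](sup_levels (A01 (x / d))).
rewrite /fuzzy_scale /of_levels; congr sup; apply/seteqP; split => a /= [/andP[a0 a1]].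
  rewrite level_gt0// => -[y /= ay <-]; split; first exact/andP.
  by rewrite mulrC mulKf.
move=> ax; split; first exact/andP.
by rewrite level_gt0//; exists (x / d) => //; rewrite mulrC divfK.
Qed.

Lemma fuzzy_scale0 : fuzzy_scale 0 A = crisp 0.
Proof.
apply/funext => x.
have cr : 0 <= (crisp 0 x : R) <= 1 by rewrite /crisp indicE ler0n lern1 leq_b1.
rewrite -[RHS](sup_levels cr) /fuzzy_scale /of_levels; congr sup.
apply/seteqP; split => a /= [/andP[a0 a1]].
  move=> [y _ <-]; split; first exact/andP.
  by rewrite mul0r /crisp indicE mem_set.
rewrite /crisp indicE; case: (boolP (x \in [set 0])) => [|_ /(lt_le_trans a0)].
  rewrite inE => -> _; split; first exact/andP.
  have [l [r [lr lE]]] := fuzzyA.2 a (introT andP (conj (ltW a0) a1)).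
  by exists l; rewrite ?mul0r// lE /= in_itv/= lexx.
by rewrite ltxx.
Qed.

Lemma fuzzy_add_crisp c B : (forall x, 0 <= B x <= 1) ->
  fuzzy_add (crisp c) B = fun x => B (x - c).
Proof.
move=> B01; apply/funext => x; rewrite -[RHS](sup_levels (B01 (x - c))).
rewrite /fuzzy_add /of_levels; congr sup; apply/seteqP; split => a /= [/andP[a0 a1]].
  rewrite !level_gt0// => -[y /= ay [z /= az <-]]; split; first exact/andP.
  move: ay; rewrite /crisp indicE; case: (boolP (y \in [set c])) => [|_].
    by rewrite inE => -> _; rewrite addrC addKr.
  by move=> /(lt_le_trans a0); rewrite ltxx.
move=> ax; split; first exact/andP.
rewrite !level_gt0//; exists c; first by rewrite /= /crisp indicE mem_set.
by exists (x - c) => //; rewrite addrC subrK.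
Qed.

(** The supremum of the levels of a membership value is that value, so the
    level-wise operations act on membership functions by substitution; the
    multiple by zero is the singleton 0 because all level sets are nonempty. *)
Lemma fuzzy_affineE c d : fuzzy_add (crisp c) (fuzzy_scale d A) =
  fun x => if d == 0 then \1_[set c] x else A ((x - c) / d).
Proof.
have [->|d0] := eqVneq d 0.
  rewrite fuzzy_scale0 fuzzy_add_crisp => [|x].
    apply/funext => x; rewrite /crisp !indicE.
    suff -> : (x - c \in [set 0]) = (x \in [set c]) by [].
    by apply/idP/idP; rewrite !inE/= => /eqP; rewrite ?subr_eq0 => /eqP // ->; rewrite subrr.
  by rewrite /crisp indicE ler0n lern1 leq_b1.
by rewrite fuzzy_scaleE// fuzzy_add_crisp.
Qed.

Lemma asymmetric_not_crisp p : ~ (forall x, A x = \1_[set p] x).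
Proof.
move=> Ap; have [x0] := asymA p; rewrite !Ap !indicE.
suff -> : (p - x0 \in [set p]) = (p + x0 \in [set p]) by rewrite eqxx.
apply/idP/idP; rewrite !inE/= => /eqP.
  by rewrite -[X in _ == X]addr0 (inj_eq (addrI p)) oppr_eq0 => /eqP ->; rewrite addr0.
by rewrite -[X in _ == X]addr0 (inj_eq (addrI p)) => /eqP ->; rewrite subr0.
Qed.

Lemma asymmetric_not_reflected b : ~ (forall y, A y = A (b - y)).
Proof.
move=> Ab; have [x0] := asymA (b / 2); rewrite Ab.
by rewrite (_ : b - (b / 2 - x0) = b / 2 + x0) ?eqxx//; field.
Qed.

(** A function invariant under [y |-> s * y + b] has invariant level intervals,
    and an affine map preserving an interval fixes or exchanges its endpoints.
    Unless s is 1 or -1, all levels reduce to the fixed point and A is crisp;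
    for [s = -1], A is symmetric about [b / 2]. Asymmetry excludes both cases, and
    for [s = 1] invariant bounded intervals force [b = 0]. *)
Lemma asymmetric_affine_invariant s b : s != 0 ->
  (forall y, A y = A (s * y + b)) -> s = 1 /\ b = 0.
Proof.
move=> s0 As.
have endpoints alpha l r : 0 < alpha -> l <= r -> level A alpha = `[l, r]%classic ->
    if 0 < s then s * l + b = l /\ s * r + b = r else s * l + b = r /\ s * r + b = l.
  move=> a0 lr lE.
  have inv y : (l <= y <= r) = (l <= s * y + b <= r).
    have h z : (l <= z <= r) = (alpha <= A z).
      have := congr1 (fun S : set R => S z) lE; rewrite level_gt0//= in_itv/=.
      by move=> E; apply/idP/idP; rewrite E.
    by rewrite !h -As.
  have il : l <= s * l + b <= r by rewrite -inv lexx lr.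
  have ir : l <= s * r + b <= r by rewrite -inv lexx lr.
  have jl : l <= (l - b) / s <= r by rewrite inv mulrC divfK// subrK lexx lr.
  have jr : l <= (r - b) / s <= r by rewrite inv mulrC divfK// subrK lexx lr.
  case: ltP => [s_gt0|s_le0].
    move: jl jr; rewrite !ler_pdivlMr// !ler_pdivrMr// ![_ * s]mulrC.
    by move: il ir => /andP[? ?] /andP[? ?] /andP[? ?] /andP[? ?]; split; lra.
  have s_lt0 : s < 0 by rewrite lt_neqAle s0.
  move: jl jr; rewrite !ler_ndivlMr// !ler_ndivrMr// ![_ * s]mulrC.
  by move: il ir => /andP[? ?] /andP[? ?] /andP[? ?] /andP[? ?]; split; lra.
have [s1|s_neq1] := eqVneq s 1.
  split => //; have [l [r [lr lE]]] := fuzzyA.2 1 (introT andP (conj ler01 (lexx 1))).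
  by have := endpoints 1 l r ltr01 lr lE; rewrite s1 ltr01 => -[]; lra.
have [sN1|s_neqN1] := eqVneq s (-1).
  exfalso; apply: (@asymmetric_not_reflected b) => y.
  by rewrite [LHS]As sN1 mulN1r addrC.
exfalso; pose p := b / (1 - s).
have s1 : 1 - s != 0 by rewrite subr_eq0 eq_sym.
have lvl alpha : 0 < alpha <= 1 -> forall x, (alpha <= A x) = (x == p).
  move=> /andP[a0 a1] x.
  have [l [r [lr lE]]] := fuzzyA.2 alpha (introT andP (conj (ltW a0) a1)).
  have [lp rp] : l = p /\ r = p.
    have fixp z : s * z + b = z -> z = p.
      move=> h; rewrite /p -[z in LHS](mulfK s1); congr (_ / _).
      by rewrite mulrBr mulr1 -{1}h; ring.
    have := endpoints alpha l r a0 lr lE; case: ifP => _ [h1 h2].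
      by split; exact: fixp.
    have lr_eq : l = r.
      have : (s + 1) * (l - r) = 0 by rewrite mulrBr !mulrDl; lra.
      move=> /eqP; rewrite mulf_eq0 subr_eq0 => /orP[|/eqP//].
      by rewrite addr_eq0 (negbTE s_neqN1).
    by move: h2; rewrite -lr_eq => /fixp ->.
  have := congr1 (fun S : set R => S x) lE; rewrite level_gt0//= in_itv/= lp rp.
  move=> E; apply/idP/eqP; first by rewrite E -eq_le => /eqP.
  by move=> xp; rewrite E xp lexx.
apply: (@asymmetric_not_crisp p) => x; rewrite indicE.
case: (boolP (x \in [set p])) => [|/negP]; rewrite inE/=.
  move=> /eqP; rewrite -(lvl 1) ?ltr01 ?lexx// => h.
  by apply/le_anti; rewrite h; have /andP[_ ->] := A01 x.
move=> /eqP xp; apply/le_anti; have /andP[A0 A1] := A01 x; rewrite A0 andbT leNgt.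
apply/negP => A_gt0; have := lvl (A x); rewrite A_gt0 A1 => /(_ isT x).
by rewrite lexx (negbTE xp).
Qed.

(** If neither multiple is crisp, A is invariant under the affine map
    [y |-> (d * y + c - c') / d'], which is the identity by asymmetry. *)
Lemma fuzzy_affine_inj c d c' d' :
  fuzzy_add (crisp c) (fuzzy_scale d A) = fuzzy_add (crisp c') (fuzzy_scale d' A) ->
  c = c' /\ d = d'.
Proof.
have crispN c1 c2 d2 : d2 != 0 ->
    (fun x => \1_[set c1] x) <> (fun x => A ((x - c2) / d2)).
  move=> d20 h; apply: (@asymmetric_not_crisp ((c1 - c2) / d2)) => y.
  have := congr1 (fun F : R -> R => F (d2 * y + c2)) h; rewrite /= addrK.
  rewrite [d2 * y]mulrC mulfK// => <-; rewrite !indicE.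
  suff -> : (y * d2 + c2 \in [set c1]) = (y \in [set (c1 - c2) / d2]) by [].
  apply/idP/idP; rewrite !inE/=; first by move=> <-; rewrite addrK mulfK.
  by move=> ->; rewrite divfK// subrK.
rewrite !fuzzy_affineE.
have [->|d0] := eqVneq d 0; have [->|d'0] := eqVneq d' 0.
- move=> /(congr1 (fun F : R -> R => F c)); rewrite !indicE mem_set//.
  case: (boolP (c \in [set c'])) => [|_ /eqP]; first by rewrite inE.
  by rewrite oner_eq0.
- by move=> /(crispN _ _ _ d'0).
- by move=> /esym/(crispN _ _ _ d0).
move=> h; have sd : d / d' != 0 by rewrite mulf_neq0// invr_eq0.
have [] := asymmetric_affine_invariant (b := (c - c') / d') sd.
  move=> y; have := congr1 (fun F : R -> R => F (d * y + c)) h; rewrite /= addrK.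
  rewrite [d * y]mulrC mulfK// => ->; congr A; field.
  exact: d'0.
move=> /(congr1 (fun z => z * d')); rewrite divfK// mul1r => ->.
move=> /(congr1 (fun z => z * d')); rewrite divfK// mul0r => /eqP.
by rewrite subr_eq0 => /eqP.
Qed.

Lemma psi_inj : injective (psi A).
Proof.
move=> [u v] [u' v'] [/fuzzy_affine_inj[ur vr] /fuzzy_affine_inj[ui vi]].
by congr pair; apply: complexP.
Qed.

Lemma coords_lin u v : coords (lin A u v) = (u, v).
Proof. by apply: psi_inj; rewrite /coords; case: cid. Qed.

Lemma ucoord_lin u v : ucoord (lin A u v) = u.
Proof. by rewrite /ucoord coords_lin. Qed.

Lemma vcoord_lin u v : vcoord (lin A u v) = v.
Proof. by rewrite /vcoord coords_lin. Qed.

End fuzzy_coordinates.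

Lemma lin_coords {R : realType} {A : R -> R} (Z : CFA A) :
  lin A (ucoord Z) (vcoord Z) = Z.
Proof.
case: Z => Z HZ; rewrite /lin /ucoord /vcoord -surjective_pairing.
by apply: eq_exist; rewrite /coords; case: cid.
Qed.

Lemma cfa_eq {R : realType} {A : R -> R} (Z W : CFA A) :
  ucoord Z = ucoord W -> vcoord Z = vcoord W -> Z = W.
Proof. by move=> eu ev; have := lin_coords Z; rewrite eu ev lin_coords. Qed.

(** * Limits and linear combinations of transforms *)

Section combinations.
Context {d : measure_display} {T : measurableType d} {R : realType}.
Implicit Types (f g h : T -> R[i]) (mu : {measure set T -> \bar R}).

(** Both coordinates of the cross product, and hence of all the expressions below,
    have the shape [f + (a * g + b * h)]. *)
Lemma cL1_comb mu f g h (a b : R[i]) : cL1 mu f -> cL1 mu g -> cL1 mu h ->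
  cL1 mu (fun x => f x + (a * g x + b * h x)).
Proof. by move=> ? ? ?; apply: cL1D => //; apply: cL1D; exact: cL1Ml. Qed.

Lemma cint_comb mu f g h (a b : R[i]) : cL1 mu f -> cL1 mu g -> cL1 mu h ->
  cint mu (fun x => f x + (a * g x + b * h x)) =
  cint mu f + (a * cint mu g + b * cint mu h).
Proof.
move=> L1f L1g L1h; have L1ag := cL1Ml a L1g; have L1bh := cL1Ml b L1h.
by rewrite cintD//; [rewrite cintD// !cintMl|exact: cL1D].
Qed.

End combinations.

Lemma fhat_comb {R : realType} {n : nat} (f g h : 'rV[R]_n -> R[i]) (a b : R[i]) w :
  cL1 (lebesgue_rV R n) f -> cL1 (lebesgue_rV R n) g -> cL1 (lebesgue_rV R n) h ->
  fhat (fun x => f x + (a * g x + b * h x)) w =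
  fhat f w + (a * fhat g w + b * fhat h w).
Proof.
move=> L1f L1g L1h; have L1ag := cL1Ml a L1g; have L1bh := cL1Ml b L1h.
by rewrite fhatD//; [rewrite fhatD// !fhatZ|exact: cL1D].
Qed.

Section ccvg.
Context {R : realType}.

Definition ccvg {T : Type} (FF : set_system T) (h : T -> R[i]) (l : R[i]) :=
  (fun t => normc (h t - l)) @ FF --> (0 : R).

Lemma ccvg_Re {T : Type} (FF : set_system T) {_ : Filter FF} (h : T -> R[i]) l :
  ccvg FF h l -> (fun t => Re (h t)) @ FF --> Re l.
Proof.
move=> /cvgr0Pnorm_le hl; apply/cvgrPdist_le => e e0.
apply: filterS (hl e e0) => t; apply: le_trans.
by rewrite distrC -ReN -ReD normr_normc Re_le_normc.
Qed.

Lemma ccvg_Im {T : Type} (FF : set_system T) {_ : Filter FF} (h : T -> R[i]) l :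
  ccvg FF h l -> (fun t => Im (h t)) @ FF --> Im l.
Proof.
move=> /cvgr0Pnorm_le hl; apply/cvgrPdist_le => e e0.
apply: filterS (hl e e0) => t; apply: le_trans.
by rewrite distrC -ImN -ImD normr_normc Im_le_normc.
Qed.

End ccvg.

Section fhat_limits.
Context {R : realType} {n : nat}.
Local Notation mu := (lebesgue_rV R n).
Local Notation E := 'rV[R]_n.
Implicit Types (f g : E -> R[i]).

Lemma at_infinity_filter : Filter (@at_infinity R n).
Proof.
split=> [|P Q [M MP] [N NQ]|P Q PQ [M MP]]; first by exists 0.
  exists (Num.max M N) => w; rewrite gt_max => /andP[Mw Nw].
  by split; [exact: MP|exact: NQ].
by exists M => w /MP; exact: PQ.
Qed.

Lemma fhat_cvg f x : cL1 mu f -> ccvg (nbhs x) (fhat f) (fhat f x).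
Proof.
move=> L1f; apply/cvgr0Pnorm_le => e e0.
have [d d0 fd] := fhat_unif_continuous L1f e0.
apply/nbhs_ballP; exists d => // y [_ xy].
rewrite normr_normc -[y](subrK x) [y - x + x]addrC; apply: fd => i.
by have := xy ord0 i; rewrite /ball /= distrC !mxE => /ltW.
Qed.

Lemma fhat_cvg_infty f : cL1 mu f -> ccvg (@at_infinity R n) (fhat f) 0.
Proof.
move=> L1f; apply/(@cvgr0Pnorm_le _ _ _ _ at_infinity_filter) => e e0.
have [M fM] := riemann_lebesgue L1f e0; exists M => w Mw.
rewrite subr0 normr_normc; apply: fM; exact: lt_le_trans Mw (enorm_le_l1norm w).
Qed.

Lemma fhat_ae_eq f g w : cmfun f -> cmfun g ->
  (\forall x \ae mu, f x = g x) -> fhat f w = fhat g w.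
Proof.
move=> mf mg fg; apply: ae_eq_cint.
- by apply: cmfunM => //; apply: cmfun_expi; exact: measurable_Ndot.
- by apply: cmfunM => //; apply: cmfun_expi; exact: measurable_Ndot.
- by apply: filterS fg => x ->.
Qed.

(** The convolution of fuzzy-valued functions is only almost everywhere the
    combination of scalar convolutions given by the cross product, namely where
    the latter are absolutely convergent. *)
Lemma cL1_ae_eq f g : cmfun f -> cL1 mu g ->
  (\forall x \ae mu, f x = g x) -> cL1 mu f.
Proof.
move=> mf /cL1P[mg goo] fg; apply/cL1P; split => //.
rewrite (ae_eq_integral (fun x => (normc (g x))%:E))//.
- by apply/measurable_EFinP; exact: cmfun_normc.
- by apply/measurable_EFinP; exact: cmfun_normc.
- by apply: filterS fg => x -> _.
Qed.

End fhat_limits.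

Section derivatives_along_lines.
Context {R : realType} {n : nat}.
Local Notation E := 'rV[R]_n.
Implicit Types (f : E -> R[i]).

Lemma is_derive_of_cvg (g : R -> R) (s l : R) :
  (fun t => t^-1 * (g (t + s) - g s)) @ 0^' --> l -> is_derive s (1 : R) g l.
Proof.
move=> gl; have E : (fun h : R => h^-1 *: (g (h *: (1 : R) + s) - g s)) @ 0^' --> l.
  by under eq_fun do rewrite [_%:A]mulr1.
by split; [apply/cvg_ex; exists l|exact: cvg_lim E].
Qed.

(** Difference quotients at every point of the line, in its direction, are the
    difference quotients of the restriction to the line. *)
Lemma cderiv_of_ccvg f f' (xi e : E) :
  (forall y, ccvg (0^' : set_system R) (fun t => (t^-1)%:C * (f (y + t *: e) - f y)) (f' y)) ->
  cderiv (fun s => f (xi + s *: e)) (fun s => f' (xi + s *: e)).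
Proof.
move=> ff' s; have h := ff' (xi + s *: e).
have line t : xi + (t + s) *: e = xi + s *: e + t *: e.
  by rewrite scalerDl [t *: e + _]addrC addrA.
split; apply: is_derive_of_cvg.
  rewrite (_ : (fun _ => _) = fun t => Re ((t^-1)%:C *
      (f (xi + s *: e + t *: e) - f (xi + s *: e)))); first exact: ccvg_Re h.
  apply/funext => t.
  by rewrite line ReM ReC ImC mul0r subr0 ReD ReN.
rewrite (_ : (fun _ => _) = fun t => Im ((t^-1)%:C *
      (f (xi + s *: e + t *: e) - f (xi + s *: e)))); first exact: ccvg_Im h.
  apply/funext => t.
by rewrite line ImM ReC ImC mul0r addr0 ImD ImN.
Qed.

Lemma continuous_line (xi : E) (j : 'I_n) :
  continuous (fun s : R => xi + s *: delta_mx ord0 j : E).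
Proof.
move=> s B /nbhs_ballP[e /= e0 sB]; apply/nbhs_ballP; exists e => // t st.
apply: sB; split => // i k; move: st; rewrite /ball /= !mxE => st.
have -> : xi i k + s * ((i == ord0) && (k == j))%:R -
    (xi i k + t * ((i == ord0) && (k == j))%:R) = (s - t) * ((i == ord0) && (k == j))%:R by ring.
by rewrite normrM; case: (_ && _); rewrite /= ?normr1 ?mulr1// normr0 mulr0.
Qed.

Lemma ccontinuous_line f (xi : E) (j : 'I_n) :
  (forall y, ccvg (nbhs y) f (f y)) ->
  ccontinuous (fun s => f (xi + s *: delta_mx ord0 j)).
Proof.
move=> cf; split => s.
  exact: (@cvg_comp _ _ _ _ (fun y => Re (f y)) _ _ _ (@continuous_line xi j s) (ccvg_Re (cf _))).
exact: (@cvg_comp _ _ _ _ (fun y => Im (f y)) _ _ _ (@continuous_line xi j s) (ccvg_Im (cf _))).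
Qed.

Lemma cderiv_unique (u u1 u2 : R -> R[i]) : cderiv u u1 -> cderiv u u2 -> u1 =1 u2.
Proof.
move=> d1 d2 s; have [[_ r1] [_ i1]] := d1 s; have [[_ r2] [_ i2]] := d2 s.
by apply: complexP; [rewrite -r1 -r2|rewrite -i1 -i2].
Qed.

End derivatives_along_lines.

(** * Coordinates on the complex fuzzy numbers *)

Section cfa_fourier.
Context {R : realType} {A : R -> R}.
Hypotheses (fuzzyA : fuzzy_number A) (asymA : asymmetric A).
Local Notation m := ((mid A)%:C).
Implicit Types (Z W : CFA A) (c : R[i]).

(** In the coordinates [u + mid A * v] and [v], the norms are plain lp norms. *)
Definition pcoord Z : R[i] := ucoord Z + m * vcoord Z.

Lemma ucoord_scale c Z : ucoord (cfa_scale c Z) = c * ucoord Z.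
Proof. exact: ucoord_lin. Qed.

Lemma vcoord_scale c Z : vcoord (cfa_scale c Z) = c * vcoord Z.
Proof. exact: vcoord_lin. Qed.

Lemma ucoord_add Z W : ucoord (Z (+) W) = ucoord Z + ucoord W.
Proof. exact: ucoord_lin. Qed.

Lemma vcoord_add Z W : vcoord (Z (+) W) = vcoord Z + vcoord W.
Proof. exact: vcoord_lin. Qed.

Lemma ucoord_cross Z W : ucoord (Z (.) W) =
  ucoord Z * ucoord W - m ^+ 2 * (vcoord Z * vcoord W).
Proof. exact: ucoord_lin. Qed.

Lemma vcoord_cross Z W : vcoord (Z (.) W) =
  ucoord Z * vcoord W + ucoord W * vcoord Z + 2 * m * (vcoord Z * vcoord W).
Proof. exact: vcoord_lin. Qed.

Lemma ucoord_sub Z W : ucoord (Z (-) W) = ucoord Z - ucoord W.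
Proof. by rewrite ucoord_add ucoord_scale mulN1r. Qed.

Lemma vcoord_sub Z W : vcoord (Z (-) W) = vcoord Z - vcoord W.
Proof. by rewrite vcoord_add vcoord_scale mulN1r. Qed.

Lemma pnorm1E Z : pnorm 1 Z = normc (pcoord Z) + normc (vcoord Z).
Proof. by rewrite /pnorm invr1 !powRr1 ?addr_ge0 ?normc_ge0. Qed.

Lemma pnorm2E Z : pnorm 2 Z `^ 2 = normc (pcoord Z) ^+ 2 + normc (vcoord Z) ^+ 2.
Proof.
rewrite /pnorm -powRrM mulVf ?pnatr_eq0// !powR_mulrn ?normc_ge0//.
by rewrite powRr1// addr_ge0// sqr_ge0.
Qed.

Lemma inftynorm_sub Z W : inftynorm (Z (-) W) =
  Num.max (normc (pcoord Z - pcoord W)) (normc (vcoord Z - vcoord W)).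
Proof.
by rewrite /inftynorm ucoord_sub vcoord_sub /pcoord; congr (Num.max (normc _) _); ring.
Qed.

(** The coordinate changes between (u, v) and [(pcoord, v)] are bounded, with norm
    at most [1 + normc (mid A)%:C]. *)
Lemma cfa_cvgP {T : Type} (FF : set_system T) {_ : Filter FF} (H : T -> CFA A) L :
  cfa_cvg FF H L <-> ccvg FF (fun t => ucoord (H t)) (ucoord L) /\
                     ccvg FF (fun t => vcoord (H t)) (vcoord L).
Proof.
have k0 : 0 <= 1 + normc m by rewrite addr_ge0// normc_ge0.
split=> [cH|[cu cv]].
  split.
    have ch : (fun t => (1 + normc m) * inftynorm (H t (-) L)) @ FF --> (0 : R).
      by rewrite -[X in _ --> X](mulr0 (1 + normc m)); apply: cvgM => //; exact: cvg_cst.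
    apply: squeeze_cvgr (cvg_cst (0 : R)) ch; apply: nearW => t.
    rewrite normc_ge0 /= inftynorm_sub mulrDl mul1r.
    have -> : ucoord (H t) - ucoord L =
        (pcoord (H t) - pcoord L) + - (m * (vcoord (H t) - vcoord L)).
      by rewrite /pcoord; ring.
    rewrite (le_trans (normc_tri _ _))// normc_opp normcM lerD//.
      by rewrite le_max lexx.
    by rewrite ler_wpM2l ?normc_ge0// le_max lexx orbT.
  apply: squeeze_cvgr (cvg_cst (0 : R)) cH; apply: nearW => t.
  by rewrite normc_ge0 /= inftynorm_sub le_max lexx orbT.
have ch : (fun t => normc (ucoord (H t) - ucoord L) +
    (1 + normc m) * normc (vcoord (H t) - vcoord L)) @ FF --> (0 : R).
  rewrite -[X in _ --> X]addr0 -[X in _ --> _ + X](mulr0 (1 + normc m)).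
  by apply: cvgD => //; apply: cvgM => //; exact: cvg_cst.
apply: squeeze_cvgr (cvg_cst (0 : R)) ch; apply: nearW => t.
rewrite inftynorm_sub le_max normc_ge0 /= ge_max; apply/andP; split.
  have -> : pcoord (H t) - pcoord L =
      (ucoord (H t) - ucoord L) + m * (vcoord (H t) - vcoord L).
    by rewrite /pcoord; ring.
  rewrite (le_trans (normc_tri _ _))// lerD2l normcM mulrDl mul1r lerDr.
  exact: normc_ge0.
rewrite mulrDl mul1r addrCA lerDl addr_ge0 ?normc_ge0//.
by rewrite mulr_ge0 ?normc_ge0.
Qed.

Context {n : nat}.
Local Notation mu := (lebesgue_rV R n).
Local Notation E := 'rV[R]_n.
Implicit Types (F G : E -> CFA A) (f : E -> R[i]).

Lemma cmfun_pcoord F : cmfun (fun x => ucoord (F x)) ->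
  cmfun (fun x => vcoord (F x)) -> cmfun (fun x => pcoord (F x)).
Proof. by move=> mu' mv; apply: cmfunD => //; apply: cmfunM => //; exact: cmfun_cst. Qed.

Lemma fLnorm1E F : cmfun (fun x => ucoord (F x)) -> cmfun (fun x => vcoord (F x)) ->
  fLnorm 1 F = (\int[mu]_x (normc (pcoord (F x)))%:E +
                \int[mu]_x (normc (vcoord (F x)))%:E)%E.
Proof.
move=> mF mv; have mp := cmfun_pcoord mF mv; rewrite /fLnorm Lnorm1.
rewrite -ge0_integralD//; last 4 first.
- by move=> x _; rewrite lee_fin normc_ge0.
- by apply/measurable_EFinP; exact: cmfun_normc.
- by move=> x _; rewrite lee_fin normc_ge0.
- by apply/measurable_EFinP; exact: cmfun_normc.
apply: eq_integral => x _; rewrite pnorm1E -EFinD /= ger0_norm//.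
by rewrite addr_ge0 ?normc_ge0.
Qed.

(** Integrability for the norm is integrability of [pcoord] and v, and u is the
    combination [pcoord - mid A * v]. *)
Lemma Lpspace1P F : Lpspace 1 F <->
  cL1 mu (fun x => ucoord (F x)) /\ cL1 mu (fun x => vcoord (F x)).
Proof.
split=> [[[mF mv]]|[L1u L1v]].
  have mp := cmfun_pcoord mF mv.
  have I0 (f : E -> R[i]) : (0 <= \int[mu]_x (normc (f x))%:E)%E.
    by apply: integral_ge0 => x _; rewrite lee_fin normc_ge0.
  rewrite fLnorm1E// => foo.
  have L1v : cL1 mu (fun x => vcoord (F x)).
    by apply/cL1P; split => //; apply: le_lt_trans foo; rewrite leeDr.
  have L1p : cL1 mu (fun x => pcoord (F x)).
    by apply/cL1P; split => //; apply: le_lt_trans foo; rewrite leeDl.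
  split=> //; have := cL1B L1p (cL1Ml m L1v).
  by rewrite /pcoord; under eq_fun do rewrite addrK.
have mF := cL1_cmfun L1u; have mv := cL1_cmfun L1v.
split; first by split.
have L1p : cL1 mu (fun x => pcoord (F x)) by apply: cL1D => //; exact: cL1Ml.
rewrite fLnorm1E// lte_add_pinfty//.
  by have [] := (cL1P _ _).1 L1p.
by have [] := (cL1P _ _).1 L1v.
Qed.

Lemma fLnorm2E F : cmfun (fun x => ucoord (F x)) -> cmfun (fun x => vcoord (F x)) ->
  fLnorm 2 F = ((\int[mu]_x (normc (pcoord (F x)) ^+ 2)%:E +
                 \int[mu]_x (normc (vcoord (F x)) ^+ 2)%:E) `^ 2^-1)%E.
Proof.
move=> mF mv; have mp := cmfun_pcoord mF mv; rewrite /fLnorm unlock.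
have msq f : cmfun f -> measurable_fun setT (fun x : E => (normc (f x) ^+ 2)%:E).
  by move=> mf; apply/measurable_EFinP/measurable_funX; exact: cmfun_normc.
rewrite -ge0_integralD//; last 4 first.
- by move=> x _; rewrite lee_fin sqr_ge0.
- exact: msq.
- by move=> x _; rewrite lee_fin sqr_ge0.
- exact: msq.
congr (_ `^ _)%E; apply: eq_integral => x _.
by rewrite -EFinD -pnorm2E /= ger0_norm// powR_ge0.
Qed.

(** * The Fourier transform of fuzzy-valued functions *)

Lemma ucoord_fintegral F : ucoord (fintegral F) = cint mu (fun x => ucoord (F x)).
Proof. exact: ucoord_lin. Qed.

Lemma vcoord_fintegral F : vcoord (fintegral F) = cint mu (fun x => vcoord (F x)).
Proof. exact: vcoord_lin. Qed.

Lemma ucoord_fourier F w : ucoord (fourier F w) = fhat (fun x => ucoord (F x)) w.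
Proof.
by rewrite (ucoord_lin fuzzyA asymA); apply: eq_cint => x; rewrite /= (ucoord_lin fuzzyA asymA).
Qed.

Lemma vcoord_fourier F w : vcoord (fourier F w) = fhat (fun x => vcoord (F x)) w.
Proof.
by rewrite (vcoord_lin fuzzyA asymA); apply: eq_cint => x; rewrite /= (vcoord_lin fuzzyA asymA).
Qed.

Lemma fourier_eq F w Z : fhat (fun x => ucoord (F x)) w = ucoord Z ->
  fhat (fun x => vcoord (F x)) w = vcoord Z -> fourier F w = Z.
Proof. by rewrite -ucoord_fourier -vcoord_fourier; exact: cfa_eq. Qed.

Lemma pcoord_fourier F w : Lpspace 1 F ->
  pcoord (fourier F w) = fhat (fun x => pcoord (F x)) w.
Proof.
move=> /Lpspace1P[L1u L1v].
by rewrite /pcoord fhatD ?fhatZ ?ucoord_fourier ?vcoord_fourier//; exact: cL1Ml.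
Qed.

Lemma cL1_pcoord F : Lpspace 1 F -> cL1 mu (fun x => pcoord (F x)).
Proof. by move=> /Lpspace1P[L1u L1v]; apply: cL1D => //; exact: cL1Ml. Qed.

Lemma fourier_continuous F : Lpspace 1 F -> fcontinuous (fourier F).
Proof.
move=> /Lpspace1P[L1u L1v] x; apply/cfa_cvgP.
have eu t := ucoord_fourier F t; have ev t := vcoord_fourier F t.
by split; [rewrite (funext eu) eu|rewrite (funext ev) ev]; exact: fhat_cvg.
Qed.

Lemma fourier_cvg_infty F : Lpspace 1 F -> cfa_cvg at_infinity (fourier F) cfa0.
Proof.
move=> /Lpspace1P[L1u L1v].
apply/(@cfa_cvgP _ _ at_infinity_filter).
rewrite (ucoord_lin fuzzyA asymA) (vcoord_lin fuzzyA asymA).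
under eq_fun do rewrite ucoord_fourier; under [X in _ /\ ccvg _ X _]eq_fun do rewrite vcoord_fourier.
by split; exact: fhat_cvg_infty.
Qed.

(** At each point, either coordinate of the transform is bounded by the integral
    of its norm, hence by the sum of both integrals. *)
Lemma supnorm_fourier_le F : Lpspace 1 F -> (supnorm (fourier F) <= fLnorm 1 F)%E.
Proof.
move=> L1F; have L1p := cL1_pcoord L1F.
have [L1u L1v] := (Lpspace1P F).1 L1F.
apply: ub_ereal_sup => _ [w _ <-].
rewrite fLnorm1E; [|exact: cL1_cmfun L1u|exact: cL1_cmfun L1v].
have I0 (f : E -> R[i]) : (0 <= \int[mu]_x (normc (f x))%:E)%E.
  by apply: integral_ge0 => x _; rewrite lee_fin normc_ge0.
have le_fhat f : cL1 mu f -> ((normc (fhat f w))%:E <= \int[mu]_x (normc (f x))%:E)%E.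
  move=> L1f; apply: le_trans (normc_cint_lee (cL1_fhat w L1f)) _.
  by under eq_integral do rewrite normcM normc_expi mul1r.
rewrite /inftynorm -/(pcoord (fourier F w)) pcoord_fourier// vcoord_fourier EFin_max.
rewrite ge_max; apply/andP; split.
  by apply: le_trans (le_fhat _ L1p) _; rewrite leeDl.
by apply: le_trans (le_fhat _ L1v) _; rewrite leeDr.
Qed.

Lemma fourier_dilate F (t : R) : t != 0 -> Lpspace 1 F ->
  Lpspace 1 (fun xi => F (t^-1 *: xi)) /\
  forall w, fourier (fun xi => F (t^-1 *: xi)) w
            = cfa_scale (`|t%:C| ^+ n) (fourier F (t *: w)).
Proof.
move=> t0 /Lpspace1P[L1u L1v].
have t0' : t^-1 != 0 by rewrite invr_eq0.
have aff f : cL1 mu f -> cL1 mu (fun x => f (t^-1 *: x)).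
  by move=> /(cL1_affine 0 t0'); under eq_fun do rewrite addr0.
split; first by apply/Lpspace1P; split; [exact: (aff _ L1u)|exact: (aff _ L1v)].
have tn : `|t%:C| ^+ n = (`|t| ^+ n)%:C :> R[i].
  by rewrite rmorphXn normc_def /= expr0n addr0 sqrtr_sqr.
move=> w; apply: fourier_eq.
  by rewrite ucoord_scale ucoord_fourier tn; exact: (fhat_dilate w t0 L1u).
by rewrite vcoord_scale vcoord_fourier tn; exact: (fhat_dilate w t0 L1v).
Qed.

Lemma fourier_modulate F x : Lpspace 1 F ->
  Lpspace 1 (fun xi => cfa_scale (expi (dot x xi)) (F xi)) /\
  forall w, fourier (fun xi => cfa_scale (expi (dot x xi)) (F xi)) w
            = fourier F (w - x).
Proof.
move=> /Lpspace1P[L1u L1v]; split.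
  apply/Lpspace1P.
  rewrite (eq_fun (fun xi => ucoord_scale _ (F xi))) (eq_fun (fun xi => vcoord_scale _ (F xi))).
  by split; apply: cL1_expi => //; apply: measurable_dot.
move=> w; apply: fourier_eq.
  rewrite ucoord_fourier -fhat_modulate; apply: eq_cint => y; congr (_ * _).
  exact: ucoord_scale.
rewrite vcoord_fourier -fhat_modulate; apply: eq_cint => y; congr (_ * _).
exact: vcoord_scale.
Qed.

Lemma fourier_shift F x : Lpspace 1 F ->
  Lpspace 1 (fun xi => F (xi - x)) /\
  forall w, fourier (fun xi => F (xi - x)) w
            = cfa_scale (expi (- dot x w)) (fourier F w).
Proof.
move=> /Lpspace1P[L1u L1v]; split.
  by apply/Lpspace1P; split; [exact: (cL1_shift _ L1u)|exact: (cL1_shift _ L1v)].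
move=> w; apply: fourier_eq.
  by rewrite ucoord_scale ucoord_fourier; exact: (fhat_shift _ _ L1u).
by rewrite vcoord_scale vcoord_fourier; exact: (fhat_shift _ _ L1v).
Qed.

Lemma fourier_inverse F : Lpspace 1 F -> Lpspace 1 (fourier F) ->
  \forall xi \ae mu,
    F xi = cfa_scale ((2 * pi) ^- n)%:C
             (fintegral (fun w => cfa_scale (expi (dot w xi)) (fourier F w))).
Proof.
move=> /Lpspace1P[L1u L1v] /Lpspace1P.
under eq_fun do rewrite ucoord_fourier; under [X in _ /\ cL1 _ X]eq_fun do rewrite vcoord_fourier.
move=> [L1U L1V].
have := fourier_inversion L1v L1V; apply: filterS2 (fourier_inversion L1u L1U) => xi eu ev.
apply: cfa_eq.
  rewrite ucoord_scale ucoord_fintegral eu; congr (_ * _); apply: eq_cint => w.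
  by rewrite ucoord_scale ucoord_fourier.
rewrite vcoord_scale vcoord_fintegral ev; congr (_ * _); apply: eq_cint => w.
by rewrite vcoord_scale vcoord_fourier.
Qed.

Lemma fourier_affine F G B : Lpspace 1 F -> Lpspace 1 G ->
  Lpspace 1 (fun xi => F xi (+) B (.) G xi) /\
  forall w, fourier (fun xi => F xi (+) B (.) G xi) w
            = fourier F w (+) B (.) fourier G w.
Proof.
move=> /Lpspace1P[L1uF L1vF] /Lpspace1P[L1uG L1vG].
set bu := ucoord B; set bv := vcoord B.
have uE x : ucoord (F x (+) B (.) G x) =
    ucoord (F x) + (bu * ucoord (G x) + - (m ^+ 2 * bv) * vcoord (G x)).
  by rewrite ucoord_add ucoord_cross -/bu -/bv; ring.
have vE x : vcoord (F x (+) B (.) G x) =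
    vcoord (F x) + (bv * ucoord (G x) + (bu + 2 * m * bv) * vcoord (G x)).
  by rewrite vcoord_add vcoord_cross -/bu -/bv; ring.
split.
  apply/Lpspace1P; rewrite (eq_fun uE) (eq_fun vE).
  by split; exact: cL1_comb.
move=> w; have := vcoord_fourier G w; have := ucoord_fourier G w.
have := vcoord_fourier F w; have := ucoord_fourier F w.
move: (fourier F w) (fourier G w) => Z W uZ vZ uW vW; apply: fourier_eq.
  rewrite (eq_fun uE) fhat_comb// ucoord_add ucoord_cross -/bu -/bv.
  by rewrite uZ uW vW; ring.
rewrite (eq_fun vE) fhat_comb// vcoord_add vcoord_cross -/bu -/bv.
by rewrite vZ uW vW; ring.
Qed.

Lemma fourier_convolution F G : Lpspace 1 F -> Lpspace 1 G ->
  (\forall xi \ae mu, fintegrable (fun z => F z (.) G (xi - z))) /\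
  Lpspace 1 (convolution F G) /\
  forall w, fourier (convolution F G) w = fourier F w (.) fourier G w.
Proof.
move=> /Lpspace1P[L1uF L1vF] /Lpspace1P[L1uG L1vG].
pose uF x := ucoord (F x); pose vF x := vcoord (F x).
pose uG x := ucoord (G x); pose vG x := vcoord (G x).
(* The coefficients 0 and 1 give the two coordinates of the cross product the
   common shape [f + (a * g + b * h)]. *)
have uE xi z : ucoord (F z (.) G (xi - z)) = uF z * uG (xi - z) +
    (- m ^+ 2 * (vF z * vG (xi - z)) + 0 * (vF z * vG (xi - z))).
  by rewrite ucoord_cross /uF /uG /vF /vG; ring.
have vE xi z : vcoord (F z (.) G (xi - z)) = uF z * vG (xi - z) +
    (1 * (vF z * uG (xi - z)) + 2 * m * (vF z * vG (xi - z))).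
  by rewrite vcoord_cross /uF /uG /vF /vG; ring.
have ae4 : \forall xi \ae mu,
    [/\ cL1 mu (fun z => uF z * uG (xi - z)), cL1 mu (fun z => vF z * vG (xi - z)),
        cL1 mu (fun z => uF z * vG (xi - z)) & cL1 mu (fun z => vF z * uG (xi - z))].
  have h1 := ae_cL1_cconv L1uF L1uG; have h2 := ae_cL1_cconv L1vF L1vG.
  have h3 := ae_cL1_cconv L1uF L1vG; have h4 := ae_cL1_cconv L1vF L1uG.
  by apply: filterS2 (filterI h1 h2) (filterI h3 h4) => xi [? ?] [? ?]; split.
pose cu xi := cconv uF uG xi + (- m ^+ 2 * cconv vF vG xi + 0 * cconv vF vG xi).
pose cv xi := cconv uF vG xi + (1 * cconv vF uG xi + 2 * m * cconv vF vG xi).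
have uC xi : ucoord (convolution F G xi) = cint mu (fun z => uF z * uG (xi - z) +
    (- m ^+ 2 * (vF z * vG (xi - z)) + 0 * (vF z * vG (xi - z)))).
  by rewrite ucoord_fintegral; apply: eq_cint => z; exact: uE.
have vC xi : vcoord (convolution F G xi) = cint mu (fun z => uF z * vG (xi - z) +
    (1 * (vF z * uG (xi - z)) + 2 * m * (vF z * vG (xi - z)))).
  by rewrite vcoord_fintegral; apply: eq_cint => z; exact: vE.
have L1cu : cL1 mu cu by apply: cL1_comb; exact: cL1_cconv.
have L1cv : cL1 mu cv by apply: cL1_comb; exact: cL1_cconv.
have aeu : \forall xi \ae mu, ucoord (convolution F G xi) = cu xi.
  by apply: filterS ae4 => xi [? ? ? ?]; rewrite uC cint_comb.
have aev : \forall xi \ae mu, vcoord (convolution F G xi) = cv xi.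
  by apply: filterS ae4 => xi [? ? ? ?]; rewrite vC cint_comb.
have P1 := cL1_conv_prod L1uF L1uG; have P2 := cL1_conv_prod L1vF L1vG.
have P3 := cL1_conv_prod L1uF L1vG; have P4 := cL1_conv_prod L1vF L1uG.
have mcu : cmfun (fun xi => ucoord (convolution F G xi)).
  rewrite (eq_fun uC); exact: (cmfun_cint1 _ (cL1_cmfun (cL1_comb (- m ^+ 2) 0 P1 P2 P2))).
have mcv : cmfun (fun xi => vcoord (convolution F G xi)).
  rewrite (eq_fun vC); exact: (cmfun_cint1 _ (cL1_cmfun (cL1_comb 1 (2 * m) P3 P4 P2))).
split; [|split].
- apply: filterS ae4 => xi [? ? ? ?]; rewrite /fintegrable /comp.
  by rewrite (eq_fun (uE xi)) (eq_fun (vE xi)); split; exact: cL1_comb.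
- by apply/Lpspace1P; split; [exact: (cL1_ae_eq mcu L1cu)|exact: (cL1_ae_eq mcv L1cv)].
move=> w; have := vcoord_fourier G w; have := ucoord_fourier G w.
have := vcoord_fourier F w; have := ucoord_fourier F w.
move: (fourier F w) (fourier G w) => Z W uZ vZ uW vW; apply: fourier_eq.
  rewrite (fhat_ae_eq w mcu (cL1_cmfun L1cu) aeu) fhat_comb; [|exact: cL1_cconv..].
  by rewrite !fhat_cconv// ucoord_cross uZ vZ uW vW; ring.
rewrite (fhat_ae_eq w mcv (cL1_cmfun L1cv) aev) fhat_comb; [|exact: cL1_cconv..].
by rewrite !fhat_cconv// vcoord_cross uZ vZ uW vW; ring.
Qed.

(** Membership in C1 only provides some continuous partial derivative; it is
    the given one, since a limit of difference quotients is unique. *)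
Lemma fourier_partial F (j : 'I_n) (dF : E -> CFA A) : Lpspace 1 F -> C1 F ->
  is_partial j F dF -> Lpspace 1 dF ->
  forall w, fourier dF w = cfa_scale ('i%C * (w ord0 j)%:C) (fourier F w).
Proof.
move=> /Lpspace1P[L1u L1v] [dG dGP] dFP /Lpspace1P[L1du L1dv] w.
have [dGj cG] := dGP j.
have quot (dH : E -> CFA A) : is_partial j F dH ->
    (forall y, ccvg (0^' : set_system R) (fun t => (t^-1)%:C *
      (ucoord (F (y + t *: delta_mx ord0 j)) - ucoord (F y))) (ucoord (dH y))) /\
    (forall y, ccvg (0^' : set_system R) (fun t => (t^-1)%:C *
      (vcoord (F (y + t *: delta_mx ord0 j)) - vcoord (F y))) (vcoord (dH y))).
  move=> dH_; split => y; have /cfa_cvgP[hu hv] := dH_ y.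
    by under eq_fun do rewrite -ucoord_sub -ucoord_scale.
  by under eq_fun do rewrite -vcoord_sub -vcoord_scale.
have [qu qv] := quot _ dFP; have [qu' qv'] := quot _ dGj.
have line0 (xi : E) : xi + (0 : R) *: delta_mx ord0 j = xi by rewrite scale0r addr0.
have eu y : ucoord (dF y) = ucoord (dG j y).
  have := cderiv_unique (cderiv_of_ccvg y qu) (cderiv_of_ccvg y qu') 0.
  by rewrite line0.
have ev y : vcoord (dF y) = vcoord (dG j y).
  have := cderiv_unique (cderiv_of_ccvg y qv) (cderiv_of_ccvg y qv') 0.
  by rewrite line0.
have cu y : ccvg (nbhs y) (fun x => ucoord (dF x)) (ucoord (dF y)).
  by rewrite (funext eu) eu; have /cfa_cvgP[] := cG y.
have cv y : ccvg (nbhs y) (fun x => vcoord (dF x)) (vcoord (dF y)).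
  by rewrite (funext ev) ev; have /cfa_cvgP[] := cG y.
apply: fourier_eq.
  rewrite ucoord_scale// ucoord_fourier//; apply: fhat_partial => // xi.
    exact: cderiv_of_ccvg qu.
  exact: (ccontinuous_line _ _ cu).
rewrite vcoord_scale// vcoord_fourier//; apply: fhat_partial => // xi.
  exact: cderiv_of_ccvg qv.
exact: (ccontinuous_line _ _ cv).
Qed.

(** The square of the norm is the sum of the squares of the coordinates [pcoord]
    and v, each of which is transformed by the scalar transform; so the scalar
    constant carries over. *)
Lemma fourier_L2 F : Lpspace 1 F -> Lpspace 2 F ->
  Lpspace 2 (fourier F) /\
  (fLnorm 2 (fourier F) <= ((2 * pi) `^ (n%:R / 2))%:E * fLnorm 2 F)%E.
Proof.
move=> L1F [[mF mv] Foo]; have L1p := cL1_pcoord L1F.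
have [L1u L1v] := (Lpspace1P F).1 L1F.
have mF' : cmfun (fun w => ucoord (fourier F w)).
  by rewrite (funext (ucoord_fourier F)); exact: cmfun_fhat.
have mv' : cmfun (fun w => vcoord (fourier F w)).
  by rewrite (funext (vcoord_fourier F)); exact: cmfun_fhat.
have I0 f : (0 <= \int[mu]_x (normc (f x) ^+ 2)%:E)%E.
  by apply: integral_ge0 => x _; rewrite lee_fin sqr_ge0.
have pi2_0 : 0 <= 2 * pi :> R by rewrite mulr_ge0// pi_ge0.
have c0 : 0 <= (2 * pi) ^+ n :> R by rewrite exprn_ge0.
have le2 : (fLnorm 2 (fourier F) <= ((2 * pi) `^ (n%:R / 2))%:E * fLnorm 2 F)%E.
  rewrite !fLnorm2E//.
  have -> : (2 * pi) `^ (n%:R / 2) = ((2 * pi) ^+ n) `^ 2^-1 :> R.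
    by rewrite -powR_mulrn// -powRrM.
  rewrite -poweR_EFin -poweRM; [|by rewrite lee_fin|by apply: adde_ge0].
  have inE (y : \bar R) : (0 <= y)%E -> y \in `[0%E, +oo%E].
    by move=> y0; rewrite in_itv/= y0 leey.
  apply: gt0_ler_poweR; [by rewrite invr_ge0|by apply: inE; apply: adde_ge0| |].
    by apply: inE; apply: mule_ge0; [rewrite lee_fin|apply: adde_ge0].
  rewrite ge0_muleDr//; apply: leeD.
    apply: le_trans (plancherel_le L1p); rewrite le_eqVlt; apply/orP; left; apply/eqP.
    by apply: eq_integral => w _; rewrite pcoord_fourier.
  apply: le_trans (plancherel_le L1v); rewrite le_eqVlt; apply/orP; left; apply/eqP.
  by apply: eq_integral => w _; rewrite vcoord_fourier.
split; last exact: le2.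
split; first exact: (conj mF' mv').
by apply: le_lt_trans le2 _; apply: lte_mul_pinfty; [rewrite lee_fin powR_ge0| |exact: Foo].
Qed.

End cfa_fourier.

Theorem proposition5p2 (R : realType) (n : nat) (A : R -> R)
  (fuzzyA : fuzzy_number A) (asymA : asymmetric A)
  (F G : 'rV[R]_n -> CFA A) (L1F : Lpspace 1 F) (L1G : Lpspace 1 G)
  (a : R[i]) (B : CFA A) (x : 'rV[R]_n) :
  (* 1 *)
  (fcontinuous (fourier F) /\
   (supnorm (fourier F) <= fLnorm 1 F)%E /\
   cfa_cvg at_infinity (fourier F) cfa0) /\
  (* 2 *)
  (forall t : R, a = t%:C -> t != 0 ->
     Lpspace 1 (fun xi => F (t^-1 *: xi)) /\
     (forall w, fourier (fun xi => F (t^-1 *: xi)) w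
                = cfa_scale (`|a| ^+ n) (fourier F (t *: w))) /\
     (0 < a ^+ n ->
      forall w, fourier (fun xi => F (t^-1 *: xi)) w
                = cfa_scale (a ^+ n) (fourier F (t *: w)))) /\
  (* 3 *)
  (Lpspace 1 (fun xi => cfa_scale (expi (dot x xi)) (F xi)) /\
   forall w, fourier (fun xi => cfa_scale (expi (dot x xi)) (F xi)) w
             = fourier F (w - x)) /\
  (* 4 *)
  (Lpspace 1 (fun xi => F (xi - x)) /\
   forall w, fourier (fun xi => F (xi - x)) w
             = cfa_scale (expi (- dot x w)) (fourier F w)) /\
  (* 5 *)
  (C1 F -> forall (j : 'I_n) (dF : 'rV[R]_n -> CFA A),
     is_partial j F dF -> Lpspace 1 dF ->
     forall w, fourier dF w = cfa_scale ('i%C * (w ord0 j)%:C) (fourier F w)) /\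
  (* 6 *)
  (Lpspace 1 (fourier F) ->
     \forall xi \ae lebesgue_rV R n,
       F xi = cfa_scale ((2 * pi) ^- n)%:C
                (fintegral
                   (fun w => cfa_scale (expi (dot w xi)) (fourier F w)))) /\
  (* 7 *)
  (Lpspace 1 (fun xi => F xi (+) B (.) G xi) /\
   forall w, fourier (fun xi => F xi (+) B (.) G xi) w
             = fourier F w (+) B (.) fourier G w) /\
  (* 8 *)
  ((\forall xi \ae lebesgue_rV R n,
      fintegrable (fun z => F z (.) G (xi - z))) /\
   Lpspace 1 (convolution F G) /\
   forall w, fourier (convolution F G) w = fourier F w (.) fourier G w) /\
  (* 9 *)
  (Lpspace 2 F ->
     Lpspace 2 (fourier F) /\
     (fLnorm 2 (fourier F)
        <= ((2 * pi) `^ (n%:R / 2) * Num.sqrt 2)%:E * fLnorm 2 F)%E).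
Proof.
split; [split; [|split]|split; [|split; [|split; [|split; [|split; [|split; [|split]]]]]]].
- exact: (fourier_continuous fuzzyA asymA L1F).
- exact: (supnorm_fourier_le fuzzyA asymA L1F).
- exact: (fourier_cvg_infty fuzzyA asymA L1F).
- move=> t -> t0; have [L1t E] := fourier_dilate fuzzyA asymA t0 L1F.
  split=> [|]; first exact: L1t.
  split=> [w|tn w]; first exact: E.
  by rewrite E -normrX gtr0_norm.
- exact: (fourier_modulate fuzzyA asymA x L1F).
- exact: (fourier_shift fuzzyA asymA x L1F).
- move=> C1F j dF dFP L1dF.
  exact: (fourier_partial fuzzyA asymA L1F C1F dFP L1dF).
- exact: (fourier_inverse fuzzyA asymA L1F).
- exact: (fourier_affine fuzzyA asymA B L1F L1G).
- exact: (fourier_convolution fuzzyA asymA L1F L1G).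
- move=> L2F; have [L2F' le2] := fourier_L2 fuzzyA asymA L1F L2F.
  split; first exact: L2F'.
  apply: (le_trans le2); rewrite EFinM muleAC.
  rewrite -[leLHS]mule1; apply: lee_wpmul2l.
    by apply: mule_ge0; [rewrite lee_fin powR_ge0|exact: Lnorm_ge0].
  by rewrite lee_fin -[leLHS]sqrtr1 ler_wsqrtr// ler1n.
Qed.
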